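(* Let $S$ be a smooth surface. There exist an element $f\in\mathrm{Homeo}^1(S)\setminus\mathrm{Diff}^1(S)$, points $p_1,p_2\in S$, and a sequence $(q_n)_{n\in\mathbb{N}}$ of pairwise distinct points of $S$ such that (i) $f(p_1)=p_1$ and $\bar{d}f_{p_1}$ is the identity, but $f$ is not differentiable at $p_1$; (ii) the pushforward map $df_{p_2}:T_{p_2}S\to T_{f(p_2)}S$ is well-defined and maps every element of $T_{p_2}S$ to $0$; (iii) $\bar{d}f:\mathbb{P}TS\to\mathbb{P}TS$ is not continuous; and (iv) $f$ is not differentiable at $q_n$, for all $n\in\mathbb{N}$.
   Context: A $C^1$ curve in a smooth surface $S$ is a simple closed curve in $S$ that is a properly embedded one-dimensional $C^1$ submanifold; equivalently, the image of a continuously differentiable injective map $\gamma:S^1\to S$ with $\gamma'(t)\neq 0$ for all $t\in S^1$. $\mathrm{Homeo}^1(S)$ is the set of homeomorphisms $f$ of $S$ such that both $f$ and $f^{-1}$ map every $C^1$ curve to a $C^1$ curve. $\mathrm{Diff}^1(S)$ is the group of $C^1$ diffeomorphisms of $S$. $\mathbb{P}T_pS$ is the projectivization of $T_pS$ and $\mathbb{P}TS$ is the projective tangent bundle, with points $(p,\ell)$, $p\in S$, $\ell\in\mathbb{P}T_pS$. Every $f\in\mathrm{Homeo}^1(S)$ sends $C^1$ curves with the same tangent line at $p$ to $C^1$ curves with the same tangent line at $f(p)$; the induced map $\bar{d}f_p:\mathbb{P}T_pS\to\mathbb{P}T_{f(p)}S$ sends the tangent line at $p$ of a $C^1$ curve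 $\alpha$ through $p$ to the tangent line at $f(p)$ of $f(\alpha)$, and $\bar{d}f:\mathbb{P}TS\to\mathbb{P}TS$ is $(p,\ell)\mapsto(f(p),\bar{d}f_p(\ell))$. The pushforward $df_p$ is well-defined if for each $v\in T_pS$ and each $C^1$ path $c$ with $c(0)=p$, $c'(0)=v$, the derivative $(f\circ c)'(0)$ exists and depends only on $v$; then $df_p(v)=(f\circ c)'(0)$. *)

(* Defs.v *)
From HB Require Import structures.
From mathcomp Require Import all_boot all_order all_algebra.
From mathcomp Require Import all_classical all_reals all_analysis.

Set Implicit Arguments.
Unset Strict Implicit.
Unset Printing Implicit Defensive.

Import Order.TTheory GRing.Theory Num.Theory.
Import numFieldNormedType.Exports.

Local Open Scope classical_set_scope.
Local Open Scope ring_scope.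

Notation plane R := (R * R)%type.

(* For n.+1, the directional derivatives of all orders up to n.+1 exist and are
   continuous on the open set D. *)
Fixpoint Ck_on (R : realType) (n : nat) (D : set (plane R))
    (g : plane R -> plane R) : Prop :=
  match n with
  | 0 => forall x, D x -> {for x, continuous g}
  | m.+1 => (forall x, D x -> differentiable g x) /\
            forall v, Ck_on m D (fun x => 'D_v g x)
  end.

Definition smooth_on (R : realType) (D : set (plane R))
    (g : plane R -> plane R) : Prop := forall n, Ck_on n D g.

(* cmap is only meaningful on cdom, and cinv on cmap @` cdom. *)
Record chart (R : realType) (S : topologicalType) := Chart {
  cdom : set S ;
  cmap :> S -> plane R ;
  cinv : plane R -> S ;
  cdom_open : open cdom ;
  cimg_open : open (cmap @` cdom) ;
  cmapK : forall x, cdom x -> cinv (cmap x) = x ;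
  cmap_continuous : forall x, cdom x -> {for x, continuous cmap} ;
  cinv_continuous : forall x, cdom x -> {for cmap x, continuous cinv} }.

Definition transition (R : realType) (S : topologicalType) (c d : chart R S) :
  plane R -> plane R := fun x => d (cinv c x).

(* Neither compactness, nor orientability, nor connectedness is required; there
   is no boundary.  The smooth structure is the one generated by the atlas. *)
Record smoothSurface (R : realType) := SmoothSurface {
  surface_sort :> topologicalType ;
  surface_inhabited : [set: surface_sort] !=set0 ;
  surface_hausdorff : hausdorff_space surface_sort ;
  surface_second_countable : @second_countable surface_sort ;
  atlas_index : Type ;
  atlas : atlas_index -> chart R surface_sort ;
  atlas_cover : forall p, exists i, cdom (atlas i) p ;
  atlas_smooth : forall i j,
    smooth_on (atlas i @` (cdom (atlas i) `&` cdom (atlas j)))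
              (transition (atlas i) (atlas j)) }.

Section TangentSpace.
Variables (R : realType) (S : smoothSurface R) (p : S).

Definition charts_at := {i : atlas_index S | cdom (atlas i) p}.

Definition chart_at (i : charts_at) : chart R S := atlas (sval i).

(* A tangent vector at p is given by its coordinates in all the charts at p;
   they are exchanged by the differentials of the transition maps. *)
Definition tangent_pred : {pred (charts_at -> plane R)} := fun v =>
  `[< forall i j : charts_at,
        v j = 'd (transition (chart_at i) (chart_at j)) (chart_at i p) (v i) >].

Lemma tangent_submod_closed : submod_closed tangent_pred.
Proof.
split=> [|a u v /asboolP hu /asboolP hv]; apply/asboolP => i j.
  by rewrite linear0.
by rewrite linearP /= -hu -hv.
Qed.

HB.instance Definition _ :=
  GRing.isSubmodClosed.Build R (charts_at -> plane R) tangent_pred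
    tangent_submod_closed.

Record tangent := Tangent {
  tcoord :> charts_at -> plane R ;
  tcoordP : tcoord \in tangent_pred }.

HB.instance Definition _ := [isSub for tcoord].
HB.instance Definition _ := [Choice of tangent by <:].
HB.instance Definition _ := [SubChoice_isSubLmodule of tangent by <:].

End TangentSpace.

Definition is_line (R : realType) (V : lmodType R) (L : set V) : Prop :=
  exists2 v : V, v != 0 & L = [set a *: v | a in [set: R]].

(* The projectivization of V. *)
Record projective (R : realType) (V : lmodType R) := Projective {
  pline : set V ;
  plineP : is_line pline }.

(* The projective tangent bundle. *)
Record PTangent (R : realType) (S : smoothSurface R) := PTPoint {
  pt_base : S ;
  pt_line : projective (tangent pt_base) }.

HB.instance Definition _ (R : realType) (S : smoothSurface R) :=
  gen_eqMixin (PTangent S).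
HB.instance Definition _ (R : realType) (S : smoothSurface R) :=
  gen_choiceMixin (PTangent S).

Section PTangentTopology.
Variables (R : realType) (S : smoothSurface R).

(* x = (a, w), where a is the image of the base point of P in the i-th chart and
   w the coordinates of a nonzero vector of the line of P. *)
Definition pt_coord (i : atlas_index S) (P : PTangent S)
    (x : plane R * plane R) : Prop :=
  exists (hi : cdom (atlas i) (pt_base P)) (v : tangent (pt_base P)),
    [/\ pline (pt_line P) v, v != 0
      & x = (atlas i (pt_base P), v (exist _ i hi))].

(* Writing cdom (atlas i) as U and atlas i as phi, O is open when, for every i,
   its preimage under the surjection phi(U) x (R^2 \ {0}) -> PTU given by
   pt_coord i is open: this is the topology of PTS as a quotient of the
   complement of the zero section in the tangent bundle. *)
Definition pt_open (O : set (PTangent S)) : Prop :=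
  forall i P x, O P -> pt_coord i P x ->
    \forall y \near x, forall Q, pt_coord i Q y -> O Q.

Lemma pt_openT : pt_open setT.
Proof. by move=> i P x _ _; near=> y. Unshelve. all: by end_near. Qed.

Lemma pt_openI : setI_closed pt_open.
Proof.
move=> A B oA oB i P x [AP BP] Px; near=> y => Q Qy; split.
  by move: Q Qy; near: y; exact: oA Px.
by move: Q Qy; near: y; exact: oB Px.
Unshelve. all: by end_near. Qed.

Lemma pt_open_bigU (I : Type) (F : I -> set (PTangent S)) :
  (forall i, pt_open (F i)) -> pt_open (\bigcup_i F i).
Proof.
move=> oF i P x [k _ FP] Px; near=> y => Q Qy; exists k => //.
by move: Q Qy; near: y; exact: oF Px.
Unshelve. all: by end_near. Qed.

HB.instance Definition _ :=
  isOpenTopological.Build (PTangent S) pt_openT pt_openI pt_open_bigU.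

End PTangentTopology.

Section Maps.
Variables (R : realType) (S : smoothSurface R).

Definition in_charts (i j : atlas_index S) (f : S -> S) :
  plane R -> plane R := fun x => atlas j (f (cinv (atlas i) x)).

Definition differentiable_at (f : S -> S) (p : S) : Prop :=
  {for p, continuous f} /\
  forall i j, cdom (atlas i) p -> cdom (atlas j) (f p) ->
    differentiable (in_charts i j f) (atlas i p).

Definition C1_map (f : S -> S) : Prop :=
  continuous f /\
  forall i j,
    Ck_on 1 (atlas i @` (cdom (atlas i) `&` f @^-1` cdom (atlas j)))
            (in_charts i j f).

Definition Diff1 (f : S -> S) : Prop :=
  exists g : S -> S, [/\ cancel f g, cancel g f, C1_map f & C1_map g].

(* I is meant to be open. *)
Definition C1_path_on (I : set R) (c : R -> S) : Prop :=
  forall t, I t -> {for t, continuous c} /\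
    forall i, cdom (atlas i) (c t) ->
      derivable (fun s => atlas i (c s)) t 1 /\
      {for t, continuous (derive1 (fun s => atlas i (c s)))}.

(* The path c passes through p at time t, and c'(t) exists and equals v. *)
Definition has_velocity (c : R -> S) (t : R) (p : S) (v : tangent p) : Prop :=
  [/\ c t = p, {for t, continuous c}
    & forall i : charts_at p,
        is_derive t (1 : R) (fun s => chart_at i (c s)) (v i)].

(* Maps from the circle R/Z are given by 1-periodic maps on R. *)
Definition C1_embedding (g : R -> S) : Prop :=
  [/\ forall t, g (t + 1) = g t,
      {in `[0, 1[%classic &, injective g},
      C1_path_on setT g
    & forall t, exists2 v : tangent (g t), has_velocity g t v & v != 0].

Definition C1_curve (A : set S) : Prop :=
  exists2 g : R -> S, C1_embedding g & A = range g.

Definition Homeo1 (f : S -> S) : Prop :=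
  exists g : S -> S,
    [/\ cancel f g, cancel g f, continuous f, continuous g
      & forall A, C1_curve A -> C1_curve (f @` A) /\ C1_curve (g @` A)].

(* A is a C^1 curve through the base point of P, and the line of P is its
   tangent line there. *)
Definition tangent_line (A : set S) (P : PTangent S) : Prop :=
  exists (g : R -> S) (t : R) (v : tangent (pt_base P)),
    [/\ C1_embedding g, A = range g, has_velocity g t v, v != 0
      & pline (pt_line P) v].

(* For f in Homeo1 the set below is a singleton, so the default value P is
   irrelevant. *)
Definition dbar (f : S -> S) (P : PTangent S) : PTangent S :=
  xget P [set Q | pt_base Q = f (pt_base P) /\
    exists A, tangent_line A P /\ tangent_line (f @` A) Q].

(* The pushforward of f at p is well-defined and equal to D.  Every v is the
   velocity of some path, so that D is unique. *)
Definition is_pushforward (f : S -> S) (p : S)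
    (D : tangent p -> tangent (f p)) : Prop :=
  forall (v : tangent p) (c : R -> S),
    (exists2 e : R, 0 < e & C1_path_on `]- e, e[%classic c) ->
    has_velocity c 0 v -> has_velocity (f \o c) 0 (D v).

End Maps.

Arguments is_pushforward {R S} f p D.

(* Main.v *)
From HB Require Import structures.
Require Import Defs.
From mathcomp Require Import all_boot all_order all_algebra.
From mathcomp Require Import all_classical all_reals all_analysis.
From mathcomp Require Import ring lra.

Set Implicit Arguments.
Unset Strict Implicit.
Unset Printing Implicit Defensive.

Import Order.TTheory GRing.Theory Num.Theory.
Import numFieldNormedType.Exports.

Local Open Scope classical_set_scope.
Local Open Scope ring_scope.


(** All the phenomena are produced in one chart, by a homeomorphism f that
    agrees with a different plane map in each of three disjoint small squares
    and is the identity elsewhere.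

    - Around p2, f is [radial], x |-> phi(|x|^2) x, which is 2|x|^2 x - |x|^4 x
      near the centre.  Its derivative at the centre is 0, whence the zero
      pushforward ([radial_model_pushforward]).  As it moves points along rays,
      dbar f is the identity over p2 ([dbar_radial]); but at (s, 0), however
      small s is, the direction (1, 1) is stretched three times more along the
      ray than across it in the limit, so that its image stays away from (1, 1)
      and dbar f is not continuous ([radial_model_dbar_discontinuous]).
    - Around p1, f is the inverse of [radial]: again dbar f is the identity over
      p1, but f behaves like a cube root and is not differentiable there.
    - In the third square, f is [shear], (x, y) |-> (x + H(g x, g y) / 64, y),
      where H(X, Y) = X Y^2 / (X^2 + Y^2) is homogeneous of degree 1 and not
      linear, and g is C^1 with infinitely many simple zeros z.  At each point
      (z, z) the directional derivatives of f exist and are not additive.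

    Two arguments show that these maps and their inverses preserve C^1 curves.

    Both [radial] and [shear] are directionally C^1 ([dirC1]): they have at
    every p a homogeneous, possibly nonlinear, first-order part D p, and
    D x v tends to D p v when x tends to p in the direction v.  This is weak
    enough to include H, strong enough for the chain rule, and for paths it
    means being C^1.  Hence a directionally C^1 map with injective D sends
    regular paths (C^1 with nonzero velocity) to regular paths
    ([regular_comp]); when moreover D is onto and bounded below, the inverse
    does so too ([regular_inverse]).  This settles all points but the centres
    of [radial] and of its inverse.

    At the centre of [radial], a regular path e with e(0) = 0 and velocity v is
    sent to a path equivalent to 2|v|^2 t^3 v, which has to be reparametrized.
    The map sigma t = t - sin(2 pi t) / (2 pi) is a homeomorphism of the line
    that commutes with the integer translations, has nonzero derivative outside
    of the integers and is equivalent to a multiple of t^3 at 0.  Composing a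
    closed curve through the centre with the inverse of sigma before applying
    [radial] ([radial_desingularizes]), or with sigma before applying the
    inverse of [radial] ([radial_inverse_desingularizes]), yields a regular
    parametrization of the image curve.

    Finally, dbar f is defined by means of the sets f(A), without reference to
    a parametrization.  The lemma [tangent_cone] shows that the tangent line of
    a C^1 curve is the limit of the secant lines of the underlying set, and this
    makes dbar f computable from any path contained in f(A). *)

(** * Norm estimates *)

Section Estimates.
Variable R : realType.
Implicit Types U V W : normedModType R.

Lemma near_normP V (p : V) (P : set V) :
  (\forall x \near p, P x) <-> exists2 d : R, 0 < d & forall x, `|x - p| < d -> P x.
Proof.
rewrite -nbhs_nearE; split=> [/nbhs_normP[d d0 dP]|[d d0 dP]].
  by exists d => // x xp; apply: dP; rewrite /= distrC.
by apply/nbhs_normP; exists d => // x /=; rewrite distrC; exact: dP.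
Qed.

Lemma near_everywhere V (p : V) (P : set V) : (forall x, P x) -> \forall x \near p, P x.
Proof. by move=> HP; apply/near_normP; exists 1. Qed.

Lemma near_norm_lt V (p : V) (d : R) : 0 < d -> \forall x \near p, `|x - p| < d.
Proof. by move=> d0; apply/near_normP; exists d. Qed.

Lemma normr_fst_le U V (v : U * V) : `|v.1| <= `|v|.
Proof. by rewrite prod_normE le_max lexx. Qed.

Lemma normr_snd_le U V (v : U * V) : `|v.2| <= `|v|.
Proof. by rewrite prod_normE le_max lexx orbT. Qed.

Lemma normr_pair_le U V (v : U * V) (d : R) :
  `|v.1| <= d -> `|v.2| <= d -> `|v| <= d.
Proof. by move=> h1 h2; rewrite prod_normE ge_max h1. Qed.

Lemma normr_pair_lt U V (v : U * V) (d : R) :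
  `|v.1| < d -> `|v.2| < d -> `|v| < d.
Proof. by move=> h1 h2; rewrite prod_normE gt_max h1. Qed.

Lemma differentiable_estimate U V (F : U -> V) p e : differentiable F p ->
  0 < e -> \forall x \near p, `|F x - F p - 'd F p (x - p)| <= e * `|x - p|.
Proof.
move=> /diff_locally /eqaddoP dF e0.
have /near_normP[d d0 H] := dF e e0.
apply/near_normP; exists d => // x xp.
have := H (x - p); rewrite subr0 => /(_ xp) /=.
by rewrite !fctE /= subrK opprD addrA.
Qed.

Lemma is_derive_pathP V (e : R -> V) t w : is_derive t (1:R) e w <->
  forall d, 0 < d -> \forall s \near t, `|e s - e t - (s - t) *: w| <= d * `|s - t|.
Proof.
split=> [de d d0|H].
  have dd : differentiable e t by apply/derivable1_diffP.
  have := differentiable_estimate dd d0.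
  apply: filterS => s.
  rewrite deriv1E; last exact/derivable1_diffP.
  by rewrite derive1E derive_val.
have cv : (fun h : R => h^-1 *: ((e \o shift t) (h *: (1 : R)) - e t)) @ 0^' --> w.
  apply/cvgrPdist_le => d d0.
  have /near_normP[k k0 Hk] := H d d0.
  near=> h.
  have h0 : h != 0 by near: h; exact: nbhs_dnbhs_neq.
  have hk : `|h + t - t| < k.
    rewrite addrK; near: h; apply: dnbhs0_lt => //.
  have /= := Hk _ hk; rewrite addrK [h%:A]mulr1 => Hh.
  have -> : w - h^-1 *: (e (h + t) - e t) = - h^-1 *: (e (h + t) - e t - h *: w).
    by rewrite [X in _ = X]scalerBr scalerA mulNr mulVf // scaleN1r scaleNr opprK addrC.
  rewrite normrZ normrN normfV ler_pdivrMl ?normr_gt0 //.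
  by rewrite mulrC.
by apply: DeriveDef; [apply/cvg_ex; exists w|exact: cvg_lim].
Unshelve. all: by end_near. Qed.

End Estimates.

(** * Directionally C^1 maps *)
Section DirectionalC1.
Variable R : realType.
Implicit Types U V W : normedModType R.

(** The homogeneous map D p need not be linear, and x |-> D x v need not be
    continuous at p: the last clause only asks for D x v --> D p v when x tends
    to p in such a way that (x - p) / a --> v.  A C^1 path e stays in this
    regime, with v its velocity, so that the velocity D (e s) (e' s) of F \o e
    is continuous.  The Lipschitz bound, uniform in x, is what makes the notion
    stable under composition. *)
Definition dirC1 U V (F : U -> V) (D : U -> U -> V) (p : U) : Prop :=
 [/\ forall e : R, 0 < e ->
       \forall x \near p, `|F x - F p - D p (x - p)| <= e * `|x - p|,
     forall a v, D p (a *: v) = a *: D p v,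
     exists2 M : R, 0 < M &
       \forall x \near p, forall v w, `|D x v - D x w| <= M * `|v - w|
   & forall v (e : R), 0 < e -> exists2 d : R, 0 < d &
       forall x a, `|x - p| < d -> `|x - p - a *: v| <= d * `|a| ->
         `|D x v - D p v| <= e].

(** The directional notion of [dirC1] is pointwise, whereas being C^1 is asked
    near t: this is the form in which the two notions agree for paths. *)
Definition C1_near V (e : R -> V) (t : R) : Prop :=
  \forall s \near t, derivable e s 1 /\ {for s, continuous (derive1 e)}.

Definition regular V (e : R -> V) (t : R) : Prop :=
  C1_near e t /\ \forall s \near t, derive1 e s != 0.

Lemma dirC1_continuous U V (F : U -> V) D p : dirC1 F D p -> {for p, continuous F}.
Proof.
move=> [H1 H2 [M M0 H3] H4].
have D0 : D p 0 = 0 by rewrite -[X in D p X](scale0r (0:U)) H2 scale0r.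
apply/cvgrPdist_le => e e0.
have := H1 1 ltr01 => /near_normP[d d0 Hd].
have DM v : `|D p v| <= M * `|v|.
  by have := nbhs_singleton H3 v 0; rewrite D0 !subr0.
apply/near_normP; exists (Num.min d (e / (1 + M))).
  by rewrite lt_min d0 divr_gt0 // addr_gt0.
move=> x; rewrite lt_min => /andP[xd xe].
have := Hd _ xd; rewrite mul1r => h.
rewrite distrC -[F x - F p](subrK (D p (x - p))).
apply: (le_trans (ler_normD _ _)).
have := DM (x - p) => h2.
apply: (@le_trans _ _ ((1 + M) * `|x - p|)); first by rewrite mulrDl mul1r lerD.
by rewrite mulrC -ler_pdivlMr ?addr_gt0 // ltW.
Qed.

Lemma dirC1_derive V (e : R -> V) D t : dirC1 e D t -> is_derive t (1:R) e (D t 1).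
Proof.
move=> [H1 H2 _ _]; apply/is_derive_pathP => d d0.
apply: filterS (H1 d d0) => s.
by rewrite -[X in D t X]mulr1 H2.
Qed.

Lemma is_derive_dirC1 V (e e' : R -> V) t :
  is_derive t (1:R) e (e' t) -> {for t, continuous e'} ->
  dirC1 e (fun s v => v *: e' s) t.
Proof.
move=> de ce; split.
- by move=> d d0; move/is_derive_pathP: de; exact.
- by move=> a v; rewrite -scalerA.
- have /cvgrPdist_lt /(_ 1 ltr01) H := ce.
  exists (1 + `|e' t|); first by rewrite ltr_pwDl.
  apply: filterS H => x Hx v w.
  rewrite -scalerBl normrZ mulrC ler_wpM2r //.
  rewrite -[e' x](subrK (e' t)) (le_trans (ler_normD _ _)) //.
  by rewrite lerD2r distrC ltW.
- move=> v d d0.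
  have /cvgrPdist_lt /(_ (d / (1 + `|v|))) H := ce.
  have /near_normP[k k0 Hk] := H (divr_gt0 d0 (ltr_pwDl ltr01 (normr_ge0 v))).
  exists k => // x a xs _.
  rewrite -scalerBr normrZ distrC.
  have := Hk _ xs; rewrite ltr_pdivlMr ?ltr_pwDl // => h.
  apply: le_trans (ltW h); rewrite mulrC ler_wpM2l //.
  by rewrite lerDr.
Qed.

Lemma C1_near_dirC1 V (e : R -> V) t : C1_near e t ->
  \forall s \near t, dirC1 e (fun s v => v *: derive1 e s) s.
Proof.
apply: filterS => s [de ce]; apply: is_derive_dirC1 => //.
by rewrite derive1E; exact: derivableP.
Qed.

(** On the line the only direction is 1, so the last clause of [dirC1] becomes
    the continuity of s |-> D s 1. *)
Lemma dirC1_C1_near V (e : R -> V) D t :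
  (\forall s \near t, dirC1 e D s) ->
  C1_near e t /\ \forall s \near t, derive1 e s = D s 1.
Proof.
move=> H.
have H1 : \forall s \near t, derive1 e s = D s 1.
  by apply: filterS H => s /dirC1_derive de; rewrite derive1E derive_val.
split=> //.
apply: filterS2 H (near_join H1) => s Hs H1s.
split; first by have := dirC1_derive Hs.
have [_ _ _ H4] := Hs.
apply/cvgrPdist_le => d d0.
have [k k0 Hk] := H4 1 d d0.
have es := nbhs_singleton H1s.
apply: filterS2 H1s (near_norm_lt s k0) => x ex xs.
rewrite ex es distrC.
apply: (Hk x (x - s)) => //.
by rewrite [_%:A]mulr1 subrr normr0 mulr_ge0 // ltW.
Qed.

End DirectionalC1.

Section DirectionalC1Algebra.
Variable R : realType.
Implicit Types U V W : normedModType R.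

Lemma dirC1_eq U V (F G : U -> V) (D E : U -> U -> V) p :
  F = G -> (forall x v, D x v = E x v) -> dirC1 F D p -> dirC1 G E p.
Proof.
by move=> <- DE; rewrite (_ : D = E) //; apply/funext => x; apply/funext.
Qed.

Lemma dirC1_near U V (F G : U -> V) (D E : U -> U -> V) p :
  (\forall x \near p, F x = G x) -> (\forall x \near p, forall v, D x v = E x v) ->
  dirC1 F D p -> dirC1 G E p.
Proof.
move=> FG DE [H1 H2 [M M0 H3] H4].
have FGp := nbhs_singleton FG; have DEp := nbhs_singleton DE.
split.
- move=> e e0; apply: filterS2 FG (H1 e e0) => x.
  by rewrite FGp DEp => ->.
- by move=> a v; rewrite -!DEp.
- exists M => //; apply: filterS2 DE H3 => x Dx Hx v w.
  by rewrite -!Dx.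
- move=> v e e0; have [d d0 Hd] := H4 v e e0.
  have /near_normP[d' d'0 Hd'] := DE.
  exists (Num.min d d'); first by rewrite lt_min d0.
  move=> x a; rewrite lt_min => /andP[xd xd'] h.
  rewrite -Hd' // -DEp; apply: (Hd x a) => //; apply: (le_trans h).
  by rewrite ler_wpM2r // ge_min lexx.
Qed.

Lemma dirC1_bound U V (F : U -> V) D p : dirC1 F D p ->
  exists2 M : R, 0 < M & forall v, `|D p v| <= M * `|v|.
Proof.
move=> [_ H2 [M M0 H3] _]; exists M => // v.
have D0 : D p 0 = 0 by rewrite -[X in D p X](scale0r (0:U)) H2 scale0r.
by have := nbhs_singleton H3 v 0; rewrite D0 !subr0.
Qed.

Lemma dirC1_0 U V (F : U -> V) D p : dirC1 F D p -> D p 0 = 0.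
Proof.
by move=> [_ H2 _ _]; rewrite -[X in D p X](scale0r (0:U)) H2 scale0r.
Qed.

Lemma dirC1_lip U V (F : U -> V) D p : dirC1 F D p ->
  exists2 M : R, 0 < M & \forall x \near p, `|F x - F p| <= M * `|x - p|.
Proof.
move=> FD; have [M M0 HM] := dirC1_bound FD; have [H1 _ _ _] := FD.
exists (1 + M); first by rewrite addr_gt0.
apply: filterS (H1 1 ltr01) => x; rewrite mul1r => h.
rewrite -[F x - F p](subrK (D p (x - p))) mulrDl mul1r.
by rewrite (le_trans (ler_normD _ _)) // lerD.
Qed.

(** The first-order expansion in the regime of the last clause of [dirC1]: it
    shows that F x then tends to F p in the direction D p v, as is needed for the
    chain rule. *)
Lemma dirC1_along U V (F : U -> V) D p v (e : R) : dirC1 F D p -> 0 < e ->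
  exists2 d : R, 0 < d & forall x a, `|x - p| < d -> `|x - p - a *: v| <= d * `|a| ->
     `|F x - F p - a *: D p v| <= e * `|a|.
Proof.
move=> FD e0; have [H1 H2 [M M0 H3] _] := FD.
pose b := e / 2 / (1 + `|v|).
have v1 : 0 < 1 + `|v| by rewrite ltr_pwDl.
have b0 : 0 < b by rewrite !divr_gt0.
have /near_normP[k k0 Hk] := H1 b b0.
exists (Num.min k (Num.min 1 (e / 2 / M))).
  by rewrite !lt_min k0 ltr01 !divr_gt0.
move=> x a; rewrite lt_min => /andP[xk _] h.
have h1 : `|x - p - a *: v| <= `|a|.
  by apply: (le_trans h); rewrite ler_piMl // !ge_min lexx orbT.
have h2 : `|x - p - a *: v| <= e / 2 / M * `|a|.
  by apply: (le_trans h); rewrite ler_wpM2r // !ge_min lexx !orbT.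
have h3 : `|x - p| <= (1 + `|v|) * `|a|.
  rewrite -[x - p](subrK (a *: v)) (le_trans (ler_normD _ _)) //.
  by rewrite mulrDl mul1r normrZ [_ * `|a|]mulrC lerD2r.
rewrite -H2 -[F x - F p](subrK (D p (x - p))) -addrA.
apply: (le_trans (ler_normD _ _)).
rewrite (splitr e) mulrDl lerD //.
  apply: (le_trans (Hk _ xk)).
  apply: (@le_trans _ _ (b * ((1 + `|v|) * `|a|))); first by rewrite ler_pM2l.
  by rewrite mulrA /b divfK // gt_eqF.
apply: (le_trans (nbhs_singleton H3 _ _)).
by rewrite -ler_pdivlMl // mulrA [M^-1 * _]mulrC.
Qed.

Lemma dirC1_comp U V W (F : U -> V) (G : V -> W) D E p :
  dirC1 F D p -> dirC1 G E (F p) ->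
  dirC1 (G \o F) (fun x v => E (F x) (D x v)) p.
Proof.
move=> FD GE; have cF := dirC1_continuous FD.
have [M M0 HM] := dirC1_bound FD.
have [N N0 HN] := dirC1_bound GE.
have [F1 F2 [M' M'0 F3] F4] := FD; have [G1 G2 [N' N'0 G3] G4] := GE.
split.
- move=> e e0.
  have [L L0 HL] := dirC1_lip FD.
  have e1 : 0 < e / 2 / L by rewrite !divr_gt0.
  have e2 : 0 < e / 2 / N' by rewrite !divr_gt0.
  apply: filterS3 (F1 _ e2) HL (cF _ (G1 _ e1)) => x /= hx1 hx2 hx3.
  rewrite -[G (F x) - G (F p)](subrK (E (F p) (F x - F p))) -addrA.
  apply: (le_trans (ler_normD _ _)).
  rewrite (splitr e) mulrDl lerD //.
    apply: (le_trans hx3).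
    apply: (@le_trans _ _ (e / 2 / L * (L * `|x - p|))); first by rewrite ler_pM2l.
    by rewrite mulrA divfK // gt_eqF.
  apply: (le_trans (nbhs_singleton G3 _ _)).
  by rewrite -ler_pdivlMl // mulrA [N'^-1 * _]mulrC.
- by move=> a v; rewrite F2 G2.
- exists (N' * M'); first by rewrite mulr_gt0.
  apply: filterS2 F3 (cF _ G3) => x /= hx1 hx2 v w.
  apply: (le_trans (hx2 _ _)); rewrite -mulrA ler_pM2l //.
- move=> v e e0.
  have e1 : 0 < e / 2 by rewrite divr_gt0.
  have e2 : 0 < e / 2 / N' by rewrite !divr_gt0.
  have [d d0 Hd] := F4 v _ e2.
  have [k k0 Hk] := G4 (D p v) _ e1.
  have [c c0 Hc] := dirC1_along v FD k0.
  have /near_normP[l l0 Hl] : \forall x \near p, `|F x - F p| < k.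
    exact: (cF _ (near_norm_lt (F p) k0)).
  have /near_normP[m m0 Hm] := cF _ G3.
  exists (Num.min (Num.min d c) (Num.min l m)).
    by rewrite !lt_min d0 c0 l0 m0.
  move=> x a; rewrite !lt_min => /andP[/andP[xd xc] /andP[xl xm]] h.
  rewrite -[E (F x) _](subrK (E (F x) (D p v))) -addrA.
  apply: (le_trans (ler_normD _ _)).
  rewrite (splitr e) lerD //.
    apply: (le_trans (Hm _ xm _ _)).
    rewrite -ler_pdivlMl // [N'^-1 * _]mulrC; apply: (Hd x a) => //.
    by apply: (le_trans h); rewrite ler_wpM2r // !ge_min lexx.
  apply: (Hk _ a); first exact: Hl.
  apply: Hc => //.
  by apply: (le_trans h); rewrite ler_wpM2r // !ge_min lexx ?orbT.
Qed.

Lemma dirC1_pair U V W (F : U -> V) (G : U -> W) D E p :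
  dirC1 F D p -> dirC1 G E p ->
  dirC1 (fun x => (F x, G x)) (fun x v => (D x v, E x v)) p.
Proof.
move=> [F1 F2 [M M0 F3] F4] [G1 G2 [N N0 G3] G4]; split.
- move=> e e0; apply: filterS2 (F1 e e0) (G1 e e0) => x hF hG.
  by rewrite prod_normE /= ge_max hF.
- by move=> a v; rewrite F2 G2.
- exists (M + N); first by rewrite addr_gt0.
  apply: filterS2 F3 G3 => x hF hG v w.
  rewrite prod_normE /= ge_max; apply/andP; split.
    by apply: (le_trans (hF _ _)); rewrite ler_wpM2r // lerDl ltW.
  by apply: (le_trans (hG _ _)); rewrite ler_wpM2r // lerDr ltW.
- move=> v e e0; have [d d0 Hd] := F4 v e e0; have [k k0 Hk] := G4 v e e0.
  exists (Num.min d k); first by rewrite lt_min d0.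
  move=> x a; rewrite lt_min => /andP[xd xk] h.
  rewrite prod_normE /= ge_max; apply/andP; split.
    apply: (Hd x a) => //; apply: (le_trans h).
    by rewrite ler_wpM2r // ge_min lexx.
  apply: (Hk x a) => //; apply: (le_trans h).
  by rewrite ler_wpM2r // ge_min lexx orbT.
Qed.

Lemma dirC1_linear U V (F : {linear U -> V}) (M : R) p : 0 < M ->
  (forall v, `|F v| <= M * `|v|) -> dirC1 F (fun _ v => F v) p.
Proof.
move=> M0 FM; split.
- move=> e e0; apply: nearW => x.
  by rewrite -linearB subrr normr0 mulr_ge0 // ltW.
- by move=> a v; rewrite linearZ.
- by exists M => //; apply: nearW => x v w; rewrite -linearB.
- move=> v e e0; exists 1 => // x a _ _.
  by rewrite subrr normr0 ltW.
Qed.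

Lemma dirC1_fst U V p : dirC1 (@fst U V) (fun _ v => v.1) p.
Proof.
apply: (@dirC1_linear _ _ (@fst U V) 1) => // v.
by rewrite mul1r prod_normE le_max lexx.
Qed.

Lemma dirC1_snd U V p : dirC1 (@snd U V) (fun _ v => v.2) p.
Proof.
apply: (@dirC1_linear _ _ (@snd U V) 1) => // v.
by rewrite mul1r prod_normE le_max lexx orbT.
Qed.

Lemma dirC1_id U p : dirC1 (@idfun U) (fun _ v => v) p.
Proof. by apply: (@dirC1_linear _ _ (@idfun U) 1) => // v; rewrite mul1r. Qed.

Lemma dirC1_cst U V (c : V) (p : U) : dirC1 (fun=> c) (fun _ _ => 0) p.
Proof.
split.
- move=> e e0; apply: nearW => x.
  by rewrite subrr subr0 normr0 mulr_ge0 // ltW.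
- by move=> a v; rewrite scaler0.
- by exists 1 => //; apply: nearW => x v w; rewrite subrr normr0 mulr_ge0.
- by move=> v e e0; exists 1 => // x a _ _; rewrite subrr normr0 ltW.
Qed.

Lemma dirC1_add U V (F G : U -> V) D E p : dirC1 F D p -> dirC1 G E p ->
  dirC1 (fun x => F x + G x) (fun x v => D x v + E x v) p.
Proof.
move=> FD GE.
have add_lin : linear (fun x : V * V => x.1 + x.2).
  by move=> a u v /=; rewrite scalerDr addrACA.
pose addM := GRing.isLinear.Build _ _ _ _ _ add_lin.
pose addL : {linear _ -> _} := HB.pack (fun x : V * V => x.1 + x.2) addM.
have H : dirC1 addL (fun _ v => addL v) (F p, G p).
  apply: (@dirC1_linear _ _ addL 2) => // v /=.
  rewrite (le_trans (ler_normD _ _)) // mulr_natl mulr2n prod_normE.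
  by rewrite lerD // le_max lexx ?orbT.
exact: dirC1_comp (dirC1_pair FD GE) H.
Qed.

Lemma dirC1_mul U (F G : U -> R) D E p : dirC1 F D p -> dirC1 G E p ->
  dirC1 (fun x => F x * G x) (fun x v => F x * E x v + G x * D x v) p.
Proof.
move=> FD GE.
suff H : forall q : R * R,
  dirC1 (fun x : R * R => x.1 * x.2) (fun x v => x.1 * v.2 + x.2 * v.1) q.
  exact: dirC1_comp (dirC1_pair FD GE) (H _).
move=> [a b]; split => /=.
- move=> e e0; apply: filterS (near_norm_lt (a, b) e0) => -[x y] /= /ltW h.
  have -> : x * y - a * b - (a * (y - b) + b * (x - a)) = (x - a) * (y - b) by ring.
  rewrite normrM; apply: ler_pM => //; last exact: (normr_snd_le (x - a, y - b)).
  exact: le_trans (normr_fst_le (x - a, y - b)) h.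
- by move=> c v; rewrite /GRing.scale /=; ring.
- exists (2 * (1 + `|(a, b)|)).
    by rewrite mulr_gt0 // ltr_pwDl.
  apply: filterS (near_norm_lt (a, b) ltr01) => -[x y] /= /ltW h v w.
  have xa := le_trans (normr_fst_le (x - a, y - b)) h.
  have yb := le_trans (normr_snd_le (x - a, y - b)) h.
  have -> : x * v.2 + y * v.1 - (x * w.2 + y * w.1) =
    x * (v.2 - w.2) + y * (v.1 - w.1) by ring.
  apply: (le_trans (ler_normD _ _)); rewrite !normrM -mulrA mulr_natl mulr2n.
  apply: lerD; apply: ler_pM => //.
  + rewrite -[x](subrK a) (le_trans (ler_normD _ _)) // lerD //.
    exact: (normr_fst_le (a, b)).
  + exact: (normr_snd_le (v - w)).
  + rewrite -[y](subrK b) (le_trans (ler_normD _ _)) // lerD //.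
    exact: (normr_snd_le (a, b)).
  + exact: (normr_fst_le (v - w)).
- move=> v e e0; exists (e / 2 / (1 + `|v|)).
    by rewrite !divr_gt0 // ltr_pwDl.
  move=> [x y] c /= h _.
  have xa := le_lt_trans (normr_fst_le (x - a, y - b)) h.
  have yb := le_lt_trans (normr_snd_le (x - a, y - b)) h.
  have -> : x * v.2 + y * v.1 - (a * v.2 + b * v.1) =
    v.2 * (x - a) + v.1 * (y - b) by ring.
  apply: (le_trans (ler_normD _ _)); rewrite !normrM (splitr e).
  have v1 : `|v.1| <= 1 + `|v| by rewrite ler_wpDl // normr_fst_le.
  have v2 : `|v.2| <= 1 + `|v| by rewrite ler_wpDl // normr_snd_le.
  move: xa yb; rewrite !ltr_pdivlMr ?ltr_pwDl //= => xa yb.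
  rewrite lerD //.
    by rewrite ler_pdivlMr //; apply: le_trans (ltW xa); rewrite ler_pM2r // mulrC ler_wpM2l.
  by rewrite ler_pdivlMr //; apply: le_trans (ltW yb); rewrite ler_pM2r // mulrC ler_wpM2l.
Qed.

End DirectionalC1Algebra.

(** * Images and inverse images of regular paths *)
Section RegularPaths.
Variable R : realType.
Implicit Types U V W : normedModType R.

(** The differential inequality is stated for differences because D x is not
    assumed to be linear. *)
Definition dir_diffeo U V (F : U -> V) (D : U -> U -> V) (p : U) : Prop :=
  [/\ dirC1 F D p, forall z, exists w, D p w = z
    & exists2 m : R, 0 < m &
        \forall x \near p, forall v w, m * `|v - w| <= `|D x v - D x w|].

Lemma dir_diffeo_inj U V (F : U -> V) D p v : dir_diffeo F D p -> D p v = 0 -> v = 0.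
Proof.
move=> [FD _ [m m0 /nbhs_singleton /(_ v 0)]]; rewrite (dirC1_0 FD) !subr0 => h Dv0.
by apply/eqP; rewrite -normr_le0 -(pmulr_rle0 _ m0) (le_trans h) // Dv0 normr0.
Qed.

Lemma regular_comp U V (F : U -> V) D (e : R -> U) t :
  (\forall s \near t, dirC1 F D (e s) /\ forall v, D (e s) v = 0 -> v = 0) ->
  regular e t ->
  regular (F \o e) t /\
  \forall s \near t, derive1 (F \o e) s = D (e s) (derive1 e s).
Proof.
move=> FD [eC1 e'0].
have H : \forall s \near t,
    dirC1 (F \o e) (fun s v => D (e s) (v *: derive1 e s)) s.
  by apply: filterS2 FD (C1_near_dirC1 eC1) => s [FDs _] es; exact: dirC1_comp.
have [H1 H2] := dirC1_C1_near H.
have H3 : \forall s \near t, derive1 (F \o e) s = D (e s) (derive1 e s).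
  by apply: filterS H2 => s ->; rewrite scale1r.
split=> //; split=> //.
apply: filterS3 FD e'0 H3 => s [_ inj] s0 ->.
by apply: contraNneq s0 => /inj ->.
Qed.

Lemma regular_near V (e f : R -> V) t :
  (\forall s \near t, e s = f s) -> regular e t ->
  regular f t /\ \forall s \near t, derive1 e s = derive1 f s.
Proof.
move=> ef [eC1 e'0].
have H : \forall s \near t, dirC1 f (fun s v => v *: derive1 e s) s.
  apply: filterS2 (near_join ef) (C1_near_dirC1 eC1) => s.
  by move=> efs; apply: (dirC1_near efs); apply: filterS efs.
have [H1 H2] := dirC1_C1_near H.
have H3 : \forall s \near t, derive1 e s = derive1 f s.
  by apply: filterS H2 => s ->; rewrite scale1r.
split=> //; split=> //.
by apply: filterS2 e'0 H3 => s + <-.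
Qed.

(** If D (b t) w = z then b s - b t - (s - t) w is controlled, through the lower
    bound on D (b t), by F (b s) - F (b t) - (s - t) z, up to the remainder of
    F, which is a small multiple of |b s - b t| and can be absorbed. *)
Lemma dir_diffeo_path U V (F : U -> V) D (b : R -> U) t z :
  dir_diffeo F D (b t) -> {for t, continuous b} ->
  is_derive t (1 : R) (F \o b) z ->
  exists2 w, D (b t) w = z & is_derive t (1 : R) b w.
Proof.
move=> [FD Dsurj [m m0 /nbhs_singleton Dm]] cb /is_derive_pathP dFb.
have [w Dw] := Dsurj z; exists w => //.
apply/is_derive_pathP => d d0.
have [F1 F2 _ _] := FD.
have w1 : 0 < 1 + `|w| by rewrite ltr_pwDl.
pose c := Num.min (m / 2) (d * m / 2 / (1 + `|w|)).
have c0 : 0 < c by rewrite lt_min !divr_gt0 // mulr_gt0.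
have cm : c <= m / 2 by rewrite ge_min lexx.
have cd : c * (1 + `|w|) <= d * m / 2.
  by rewrite -ler_pdivlMr // ge_min lexx orbT.
apply: filterS2 (dFb c c0) (cb _ (F1 c c0)) => s /= h1 h2.
set h := b s - b t in h2 *.
set X := `|h - (s - t) *: w|.
have hX : `|h| <= X + `|s - t| * `|w|.
  by rewrite -[h](subrK ((s - t) *: w)) -normrZ ler_normD.
have mX : m * X <= c * `|h| + c * `|s - t|.
  apply: (le_trans (Dm _ _)); rewrite F2 Dw.
  rewrite -[_ - _ *: z](subrKA (F (b s) - F (b t))).
  by rewrite (le_trans (ler_normD _ _)) // lerD // distrC.
have := ler_wpM2l (ltW c0) hX => hX'.
have X0 : 0 <= X := normr_ge0 _.
have := ler_wpM2r X0 cm => hc.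
have := ler_wpM2r (normr_ge0 (s - t)) cd => hd.
have : m / 2 * X <= m / 2 * (d * `|s - t|) by nra.
by rewrite ler_pM2l // divr_gt0.
Qed.

(** The velocity of b solves D (b s) (b' s) = (F \o b)' s.  To see that it is
    continuous at s, compare D (b x) (b' x) with D (b x) (b' s): the latter
    tends to D (b s) (b' s) because b x tends to b s in the direction b' s. *)
Lemma regular_inverse U V (F : U -> V) D (b : R -> U) t :
  (\forall s \near t, dir_diffeo F D (b s)) ->
  (\forall s \near t, {for s, continuous b}) ->
  regular (F \o b) t ->
  regular b t /\ \forall s \near t, D (b s) (derive1 b s) = derive1 (F \o b) s.
Proof.
move=> FD cb [cC1 c'0].
have H1 : \forall s \near t, D (b s) (derive1 b s) = derive1 (F \o b) s /\
    is_derive s (1 : R) b (derive1 b s).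
  apply: filterS3 FD cb cC1 => s FDs cbs [dc _].
  have dc' : is_derive s (1 : R) (F \o b) (derive1 (F \o b) s).
    by rewrite derive1E; exact: derivableP.
  have [w <- dw] := dir_diffeo_path FDs cbs dc'.
  have bw : derive1 b s = w by rewrite derive1E derive_val.
  by rewrite bw.
have Db : \forall s \near t, D (b s) (derive1 b s) = derive1 (F \o b) s.
  by apply: filterS H1 => s [].
split=> //; split; last first.
  apply: filterS3 Db c'0 FD => s Ds s0 [FDs _ _].
  apply: contraNneq s0 => b0; rewrite -Ds b0 (dirC1_0 FDs) //.
have C : \forall s \near t, {for s, continuous b} /\
  {for s, continuous (derive1 (F \o b))}.
  by apply: filterS2 cb cC1 => s ? [].
apply: filterS3 (near_join H1) C FD => s H1s [cbs cc] [FDs _ [m m0 Dm]].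
have [Ds dbs] := nbhs_singleton H1s.
split; first by [].
apply/cvgrPdist_le => d d0.
have md : 0 < m * d / 2 by rewrite !divr_gt0 // mulr_gt0.
have [_ _ _ F4] := FDs.
have [k k0 Hk] := F4 (derive1 b s) _ md.
have /is_derive_pathP /(_ k k0) bk := dbs.
have A1 : \forall x \near s, `|derive1 (F \o b) s - derive1 (F \o b) x| <= m * d / 2.
  by move/cvgrPdist_le: cc; apply.
have A2 : \forall x \near s, `|b x - b s| < k := cbs _ (near_norm_lt (b s) k0).
have A3 : \forall x \near s, forall v w, m * `|v - w| <= `|D (b x) v - D (b x) w| := cbs _ Dm.
have A4 : \forall x \near s, `|b x - b s| < k /\
    forall v w, m * `|v - w| <= `|D (b x) v - D (b x) w|.
  by apply: filterS2 A2 A3.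
have A5 : \forall x \near s, D (b x) (derive1 b x) = derive1 (F \o b) x /\
    `|derive1 (F \o b) s - derive1 (F \o b) x| <= m * d / 2.
  by apply: filterS2 H1s A1 => x [].
apply: filterS3 A4 A5 bk => x [a2 a3] [Dx a1] a4.
rewrite distrC -(ler_pM2l m0) (le_trans (a3 _ _)) // Dx.
rewrite -(subrKA (derive1 (F \o b) s)) (le_trans (ler_normD _ _)) //.
rewrite (splitr (m * d)) lerD //; first by rewrite distrC.
rewrite -Ds distrC; exact: Hk a4.
Qed.

(** The mean value theorem on either side of t; differentiability is not asked at
    t, since the derivative there is what this is used to find. *)
Lemma mvt_ball (f df : R -> R) t s : s != t ->
  (forall x, `|x - t| <= `|s - t| -> x != t -> is_derive x (1 : R) f (df x)) ->
  {for t, continuous f} ->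
  exists2 c, `|c - t| <= `|s - t| /\ c != t & f s - f t = df c * (s - t).
Proof.
move=> st dfE cf.
have cfx x : `|x - t| <= `|s - t| -> {for x, continuous f}.
  move=> xs; have [->//|xt] := eqVneq x t.
  apply: differentiable_continuous; apply/derivable1_diffP.
  by have := dfE x xs xt.
have [lt_ts|lt_st|/eqP] := ltgtP t s; last by rewrite eq_sym (negbTE st).
- have [||c ] := @MVT R f df t s lt_ts.
  + move=> x; rewrite in_itv /= => /andP[tx xs]; apply: dfE; last by rewrite gt_eqF.
    by rewrite !gtr0_norm ?subr_gt0 // lerD2r ltW.
  + apply: continuous_in_subspaceT => x; rewrite inE /= in_itv /= => /andP[tx xs].
    by apply: cfx; rewrite ger0_norm ?subr_ge0 // gtr0_norm ?subr_gt0 // lerD2r.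
  + rewrite in_itv /= => /andP[tc cs] ->; exists c => //.
    by rewrite gt_eqF // !gtr0_norm ?subr_gt0 // lerD2r ltW.
- have [||c ] := @MVT R f df s t lt_st.
  + move=> x; rewrite in_itv /= => /andP[tx xs]; apply: dfE; last by rewrite lt_eqF.
    by rewrite !ltr0_norm ?subr_lt0 // lerN2 lerD2r ltW.
  + apply: continuous_in_subspaceT => x; rewrite inE /= in_itv /= => /andP[tx xs].
    by apply: cfx; rewrite ler0_norm ?subr_le0 // ltr0_norm ?subr_lt0 // lerN2 lerD2r.
  + rewrite in_itv /= => /andP[tc cs] E; exists c.
      by rewrite lt_eqF // !ltr0_norm ?subr_lt0 // lerN2 lerD2r ltW.
    by rewrite -opprB E -mulrN opprB.
Qed.

Lemma is_derive_punctured (f df : R -> R) t l :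
  {for t, continuous f} ->
  (\forall s \near t, s != t -> is_derive s (1 : R) f (df s)) ->
  df @ t^' --> l -> is_derive t (1 : R) f l.
Proof.
move=> cf dfE dfl; apply/is_derive_pathP => d d0.
have /cvgrPdist_le /(_ d d0) := dfl; rewrite near_withinE /= => H.
have /near_normP[k k0 Hk] : \forall s \near t,
    (s != t -> is_derive s (1 : R) f (df s)) /\ (s != t -> `|l - df s| <= d).
  by apply: filterS2 dfE H.
apply/near_normP; exists k => // s sk.
have [->|st] := eqVneq s t; first by rewrite !subrr scale0r subr0 normr0 mulr0.
have [||c [cs ct] ->] := @mvt_ball f df t s st.
- move=> x xs xt; exact: (Hk x (le_lt_trans xs sk)).1 xt.
- by [].
- have [_ /(_ ct)] := Hk c (le_lt_trans cs sk).
  rewrite [_ *: l]mulrC [df c * _]mulrC [l * _]mulrC -mulrBr normrM distrC => h.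
  by rewrite mulrC ler_wpM2r.
Qed.

Lemma is_derive_pair U V (f : R -> U) (g : R -> V) t u v :
  is_derive t (1 : R) (fun s => (f s, g s)) (u, v) <->
  is_derive t (1 : R) f u /\ is_derive t (1 : R) g v.
Proof.
split=> [/is_derive_pathP H|[/is_derive_pathP Hf /is_derive_pathP Hg]].
  split; apply/is_derive_pathP => d d0; apply: filterS (H d d0) => s.
    exact: (le_trans (normr_fst_le _)).
  exact: (le_trans (normr_snd_le _)).
apply/is_derive_pathP => d d0; apply: filterS2 (Hf d d0) (Hg d d0) => s hf hg.
exact: normr_pair_le.
Qed.

(** This is how regularity is obtained at a point where the path is singular by
    nature: its velocity is computed elsewhere, and the mean value theorem,
    applied to each coordinate, turns the limit of the velocities into the
    velocity at the limit. *)
Lemma regular_punctured (e de : R -> plane R) (t : R) (w : plane R) :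
  {for t, continuous e} ->
  (\forall s \near t, s != t -> regular e s /\ derive1 e s = de s) ->
  de @ t^' --> w -> w != 0 -> regular e t.
Proof.
move=> ce He dew w0.
have dei s : regular e s -> is_derive s (1 : R) e (derive1 e s).
  by move=> [/nbhs_singleton[dd _] _]; rewrite derive1E; exact: derivableP.
have det : is_derive t (1 : R) e w.
  rewrite (surjective_pairing w).
  rewrite (_ : e = fun s => ((e s).1, (e s).2)); last first.
    by apply/funext => s; rewrite -surjective_pairing.
  apply/is_derive_pair; split.
  - apply: (@is_derive_punctured _ (fun s => (de s).1)).
    + by apply: (cvg_comp _ fst ce); exact: cvg_fst.
    + apply: filterS He => s h /h [/dei + <-].
      rewrite {1}(_ : e = fun s => ((e s).1, (e s).2)); last first.
        by apply/funext => x; rewrite -surjective_pairing.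
      by rewrite (surjective_pairing (derive1 e s)) => /is_derive_pair[].
    + by apply: (cvg_comp _ fst dew); exact: cvg_fst.
  - apply: (@is_derive_punctured _ (fun s => (de s).2)).
    + by apply: (cvg_comp _ snd ce); exact: cvg_snd.
    + apply: filterS He => s h /h [/dei + <-].
      rewrite {1}(_ : e = fun s => ((e s).1, (e s).2)); last first.
        by apply/funext => x; rewrite -surjective_pairing.
      by rewrite (surjective_pairing (derive1 e s)) => /is_derive_pair[].
    + by apply: (cvg_comp _ snd dew); exact: cvg_snd.
have e't : derive1 e t = w by rewrite derive1E derive_val.
have ce' : {for t, continuous (derive1 e)}.
  apply/cvgrPdist_le => d d0; rewrite e't.
  have /cvgrPdist_le /(_ d d0) := dew; rewrite near_withinE /= => H.
  apply: filterS2 He H => s h1 h2.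
  have [->|st] := eqVneq s t; first by rewrite e't subrr normr0 ltW.
  by rewrite (h1 st).2 h2.
split.
  have dt : derivable e t 1 := @ex_derive _ _ _ _ _ _ _ det.
  apply: filterS He => s h; have [->|st] := eqVneq s t; first exact: conj dt ce'.
  by have [[/nbhs_singleton]] := h st.
apply: filterS He => s h; have [->|st] := eqVneq s t; first by rewrite e't.
by have [[_ /nbhs_singleton]] := h st.
Qed.

End RegularPaths.

Section PlaneC1.
Variable R : realType.

Definition C1_at (g : plane R -> plane R) (x : plane R) : Prop :=
  (\forall y \near x, differentiable g y) /\
  forall v, {for x, continuous (fun y => 'D_v g y)}.

Lemma continuous_bounded_near (U V : normedModType R) (f : U -> V) x :
  {for x, continuous f} -> exists2 M : R, 0 < M & \forall y \near x, `|f y| <= M.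
Proof.
move=> /cvgrPdist_lt /(_ 1 ltr01) H; exists (1 + `|f x|); first by rewrite ltr_pwDl.
apply: filterS H => y /ltW h; rewrite -[f y](subrK (f x)).
by rewrite (le_trans (ler_normD _ _)) // lerD2r distrC.
Qed.

(** The partial derivatives bound the differential near x, and this is the
    uniform Lipschitz clause. *)
Lemma C1_at_dirC1 g x : C1_at g x -> dirC1 g (fun y v => 'd g y v) x.
Proof.
move=> [dg cg].
have dgx := nbhs_singleton dg.
have E y (v : plane R) : differentiable g y ->
    'd g y v = v.1 *: 'D_(1, 0) g y + v.2 *: 'D_(0, 1) g y.
  move=> dgy; rewrite !deriveE // -!linearZ -linearD; congr ('d g y _).
  case: v => a b /=; rewrite [RHS]surjective_pairing /=.
  by congr (_, _); rewrite /GRing.scale /= !mulr0 ?mulr1 ?addr0 ?add0r ?mulr1.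
have subst (a a' b b' : plane R) e : a = a' -> b = b' -> `|a - b| <= e ->
    `|b' - a'| <= e.
  by move=> -> ->; rewrite distrC.
have [A A0 HA] := continuous_bounded_near (cg (1, 0)).
have [B B0 HB] := continuous_bounded_near (cg (0, 1)).
split.
- by move=> e e0; exact: differentiable_estimate.
- by move=> a v; rewrite linearZ.
- exists (A + B); first exact: addr_gt0.
  apply: filterS3 dg HA HB => y dgy.
  move: (E y ^~ dgy); move: ('D_(1, 0) g y) ('D_(0, 1) g y) => a b {}E ha hb v w.
  rewrite -linearB E; move: (v - w) => u.
  rewrite (le_trans (ler_normD _ _)) // !normrZ mulrDl lerD // mulrC ler_pM //.
    exact: normr_fst_le.
  exact: normr_snd_le.
- move=> v e e0.
  have /cvgrPdist_le /(_ e e0) c := cg v.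
  have /near_normP[d d0 Hd] : \forall y \near x,
      differentiable g y /\ `|'D_v g x - 'D_v g y| <= e by exact: filterI.
  exists d => // y a yd _; have [dgy h] := Hd _ yd.
  exact: (subst _ _ _ _ _ (deriveE v dgx) (deriveE v dgy) h).
Qed.

Lemma path_chain (U V : normedModType R) (F : U -> V) D (e : R -> U) t w :
  dirC1 F D (e t) -> is_derive t (1 : R) e w ->
  is_derive t (1 : R) (F \o e) (D (e t) w).
Proof.
move=> FD de; apply/is_derive_pathP => d d0.
have [k k0 Hk] := dirC1_along w FD d0.
have ce : {for t, continuous e}.
  by apply: differentiable_continuous; apply/derivable1_diffP; have := de.
have ek : \forall s \near t, `|e s - e t| < k := ce _ (near_norm_lt (e t) k0).
have /is_derive_pathP /(_ k k0) h := de.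
by apply: filterS2 ek h => s h1 h2; exact: Hk.
Qed.

Lemma is_derive_line (V : normedModType R) (p v : V) :
  is_derive (0 : R) (1 : R) (fun s => p + s *: v) v.
Proof.
apply/is_derive_pathP => d d0; apply: near_everywhere => s.
by rewrite scale0r addr0 subr0 [p + _]addrC addrK subrr normr0 mulr_ge0 // ltW.
Qed.

Lemma is_derive_punctured_neq (V : normedModType R) (e : R -> V) t w :
  is_derive t (1 : R) e w -> w != 0 -> \forall s \near t, s != t -> e s != e t.
Proof.
move=> /is_derive_pathP dg w0.
have nw : 0 < `|w| by rewrite normr_gt0.
have nw2 : 0 < `|w| / 2 by rewrite divr_gt0.
apply: filterS (dg _ nw2) => s h st; apply/eqP => gp.
move: h; rewrite gp subrr sub0r normrN normrZ.
rewrite [leLHS]mulrC ler_pM2r ?normr_gt0 ?subr_eq0 //; lra.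
Qed.

Lemma is_derive_near (V : normedModType R) (e f : R -> V) t w :
  (\forall s \near t, e s = f s) -> is_derive t (1 : R) e w ->
  is_derive t (1 : R) f w.
Proof.
move=> ef /is_derive_pathP H; apply/is_derive_pathP => d d0.
have eft := nbhs_singleton ef.
by apply: filterS2 ef (H d d0) => s; rewrite eft => ->.
Qed.

Lemma is_derive_unique (V : normedModType R) (e : R -> V) t v w :
  is_derive t (1 : R) e v -> is_derive t (1 : R) e w -> v = w.
Proof.
by move=> h1 h2; rewrite -(@derive_val _ _ _ _ _ _ _ h1) (@derive_val _ _ _ _ _ _ _ h2).
Qed.

Lemma derivable_path_continuous (V : normedModType R) (e : R -> V) t :
  derivable e t 1 -> {for t, continuous e}.
Proof. by move=> de; apply: differentiable_continuous; apply/derivable1_diffP. Qed.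

Lemma continuous_line (V : normedModType R) (p v : V) :
  {for 0, continuous (fun s : R => p + s *: v)}.
Proof. by apply: derivable_path_continuous; have := is_derive_line p v. Qed.

Lemma differentiable_path_chain (U V : normedModType R) (F : U -> V) (e : R -> U) t w :
  differentiable F (e t) -> is_derive t (1 : R) e w ->
  is_derive t (1 : R) (F \o e) ('d F (e t) w).
Proof.
move=> dF de; have dde : differentiable e t by apply/derivable1_diffP; have := de.
have d := differentiable_comp dde dF.
split; first by apply/derivable1_diffP.
have E1 : 'd (F \o e) t (1 : R) = 'd F (e t) ('d e t 1).
  by rewrite (diff_comp dde dF).
have E2 : 'd e t 1 = w := etrans (esym (deriveE (1 : R) dde)) (@derive_val _ _ _ _ _ _ _ de).
exact: etrans (deriveE (1 : R) d) (etrans E1 (congr1 _ E2)).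
Qed.

End PlaneC1.

(** * Charts and regular paths on a surface *)
Section Charts.
Variables (R : realType) (S : smoothSurface R).

(** The rescalings of a chart do not belong to the atlas; this is what they share
    with its elements. *)
Definition compatible (c : chart R S) : Prop :=
  forall i p, cdom c p -> cdom (atlas i) p ->
    C1_at (transition c (atlas i)) (c p) /\
    C1_at (transition (atlas i) c) (atlas i p).

Lemma cdom_near (c : chart R S) p : cdom c p -> \forall q \near p, cdom c q.
Proof. by move=> cp; apply: open_nbhs_nbhs; split=> //; exact: cdom_open. Qed.

Lemma cimg_near (c : chart R S) p : cdom c p ->
  \forall x \near c p, (c @` cdom c) x.
Proof.
by move=> cp; apply: open_nbhs_nbhs; split; [exact: cimg_open|exists p].
Qed.

Lemma chart_image_inv (c : chart R S) x : (c @` cdom c) x ->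
  cdom c (cinv c x) /\ c (cinv c x) = x.
Proof. by move=> [p cp <-]; rewrite cmapK. Qed.

Lemma transition_domain (c d : chart R S) p : cdom c p -> cdom d p ->
  \forall x \near c p, (c @` (cdom c `&` cdom d)) x.
Proof.
move=> cp dp.
have H := cinv_continuous cp.
have dp' : \forall q \near cinv c (c p), cdom d q by rewrite cmapK //; exact: cdom_near.
apply: filterS2 (cimg_near cp) (H _ dp') => x cx /= dx.
by have [h1 h2] := chart_image_inv cx; exists (cinv c x).
Qed.

Lemma atlas_compatible i : compatible (atlas i).
Proof.
move=> j p ip jp.
have H (k l : atlas_index S) : cdom (atlas k) p -> cdom (atlas l) p ->
    C1_at (transition (atlas k) (atlas l)) (atlas k p).
  move=> kp lp; have [sd sc] := atlas_smooth k l 1.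
  split; first by apply: filterS (transition_domain kp lp).
  by move=> v; apply: sc; exists p.
by split; exact: H.
Qed.

Lemma transitionK (c d : chart R S) p : cdom c p -> cdom d p ->
  \forall x \near c p, transition d c (transition c d x) = x.
Proof.
move=> cp dp; apply: filterS (transition_domain cp dp) => x [q [cq dq] <-].
by rewrite /transition !cmapK.
Qed.

Lemma transitionE (c d : chart R S) p : cdom c p -> transition c d (c p) = d p.
Proof. by move=> cp; rewrite /transition cmapK. Qed.

(** The chain rule along the line through x in the direction v. *)
Lemma C1_at_inverse (g h : plane R -> plane R) x v :
  C1_at g x -> C1_at h (g x) -> (\forall y \near x, h (g y) = y) ->
  'd h (g x) ('d g x v) = v.
Proof.
move=> g1 h1 hg; pose l (s : R) := x + s *: v.
have dl : is_derive (0 : R) (1 : R) l v := is_derive_line x v.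
have l0 : l 0 = x by rewrite /l scale0r addr0.
have dg : differentiable g (l 0) by rewrite l0; exact: nbhs_singleton g1.1.
have dh : differentiable h ((g \o l) 0) by rewrite /= l0; exact: nbhs_singleton h1.1.
have := differentiable_path_chain dh (differentiable_path_chain dg dl).
rewrite /= l0 => H; apply: is_derive_unique H _; apply: (is_derive_near _ dl).
have hg' : \forall y \near l 0, h (g y) = y by rewrite l0.
have H' : \forall s \near (0 : R), h (g (l s)) = l s := @continuous_line _ _ _ _ _ hg'.
by apply: filterS H' => s /= ->.
Qed.

Lemma C1_at_inj (g h : plane R -> plane R) x y v :
  C1_at g x -> C1_at h y -> y = g x -> (\forall y \near x, h (g y) = y) ->
  'd g x v = 0 -> v = 0.
Proof.
move=> g1 + yE hg v0; rewrite yE => h1; have := C1_at_inverse v g1 h1 hg.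
by move/(etrans (esym (congr1 ('d h (g x)) v0))); rewrite linear0.
Qed.

Lemma transition_to_atlas_inj (c : chart R S) i p v : compatible c ->
  cdom c p -> cdom (atlas i) p ->
  'd (transition c (atlas i)) (c p) v = 0 -> v = 0.
Proof.
move=> cc cp ip; have [h1 h2] := cc i p cp ip.
exact: (C1_at_inj h1 h2 (esym (transitionE _ cp)) (transitionK cp ip)).
Qed.

Lemma transition_from_atlas_inj (c : chart R S) i p v : compatible c ->
  cdom c p -> cdom (atlas i) p ->
  'd (transition (atlas i) c) (atlas i p) v = 0 -> v = 0.
Proof.
move=> cc cp ip; have [h1 h2] := cc i p cp ip.
exact: (C1_at_inj h2 h1 (esym (transitionE _ ip)) (transitionK ip cp)).
Qed.

Definition surface_regular (e : R -> S) (t : R) : Prop :=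
  (\forall s \near t, {for s, continuous e}) /\
  forall i, cdom (atlas i) (e t) -> regular (atlas i \o e) t.

Lemma path_in_chart (c : chart R S) (e : R -> S) t :
  {for t, continuous e} -> cdom c (e t) -> \forall s \near t, cdom c (e s).
Proof. by move=> ce cet; exact: (ce _ (cdom_near cet)). Qed.

Lemma path_change_chart (c d : chart R S) (e : R -> S) t :
  {for t, continuous e} -> cdom c (e t) ->
  \forall s \near t, (transition c d \o (c \o e)) s = (d \o e) s.
Proof.
move=> ce cet; apply: filterS (path_in_chart ce cet) => s cs /=.
by rewrite transitionE.
Qed.

Lemma surface_regular_chart (c : chart R S) e t : compatible c ->
  (\forall s \near t, {for s, continuous e}) -> cdom c (e t) ->
  regular (c \o e) t -> surface_regular e t.
Proof.
move=> cc ce cet rt; split; first exact: ce.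
move=> i it.
have cet' := nbhs_singleton ce.
have H : \forall s \near t,
   dirC1 (transition c (atlas i)) (fun y v => 'd (transition c (atlas i)) y v) ((c \o e) s) /\
   forall v, 'd (transition c (atlas i)) ((c \o e) s) v = 0 -> v = 0.
  apply: filterS2 (path_in_chart cet' cet) (path_in_chart cet' it) => s cs is_.
  split; first by exact: (C1_at_dirC1 (cc i (e s) cs is_).1).
  by move=> v; exact: (transition_to_atlas_inj cc cs is_).
have [H1 _] := regular_comp H rt.
exact: (regular_near (path_change_chart (atlas i) cet' cet) H1).1.
Qed.

Lemma chart_surface_regular (c : chart R S) e t : compatible c ->
  surface_regular e t -> cdom c (e t) -> regular (c \o e) t.
Proof.
move=> cc [ce rt] cet; have [i it] := atlas_cover (e t).
have cet' := nbhs_singleton ce.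
have H : \forall s \near t,
   dirC1 (transition (atlas i) c) (fun y v => 'd (transition (atlas i) c) y v) ((atlas i \o e) s) /\
   forall v, 'd (transition (atlas i) c) ((atlas i \o e) s) v = 0 -> v = 0.
  apply: filterS2 (path_in_chart cet' cet) (path_in_chart cet' it) => s cs is_.
  split; first by exact: (C1_at_dirC1 (cc i (e s) cs is_).2).
  by move=> v; exact: (transition_from_atlas_inj cc cs is_).
have [H1 _] := regular_comp H (rt i it).
exact: (regular_near (path_change_chart c cet' it) H1).1.
Qed.

End Charts.

Section Embeddings.
Variables (R : realType) (S : smoothSurface R).

Lemma tangent_coord0 (p : S) (v : tangent p) (i : charts_at p) :
  v i = 0 -> v = 0.
Proof.
move=> vi0; apply: val_inj => /=; apply/funext => j.
have /asboolP H := tcoordP v.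
by rewrite (H i j) vi0 linear0.
Qed.

Lemma tangent0E (p : S) (i : charts_at p) : (0 : tangent p) i = 0.
Proof. by []. Qed.

Lemma tangent_scaleE (p : S) a (v : tangent p) (i : charts_at p) :
  (a *: v) i = a *: v i.
Proof. by []. Qed.

Lemma path_chain_chart (c d : chart R S) (e : R -> S) t w :
  {for t, continuous e} -> cdom c (e t) ->
  C1_at (transition c d) (c (e t)) ->
  is_derive t (1 : R) (c \o e) w ->
  is_derive t (1 : R) (d \o e) ('d (transition c d) (c (e t)) w).
Proof.
move=> ce cet Ccd de.
apply: (is_derive_near (path_change_chart d ce cet)).
exact: (path_chain (C1_at_dirC1 Ccd) de).
Qed.

Lemma velocity_of_chart (c : chart R S) (e : R -> S) t w :
  compatible c -> {for t, continuous e} -> cdom c (e t) ->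
  is_derive t (1 : R) (c \o e) w ->
  exists v : tangent (e t), has_velocity e t v /\
    forall i, v i = 'd (transition c (chart_at i)) (c (e t)) w.
Proof.
move=> cc ce cet de.
pose v (i : charts_at (e t)) := 'd (transition c (chart_at i)) (c (e t)) w.
have dv i : is_derive t (1 : R) (chart_at i \o e) (v i).
  case: i @v => i it v.
  exact: (path_chain_chart ce cet (cc i (e t) cet it).1 de).
have vT : v \in @tangent_pred R S (e t).
  apply/asboolP => i j; apply: (is_derive_unique (dv j)).
  have H := atlas_compatible (svalP i) (svalP j).
  exact: (path_chain_chart ce (svalP i) H.1 (dv i)).
exists (Tangent vT); split; last by [].
split; [by []|exact: ce|exact: dv].
Qed.

Lemma chart_of_velocity (c : chart R S) (e : R -> S) t p (v : tangent p) :
  compatible c -> has_velocity e t v -> cdom c p ->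
  exists2 w, is_derive t (1 : R) (c \o e) w & v != 0 -> w != 0.
Proof.
move=> cc [etp ce dv] cp; subst p.
have [i it] := atlas_cover (e t).
have H := dv (exist _ i it).
exists ('d (transition (atlas i) c) (atlas i (e t)) (v (exist _ i it))).
  exact: (path_chain_chart ce it (cc i (e t) cp it).2 H).
move/eqP => v0; apply/eqP => w0; apply: v0.
exact: (tangent_coord0 (transition_from_atlas_inj cc cp it w0)).
Qed.

Lemma embedding_surface_regular (g : R -> S) : C1_embedding g -> forall t, surface_regular g t.
Proof.
move=> [_ _ gC1 gv] t.
have cg s : {for s, continuous g} := (gC1 s I).1.
split; first exact: near_everywhere.
move=> i it; have near_i := path_in_chart (cg t) it.
split; first by apply: filterS near_i => s is_; exact: (gC1 s I).2.
apply: filterS near_i => s is_.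
have [v [_ _ dv] v0] := gv s.
have := dv (exist _ i is_) => H.
rewrite derive1E (@derive_val _ _ _ _ _ _ _ H); apply/eqP => vi0.
by move/eqP: v0; apply; exact: tangent_coord0 vi0.
Qed.

(** Together with [embedding_surface_regular], this reduces the C^1 embeddings of
    the circle to regular paths, which can be handled locally. *)
Lemma surface_regular_embedding (g : R -> S) :
  (forall t, g (t + 1) = g t) -> {in `[0, 1[%classic &, injective g} ->
  (forall t, surface_regular g t) -> C1_embedding g.
Proof.
move=> gp gi gr; split=> //.
- move=> t _; have [cg rg] := gr t; split; first exact: nbhs_singleton cg.
  by move=> i it; have [/nbhs_singleton ? _] := rg i it.
- move=> t; have [cg rg] := gr t; have [i it] := atlas_cover (g t).
  have [/nbhs_singleton [dg _] /nbhs_singleton g0] := rg i it.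
  have dg' : is_derive t (1 : R) (atlas i \o g) (derive1 (atlas i \o g) t).
    by rewrite derive1E; exact: derivableP.
  have [v [vg _]] := velocity_of_chart (@atlas_compatible _ _ i) (nbhs_singleton cg) it dg'.
  exists v; first exact: vg.
  have [_ _ /(_ (exist _ i it)) dv] := vg.
  have E : v (exist _ i it) = derive1 (atlas i \o g) t by exact: is_derive_unique dv dg'.
  by apply/eqP => v0; move/eqP: g0; apply; rewrite -E v0.
Qed.

Lemma periodic_int (T : Type) (g : R -> T) : (forall t, g (t + 1) = g t) ->
  forall t (n : int), g (t + n%:~R) = g t.
Proof.
move=> gp; have gn (n : nat) t : g (t + n%:R) = g t.
  by elim: n => [|n IH]; rewrite ?addr0 // -natr1 addrA gp.
move=> t [n|n]; first exact: gn.
by rewrite NegzE mulrNz -[LHS](gn n.+1) subrK.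
Qed.

Lemma periodic_inj_int (T : Type) (g : R -> T) : (forall t, g (t + 1) = g t) ->
  {in `[0, 1[%classic &, injective g} ->
  forall s t, g s = g t -> exists n : int, s = t + n%:~R.
Proof.
move=> gp gi s t gst.
have H (x : R) : (x - (Num.floor x)%:~R) \in `[0, 1[%classic.
  rewrite inE /= in_itv /=; have /andP[] := floor_itv x; rewrite intrD => h1 h2.
  by apply/andP; split; lra.
have gf (x : R) : g (x - (Num.floor x)%:~R) = g x.
  by rewrite -mulrNz periodic_int.
have := gi _ _ (H s) (H t); rewrite !gf => /(_ gst) e.
exists (Num.floor s - Num.floor t); rewrite intrB.
by rewrite addrCA -e addrC subrK.
Qed.

Lemma int_periodic_inj (T : Type) (g : R -> T) :
  (forall s t, g s = g t -> exists n : int, s = t + n%:~R) ->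
  {in `[0, 1[%classic &, injective g}.
Proof.
move=> H s t; rewrite !inE /= !in_itv /= => /andP[s0 s1] /andP[t0 t1] /H[n sn].
have n1 : n%:~R < (1 : R) by lra.
have n2 : (-1 : R) < n%:~R by lra.
move: n1 n2; rewrite (_ : 1 = 1%:~R) // (_ : (-1) = (-1)%:~R) // !ltr_int => n1 n2.
have n0 : n = 0 by move: n n1 n2 {sn} => [[|n]|[|n]].
by rewrite sn n0 mulr0z addr0.
Qed.

End Embeddings.

(** * Rescaled charts *)
Section Rescaling.
Variable R : realType.
Variables (a : plane R) (r : R).
Hypothesis r0 : 0 < r.

Definition aff (x : plane R) : plane R := a + r *: x.
Definition affinv (x : plane R) : plane R := r^-1 *: (x - a).

Lemma affK : cancel aff affinv.
Proof. by move=> x; rewrite /affinv /aff addrC addKr scalerA mulVf ?scale1r ?gt_eqF. Qed.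

Lemma affinvK : cancel affinv aff.
Proof. by move=> x; rewrite /affinv /aff scalerA mulfV ?scale1r ?gt_eqF // subrKC. Qed.

Lemma is_diff_aff x : is_diff x aff ( *:%R r).
Proof.
have H : is_diff x (cst a + ( *:%R r)) (0 + ( *:%R r)) by apply: is_diffD.
by rewrite add0r in H.
Qed.

Lemma is_diff_affinv x : is_diff x affinv ( *:%R r^-1).
Proof.
have H : is_diff x (r^-1 \*: ((@id (plane R)) - cst a)) (r^-1 \*: (id - 0)).
  by apply: is_diffZ; apply: is_diffB.
by rewrite subr0 in H.
Qed.

Lemma continuous_aff : continuous aff.
Proof.
move=> x; apply: differentiable_continuous; exact: (@ex_diff _ _ _ _ _ _ _ (is_diff_aff x)).
Qed.

Lemma continuous_affinv : continuous affinv.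
Proof.
move=> x; apply: differentiable_continuous; exact: (@ex_diff _ _ _ _ _ _ _ (is_diff_affinv x)).
Qed.

Lemma derive_of_diff (g dg : plane R -> plane R) x v :
  is_diff x g dg -> 'D_v g x = dg v.
Proof. by move=> [h1 <-]; exact: deriveE. Qed.

Lemma derive_comp_aff (g : plane R -> plane R) x v : differentiable g (aff x) ->
  differentiable (g \o aff) x /\ 'D_v (g \o aff) x = r *: 'D_v g (aff x).
Proof.
move=> dg; have H := is_diff_comp (is_diff_aff x) (differentiableP dg).
split; first exact: (@ex_diff _ _ _ _ _ _ _ H).
rewrite (derive_of_diff v H) /= (deriveE v dg); exact: linearZ.
Qed.

Lemma derive_affinv_comp (g : plane R -> plane R) x v : differentiable g x ->
  differentiable (affinv \o g) x /\ 'D_v (affinv \o g) x = r^-1 *: 'D_v g x.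
Proof.
move=> dg; have H := is_diff_comp (differentiableP dg) (is_diff_affinv (g x)).
split; first exact: (@ex_diff _ _ _ _ _ _ _ H).
rewrite (derive_of_diff v H) /= (deriveE v dg); reflexivity.
Qed.

Lemma continuous_near (U V : normedModType R) (f g : U -> V) x :
  (\forall y \near x, f y = g y) -> {for x, continuous f} -> {for x, continuous g}.
Proof.
move=> fg cf; apply/cvgrPdist_le => e e0; have fgx := nbhs_singleton fg.
have /cvgrPdist_le /(_ e e0) := cf; rewrite fgx.
by apply: filterS2 fg => y ->.
Qed.

Lemma C1_at_comp_aff g x : C1_at g (aff x) -> C1_at (g \o aff) x.
Proof.
move=> [dg cg].
have dg' : \forall y \near x, differentiable g (aff y).
  exact: (@continuous_aff x _ dg).
split; first by apply: filterS dg' => y dgy; exact: (derive_comp_aff 0 dgy).1.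
move=> v; apply: (@continuous_near _ _ (fun y => r *: 'D_v g (aff y))).
  by apply: filterS dg' => y dgy; exact: (esym (derive_comp_aff v dgy).2).
apply: cvgZr; exact: (continuous_comp (@continuous_aff x) (cg v)).
Qed.

Lemma C1_at_affinv_comp g x : C1_at g x -> C1_at (affinv \o g) x.
Proof.
move=> [dg cg]; split.
  by apply: filterS dg => y dgy; exact: (derive_affinv_comp 0 dgy).1.
move=> v; apply: (@continuous_near _ _ (fun y => r^-1 *: 'D_v g y)).
  by apply: filterS dg => y dgy; exact: (esym (derive_affinv_comp v dgy).2).
by apply: cvgZr; exact: cg.
Qed.

Variable S : smoothSurface R.
Variable c : chart R S.

Lemma rescale_img_open : open ((affinv \o c) @` cdom c).
Proof.
rewrite (_ : _ @` _ = aff @^-1` (c @` cdom c)).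
  by apply: open_comp; [move=> x _; exact: continuous_aff|exact: cimg_open].
apply/seteqP; split=> x /=.
  by move=> [p cp <-]; exists p; rewrite //= affinvK.
by move=> [p cp pE]; exists p; rewrite //= pE affK.
Qed.

Lemma rescaleK x : cdom c x -> cinv c (aff (affinv (c x))) = x.
Proof. by move=> cx; rewrite affinvK cmapK. Qed.

Lemma rescale_continuous x : cdom c x -> {for x, continuous (affinv \o c)}.
Proof.
move=> cx; apply: continuous_comp; [exact: cmap_continuous|exact: continuous_affinv].
Qed.

Lemma rescale_inv_continuous x : cdom c x ->
  {for (affinv \o c) x, continuous (cinv c \o aff)}.
Proof.
move=> cx; apply: continuous_comp; first exact: continuous_aff.
by rewrite /= affinvK; exact: cinv_continuous.
Qed.

Definition rescale : chart R S :=
  @Chart R S (cdom c) (affinv \o c) (cinv c \o aff) (cdom_open c)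
    rescale_img_open rescaleK rescale_continuous rescale_inv_continuous.

Lemma rescale_compatible : compatible c -> compatible rescale.
Proof.
move=> cc i p cp ip; have [h1 h2] := cc i p cp ip; split.
  apply: (@C1_at_comp_aff (transition c (atlas i))) => /=.
  by rewrite affinvK.
exact: (@C1_at_affinv_comp (transition (atlas i) c)).
Qed.

End Rescaling.

(** * Transfer of a map of the plane to the surface *)
Section Supported.
Variable R : realType.

Definition supported (F G : plane R -> plane R) : Prop :=
  [/\ cancel F G, cancel G F, continuous F, continuous G
    & forall x, 1 <= `|x| -> F x = x].

Lemma supported_sym F G : supported F G -> supported G F.
Proof.
move=> [FG GF cF cG F1]; split=> // x x1.
by rewrite -{1}(F1 x x1) FG.
Qed.

Lemma supported_lt1 F G x : supported F G -> `|x| < 1 -> `|F x| < 1.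
Proof.
move=> [FG GF _ _ F1] x1; rewrite ltNge; apply/negP => Fx1.
have := F1 _ Fx1 => /(can_inj FG) E.
by move: Fx1; rewrite E leNgt x1.
Qed.

Lemma compact_square (M : R) : compact [set x : plane R | `|x| <= M].
Proof.
have H := compact_setX (@segment_compact R (-M) M) (@segment_compact R (-M) M).
rewrite (_ : [set x | _] = `[-M, M]%classic `*` `[-M, M]%classic) //.
apply/seteqP; split=> -[x y] /=.
  rewrite /= !in_itv /= -!ler_norml => h; split.
    exact: le_trans (normr_fst_le (x, y)) h.
  exact: le_trans (normr_snd_le (x, y)) h.
by rewrite /= !in_itv /= -!ler_norml => -[h1 h2]; exact: normr_pair_le.
Qed.

End Supported.

Section Transfer.
Variables (R : realType) (S : smoothSurface R) (c : chart R S).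

(** The supports lie in the unit square; the larger square leaves room for its
    boundary. *)
Definition big_chart : Prop :=
  compatible c /\ forall x, `|x| < 2 -> (c @` cdom c) x.

Definition transfer (F : plane R -> plane R) (p : S) : S :=
  if pselect (cdom c p) then cinv c (F (c p)) else p.

Lemma transfer_out F p : ~ cdom c p -> transfer F p = p.
Proof. by rewrite /transfer; case: pselect. Qed.

Lemma transferE F p : cdom c p -> transfer F p = cinv c (F (c p)).
Proof. by rewrite /transfer; case: pselect. Qed.

Hypothesis bigc : big_chart.
Variables F G : plane R -> plane R.
Hypothesis FGs : supported F G.

Lemma big_chart_near1 x : `|x| <= 1 -> (c @` cdom c) x.
Proof. by move=> x1; apply: bigc.2; apply: le_lt_trans x1 _; rewrite ltrDl. Qed.

Lemma transfer_img x : (c @` cdom c) x -> (c @` cdom c) (F x).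
Proof.
move=> cx; have [x1|x1] := ltP (`|x|) 1.
  by apply/big_chart_near1/ltW/(supported_lt1 FGs).
by have [_ _ _ _ ->] := FGs.
Qed.

Lemma transfer_dom p : cdom c p ->
  cdom c (transfer F p) /\ c (transfer F p) = F (c p).
Proof.
move=> cp; rewrite transferE //.
by apply: chart_image_inv; apply: transfer_img; exists p.
Qed.

Lemma transfer_id p : cdom c p -> 1 <= `|c p| -> transfer F p = p.
Proof.
move=> cp p1; rewrite transferE //.
by have [_ _ _ _ ->] := FGs; rewrite ?cmapK.
Qed.

(** The part of the surface that corresponds to the closed unit square is
    compact, hence closed as the surface is Hausdorff: a point outside of the
    chart has a neighbourhood that avoids it. *)
Lemma transfer_near_out p : ~ cdom c p -> \forall q \near p, transfer F q = q.
Proof.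
move=> cp.
pose K := cinv c @` [set x | `|x| <= 1].
have Kc : compact K.
  apply: continuous_compact; last exact: compact_square.
  apply: continuous_in_subspaceT => x; rewrite inE /= => x1.
  by have [q cq <-] := big_chart_near1 x1; exact: cinv_continuous.
have Kcl : closed K by apply: compact_closed => //; exact: surface_hausdorff.
have nKp : (~` K) p.
  by move=> [x /= x1 xp]; apply: cp; rewrite -xp; exact: (chart_image_inv (big_chart_near1 x1)).1.
have : \forall q \near p, (~` K) q.
  by apply: open_nbhs_nbhs; split=> //; exact: closed_openC.
apply: filterS => q nKq; have [cq|/transfer_out->//] := pselect (cdom c q).
apply: transfer_id => //; rewrite leNgt; apply/negP => q1; apply: nKq.
by exists (c q); [exact: ltW|rewrite cmapK].
Qed.

Lemma transfer_cancel : cancel (transfer F) (transfer G).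
Proof.
move=> p; have [cp|cp] := pselect (cdom c p); last by rewrite !transfer_out // transfer_out.
have [cq qE] := transfer_dom cp.
rewrite transferE // qE.
by have [-> _ _ _ _] := FGs; rewrite cmapK.
Qed.

Lemma transfer_continuous : continuous (transfer F).
Proof.
move=> p; have [cp|cp] := pselect (cdom c p).
  have [cq qE] := transfer_dom cp.
  have [_ _ cF _ _] := FGs.
  have c1 : {for p, continuous (F \o c)} := continuous_comp (cmap_continuous cp) (cF _).
  have c2 : {for F (c p), continuous (cinv c)} by rewrite -qE; exact: cinv_continuous.
  have H : (cinv c \o (F \o c)) @ p --> transfer F p.
    by rewrite transferE //; exact: (continuous_comp c1 c2).
  apply: cvg_trans H; apply: near_eq_cvg.
  by apply: filterS (cdom_near cp) => q cq'; rewrite transferE.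
have H : id @ p --> transfer F p by rewrite transfer_out //; exact: cvg_id.
apply: cvg_trans H; apply: near_eq_cvg.
by apply: filterS (transfer_near_out cp) => q ->.
Qed.

End Transfer.

Section TransferCurves.
Variables (R : realType) (S : smoothSurface R) (c : chart R S).
Hypothesis bigc : big_chart c.
Variables F G : plane R -> plane R.
Hypothesis FGs : supported F G.

Definition regular_preserving (x : plane R) : Prop :=
  forall (e : R -> plane R) t, e t = x -> regular e t -> regular (F \o e) t.

Local Notation f := (transfer c F).

Lemma continuous_comp_near (e : R -> S) (t : R) :
  (\forall s \near t, {for s, continuous e}) ->
  \forall s \near t, {for s, continuous (f \o e)}.
Proof.
apply: filterS => s ce; apply: continuous_comp => //.
exact: (transfer_continuous bigc FGs).
Qed.

Lemma transfer_surface_regular_in (e : R -> S) (t : R) :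
  (\forall s \near t, {for s, continuous e}) -> cdom c (e t) ->
  regular (F \o (c \o e)) t -> surface_regular (f \o e) t.
Proof.
move=> ce cet rt; have [cq qE] := transfer_dom bigc FGs cet.
apply: (surface_regular_chart bigc.1 (continuous_comp_near ce) cq).
apply: (regular_near _ rt).1.
apply: filterS (path_in_chart (nbhs_singleton ce) cet) => s cs.
by rewrite /= (transfer_dom bigc FGs cs).2.
Qed.

Lemma transfer_surface_regular (e : R -> S) t : surface_regular e t ->
  (cdom c (e t) -> regular_preserving (c (e t))) -> surface_regular (f \o e) t.
Proof.
move=> re HF; have [cet|cet] := pselect (cdom c (e t)).
  apply: transfer_surface_regular_in => //; first exact: re.1.
  exact: (HF cet) (erefl _) (chart_surface_regular bigc.1 re cet).
have [ce rt] := re; split; first exact: continuous_comp_near.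
move=> i it; have cet' := nbhs_singleton ce.
have fid : \forall s \near t, e s = f (e s).
  have H : \forall s \near t, f (e s) = e s := cet' _ (transfer_near_out bigc FGs cet).
  by apply: filterS H => s ->.
have it' : cdom (atlas i) (e t) by rewrite (nbhs_singleton fid).
by apply: (regular_near _ (rt i it')).1; apply: filterS fid => s /= <-.
Qed.

End TransferCurves.

Section Reparametrization.
Variable R : realType.

Lemma regular_continuous (V : normedModType R) (e : R -> V) t : regular e t ->
  \forall s \near t, {for s, continuous e}.
Proof. by move=> [H _]; apply: filterS H => s [/derivable_path_continuous]. Qed.

Lemma regular_reparam (V : normedModType R) (e : R -> V) (k : R -> R) (t : R) :
  regular e (k t) -> regular k t ->
  regular (e \o k) t /\
  \forall s \near t, derive1 (e \o k) s = derive1 k s *: derive1 e (k s).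
Proof.
move=> [eC1 e0] rk.
have ck : {for t, continuous k} := nbhs_singleton (regular_continuous rk).
have H1 : \forall s \near t, dirC1 e (fun s v => v *: derive1 e s) (k s).
  exact: (ck _ (C1_near_dirC1 eC1)).
have H2 : \forall s \near t, derive1 e (k s) != 0 := ck _ e0.
have [||H3 H4] := @regular_comp R R V e (fun s v => v *: derive1 e s) k t.
- apply: filterS2 H1 H2 => s h1 h2; split; first exact: h1.
  by move=> v /eqP; rewrite scaler_eq0 (negbTE h2) orbF => /eqP.
- exact: rk.
- by split; [exact: H3|exact: H4].
Qed.

Lemma regular_shift (a t : R) : regular (fun s => s + a) t.
Proof.
have H : \forall s \near t, dirC1 (fun s : R => s + a) (fun _ v => v + 0) s.
  apply: near_everywhere => s; exact: dirC1_add (dirC1_id _) (dirC1_cst _ _).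
have [H1 H2] := dirC1_C1_near H; split=> //.
by apply: filterS H2 => s ->; rewrite addr0 oner_neq0.
Qed.

Variable S : smoothSurface R.

Lemma surface_regular_reparam (e : R -> S) (k : R -> R) t :
  surface_regular e (k t) -> regular k t -> surface_regular (e \o k) t.
Proof.
move=> [ce re] rk; have ck := regular_continuous rk; split.
  have H : \forall s \near t, {for k s, continuous e} := nbhs_singleton ck _ ce.
  by apply: filterS2 H ck => s h1 h2; exact: continuous_comp h2 h1.
by move=> i it; exact: (regular_reparam (re i it) rk).1.
Qed.

Lemma surface_regular_periodic (g : R -> S) (n : int) : (forall t, g (t + 1) = g t) ->
  surface_regular g 0 -> surface_regular g n%:~R.
Proof.
move=> gp g0.
have -> : g = g \o (fun t => t + - n%:~R).
  by apply/funext => t /=; rewrite -mulrNz periodic_int.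
by apply: surface_regular_reparam; [rewrite subrr|exact: regular_shift].
Qed.

Lemma Homeo1_comp (f1 f2 : S -> S) : Homeo1 f1 -> Homeo1 f2 -> Homeo1 (f1 \o f2).
Proof.
move=> [g1 [fg1 gf1 cf1 cg1 h1]] [g2 [fg2 gf2 cf2 cg2 h2]].
exists (g2 \o g1); split.
- exact: can_comp.
- exact: can_comp.
- by move=> x; apply: continuous_comp; [exact: cf2|exact: cf1].
- by move=> x; apply: continuous_comp; [exact: cg1|exact: cg2].
- move=> A HA; rewrite -(image_comp f2 f1) -(image_comp g1 g2); split.
    exact: (h1 _ (h2 _ HA).1).1.
  exact: (h2 _ (h1 _ HA).2).2.
Qed.

End Reparametrization.

Section TransferHomeo.
Variables (R : realType) (S : smoothSurface R) (c : chart R S).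
Hypothesis bigc : big_chart c.

(** The map k lifts a homeomorphism of the circle that fixes the base point 0.
    It may be singular there, and it is at this parameter that it repairs the
    image under F of a path through the origin. *)
Definition desingularizes (k : R -> R) (F : plane R -> plane R) : Prop :=
  [/\ forall t, k (t + 1) = k t + 1, k 0 = 0, bijective k, continuous k
    & (forall t, (forall n : int, t != n%:~R) -> regular k t) /\
      forall e : R -> plane R, e 0 = 0 -> regular e 0 -> regular (F \o (e \o k)) 0].

(** A closed curve passes at most once through the centre of the chart.  After a
    shift of the parameter it does so at the integers exactly, and composing it
    with k makes its image regular there, without loss elsewhere. *)
Lemma transfer_C1_curve F G k A : supported F G ->
  (forall x, x != 0 -> regular_preserving F x) -> desingularizes k F ->
  C1_curve A -> C1_curve (transfer c F @` A).
Proof.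
move=> FGs Freg [kp k0 kb ck [kreg kF]] [g gE ->].
have [gp gi _ _] := gE; have gr := embedding_surface_regular gE.
have [p0 p0E] : exists p0, cdom c p0 /\ c p0 = 0.
  have [|q cq qE] := bigc.2 0; first by rewrite normr0.
  by exists q.
have fi : injective (transfer c F) := can_inj (transfer_cancel bigc FGs).
have atp0 q : cdom c q -> c q = 0 -> q = p0.
  by move=> cq cq0; rewrite -(cmapK cq) cq0 -p0E.2 (cmapK p0E.1).
have [[t0 gt0]|np0] := pselect (exists t, g t = p0); last first.
  exists (transfer c F \o g); last by rewrite image_comp.
  apply: surface_regular_embedding.
  - by move=> t /=; rewrite gp.
  - by move=> s t sI tI /= /fi; exact: gi.
  - move=> t; apply: (transfer_surface_regular bigc FGs) => // ct; apply: Freg.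
    by apply/eqP => ct0; apply: np0; exists t; exact: atp0.
pose g' t := g (t + t0).
have g'p t : g' (t + 1) = g' t by rewrite /g' addrAC gp.
have g'r t : surface_regular g' t.
  by apply: (@surface_regular_reparam _ _ g (fun s => s + t0)) => //; exact: regular_shift.
have kn t (n : int) : k (t + n%:~R) = k t + n%:~R.
  have H : forall t, k (t + 1) - (t + 1) = k t - t by move=> u; rewrite kp; ring.
  have := periodic_int (g := fun t => k t - t) H t n.
  by move=> /(congr1 (fun x => x + (t + n%:~R))); rewrite subrK => ->; ring.
have ki : injective k := bij_inj kb.
have g'k t : g' (k t) = p0 -> exists n : int, t = n%:~R.
  rewrite -gt0 => /(periodic_inj_int gp gi) [n] /eqP.
  rewrite addrC -subr_eq0 opprD addrACA subrr add0r subr_eq0 => /eqP kt.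
  by exists n; apply: ki; rewrite kt -[n%:~R in RHS]add0r kn k0 add0r.
exists (transfer c F \o (g' \o k)); last first.
  rewrite -[RHS](image_comp (g' \o k) (transfer c F)); congr (_ @` _).
  case: kb => k' kk' k'k.
  apply/seteqP; split=> x [t _ <-].
    by exists (k' (t - t0)) => //=; rewrite k'k /g' subrK.
  by exists (k t + t0).
apply: surface_regular_embedding.
- by move=> t /=; rewrite kp g'p.
- apply: int_periodic_inj => s t /= /fi /(periodic_inj_int gp gi) [n].
  by rewrite addrAC => /addIr; rewrite -kn => /ki ->; exists n.
- move=> t; have [[n ->]|nt] := pselect (exists n : int, t = n%:~R).
    apply: surface_regular_periodic; first by move=> u /=; rewrite kp g'p.
    have g'0 : g' 0 = p0 by rewrite /g' add0r.
    apply: (transfer_surface_regular_in bigc FGs).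
    + apply: near_everywhere => s; apply: continuous_comp; first exact: ck.
      exact: nbhs_singleton (g'r _).1.
    + by rewrite /= k0 g'0; exact: p0E.1.
    + apply: (kF (c \o g')); first by rewrite /= g'0 p0E.2.
      by apply: (chart_surface_regular bigc.1 (g'r 0)); rewrite g'0; exact: p0E.1.
  have rt : surface_regular (g' \o k) t.
    apply: surface_regular_reparam => //; apply: kreg => n; apply/eqP => tn.
    by apply: nt; exists n.
  apply: (transfer_surface_regular bigc FGs) => // ct; apply: Freg.
  by apply/eqP => ct0; apply: nt; apply: g'k; exact: atp0.
Qed.

Lemma transfer_Homeo1 F G k l : supported F G ->
  (forall x, x != 0 -> regular_preserving F x) ->
  (forall x, x != 0 -> regular_preserving G x) ->
  desingularizes k F -> desingularizes l G -> Homeo1 (transfer c F).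
Proof.
move=> FG HF HG kF lG; have GF := supported_sym FG.
exists (transfer c G); split.
- exact: transfer_cancel FG.
- exact: transfer_cancel GF.
- exact: transfer_continuous FG.
- exact: transfer_continuous GF.
- by move=> A HA; split; [exact: (transfer_C1_curve FG HF kF HA)|exact: (transfer_C1_curve GF HG lG HA)].
Qed.

End TransferHomeo.

(** * Tangent lines of curves as sets, and the induced map *)
Section Cross.
Variable R : realType.
Implicit Types u v w : plane R.

Definition cross u v : R := u.1 * v.2 - u.2 * v.1.

Lemma cross_le u v : `|cross u v| <= 2 * `|u| * `|v|.
Proof.
rewrite /cross (le_trans (ler_normB _ _)) // !normrM -mulrA mulr_natl mulr2n.
by apply: lerD; apply: ler_pM => //; rewrite ?normr_fst_le ?normr_snd_le.
Qed.

Lemma crossDl u v w : cross (u + v) w = cross u w + cross v w.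
Proof. by rewrite /cross /=; ring. Qed.

Lemma crossNl u w : cross (- u) w = - cross u w.
Proof. by rewrite /cross /=; ring. Qed.

Lemma crossZl a u w : cross (a *: u) w = a * cross u w.
Proof. by rewrite /cross /= /GRing.scale /=; ring. Qed.

Lemma crossvv u : cross u u = 0.
Proof. by rewrite /cross; ring. Qed.

Lemma cross0_parallel u v : cross u v = 0 -> u != 0 -> exists a, v = a *: u.
Proof.
case: u v => [a b] [x y]; rewrite /cross /= => E.
have pairE (s : R) : s * a = x -> s * b = y -> (x, y) = s *: (a, b) by move=> <- <-.
have [a0|a0 _] := eqVneq a 0; last first.
  exists (x / a); apply: pairE; first by rewrite divfK.
  by rewrite mulrAC (_ : x * b = y * a) ?mulfK //; lra.
have [b0|b0 _] := eqVneq b 0; first by rewrite a0 b0 eqxx.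
exists (y / b); apply: pairE; last by rewrite divfK.
by rewrite mulrAC (_ : y * a = x * b) ?mulfK //; lra.
Qed.

End Cross.

Section TangentCone.
Variables (R : realType) (S : smoothSurface R).

(** The image of the parameters at distance at least d from t modulo 1 is compact
    and does not contain g t, as g is injective on the circle. *)
Lemma embedding_near (g : R -> S) t (d : R) : C1_embedding g -> 0 < d ->
  \forall q \near g t, range g q -> exists2 s, `|s - t| < d & g s = q.
Proof.
move=> gE d0; have [gp gi _ _] := gE; have gr := embedding_surface_regular gE.
have gc : continuous g by move=> s; exact: nbhs_singleton (gr s).1.
pose K := `[t - 1/2, t - d]%classic `|` `[t + d, t + 1/2]%classic.
have Kc : compact K by apply: compactU; exact: segment_compact.
have gKcl : closed (g @` K).
  apply: compact_closed; first exact: surface_hausdorff.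
  apply: continuous_compact => //; exact: continuous_subspaceT.
have nK : (~` (g @` K)) (g t).
  move=> [s Ks /(periodic_inj_int gp gi) [n sn]].
  have : `|n%:~R| <= 1/2 :> R /\ `|n%:~R| >= d :> R.
    move: Ks; rewrite sn /K /= !in_itv /= => -[|] /andP[h1 h2].
      by rewrite ler0_norm; lra.
    by rewrite ger0_norm; lra.
  move=> [h1 h2].
  have : `|n|%:~R < 1%:~R :> R by rewrite intr_norm /=; lra.
  rewrite ltr_int => n1; have n0 : n = 0 by move: n n1 {sn h1 h2} => [[|n]|n].
  by move: h2; rewrite n0 normr0; lra.
have : \forall q \near g t, (~` (g @` K)) q.
  by apply: open_nbhs_nbhs; split=> //; exact: closed_openC.
apply: filterS => q nKq [u _ guq].
pose n := Num.floor (u - t + 1/2).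
have /andP[n1 n2] := floor_itv (u - t + 1/2); move: n1 n2; rewrite -/n intrD => n1 n2.
exists (u - n%:~R); last by rewrite -mulrNz periodic_int.
rewrite ltNge; apply/negP => du; apply: nKq.
exists (u - n%:~R); last by rewrite -mulrNz periodic_int.
have [s0|s0] := leP 0 (u - n%:~R - t).
  by right; move: du; rewrite ger0_norm //= in_itv /= => du; apply/andP; split; lra.
by left; move: du; rewrite ltr0_norm //= in_itv /= => du; apply/andP; split; lra.
Qed.

(** Points of the curve that are close to g t have parameters s close to t, and
    then c (g s) - c (g t) is close to (s - t) w, whose cross product with w
    is 0. *)
Lemma tangent_cone (c : chart R S) (g : R -> S) t w (e : R) :
  C1_embedding g -> cdom c (g t) -> is_derive t (1 : R) (c \o g) w -> w != 0 ->
  0 < e ->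
  \forall q \near g t, range g q ->
    `|cross (c q - c (g t)) w| <= e * `|c q - c (g t)|.
Proof.
move=> gE ct /is_derive_pathP dg w0 e0.
have nw0 : 0 < `|w| by rewrite normr_gt0.
pose h := Num.min (`|w| / 2) (e / 4).
have h0 : 0 < h by rewrite lt_min !divr_gt0.
have hw : h <= `|w| / 2 by rewrite ge_min lexx.
have he : h <= e / 4 by rewrite ge_min lexx orbT.
have /near_normP[d d0 Hd] := dg h h0.
apply: filterS (embedding_near t gE d0) => q gq /gq [s sd <-].
have := Hd s sd => /=; set X := c (g s) - c (g t).
move=> hX.
have := cross_le (X - (s - t) *: w) w.
rewrite crossDl crossNl crossZl crossvv mulr0 oppr0 addr0.
have : `|s - t| * `|w| <= `|X| + `|X - (s - t) *: w|.
  rewrite -normrZ -{1}(subKr X ((s - t) *: w)).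
  exact: ler_normB.
move: hX; move: (`|X - _ *: w|) (`|s - t|) (normr_ge0 (s - t)) (normr_ge0 X) (normr_ge0 w).
move: (`|X|) (`|w|) (`|cross X w|) nw0 hw => x W C W0 hw m st st0 x0 W0' h1 h2 h3.
have h4 : st * W <= 2 * x.
  have := ler_wpM2r st0 hw => h5; lra.
have h6 : m * W <= h * (2 * x).
  have := ler_wpM2r (ltW W0) h1 => h7; have := ler_wpM2l (ltW h0) h4 => h8.
  by apply: le_trans h7 _; rewrite -mulrA.
have := ler_wpM2r x0 he => h9; lra.
Qed.

(** The path e need not be a parametrization of the curve: it is enough that it
    runs inside it and that its secants, scaled by lam, have a limit. *)
Lemma tangent_cone_limit (c : chart R S) (g : R -> S) t w
    (e : R -> S) s0 (lam : R -> R) (u : R -> plane R) w' :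
  C1_embedding g -> cdom c (g t) -> is_derive t (1 : R) (c \o g) w -> w != 0 ->
  {for s0, continuous e} -> e s0 = g t ->
  (\forall s \near s0, s != s0 -> [/\ range g (e s), lam s != 0 &
      c (e s) - c (g t) = lam s *: u s]) ->
  u @ s0^' --> w' -> cross w' w = 0.
Proof.
move=> gE ct dg w0 ce es0 H uw'; apply/eqP; rewrite -normr_le0 leNgt.
apply/negP => C0.
pose M := 2 * `|w| + `|w'| + 1.
have M0 : 0 < M by rewrite /M ltr_wpDl // addr_ge0 // mulr_ge0.
pose h := Num.min 1 (`|cross w' w| / 2 / M).
have h0 : 0 < h by rewrite lt_min ltr01 !divr_gt0.
have h1 : h <= 1 by rewrite ge_min lexx.
have hM : h * M <= `|cross w' w| / 2 by rewrite -ler_pdivlMr // ge_min lexx orbT.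
have cone := tangent_cone gE ct dg w0 h0.
have cone' : \forall s \near s0, range g (e s) ->
    `|cross (c (e s) - c (g t)) w| <= h * `|c (e s) - c (g t)|.
  have cone1 : \forall q \near e s0, range g q ->
    `|cross (c q - c (g t)) w| <= h * `|c q - c (g t)| by rewrite es0.
  exact: (ce _ cone1).
have /cvgrPdist_le /(_ h h0) := uw'; rewrite near_withinE /= => uh.
have : \forall s \near s0, s != s0 -> `|cross w' w| < `|cross w' w|.
  apply: filterS3 H cone' uh => s Hs cs us ss0.
  have [rg lam0 E] := Hs ss0; have := cs rg; rewrite E crossZl normrM normrZ.
  rewrite mulrCA ler_pM2l ?normr_gt0 // => k1.
  have k2 := us ss0.
  have k3 : `|cross w' w| <= `|cross (w' - u s) w| + `|cross (u s) w|.
    by rewrite (_ : cross w' w = cross (w' - u s) w + cross (u s) w) ?ler_normD // -crossDl subrK.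
  have k4 := cross_le (w' - u s) w.
  have k5 : `|u s| <= `|w'| + `|w' - u s|.
    by have := ler_normB w' (w' - u s); rewrite subKr.
  have k6 : h * `|u s| <= h * (`|w'| + 1).
    rewrite ler_pM2l //; apply: le_trans k5 _; rewrite lerD2l; exact: le_trans k2 h1.
  have k7 : `|w' - u s| * `|w| <= h * `|w| by rewrite ler_wpM2r.
  move: hM; rewrite /M => hM; lra.
move/near_normP => [d d0 Hd].
have /= := Hd (s0 + d / 2); rewrite addrC addKr ltxx gtr0_norm ?divr_gt0 //.
by move=> /(_ _ _) F; suff : false by []; apply: F; [lra|apply/eqP; lra].
Qed.

End TangentCone.

Section Lines.
Variables (R : realType).

Lemma line_scale (V : lmodType R) (L : projective V) v a : pline L v -> pline L (a *: v).
Proof.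
case: L => L [v0 v00 LE] /=; rewrite LE => -[b _ <-].
by exists (a * b) => //; rewrite scalerA.
Qed.

Lemma line_parallel (V : lmodType R) (L : projective V) u v :
  pline L u -> u != 0 -> pline L v -> exists a, v = a *: u.
Proof.
case: L => L [v0 v00 LE] /=; rewrite LE => -[b _ <-] u0 [a _ <-].
have b0 : b != 0 by apply: contraNneq u0 => ->; rewrite scale0r.
by exists (a / b); rewrite scalerA divfK.
Qed.

Lemma line_eq (V : lmodType R) (L M : projective V) u a :
  pline L u -> u != 0 -> pline M (a *: u) -> a *: u != 0 -> L = M.
Proof.
move=> Lu u0 Mu au0.
have a0 : a != 0 by apply: contraNneq au0 => ->; rewrite scale0r.
have LM : pline L = pline M.
  apply/seteqP; split=> v.
    move=> /(line_parallel Lu u0) [b ->].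
    by rewrite -(divfK a0 b) -scalerA; exact: line_scale.
  move=> /(line_parallel Mu au0) [b ->].
  by rewrite scalerA; exact: line_scale.
case: L M LM {Lu Mu} => [L HL] [M HM] /= LM; subst M.
by congr Projective; exact: Prop_irrelevance.
Qed.

Definition line_of (V : lmodType R) (v : V) (v0 : v != 0) : projective V :=
  @Projective R V [set a *: v | a in [set: R]] (ex_intro2 _ _ v v0 erefl).

Lemma line_of_mem (V : lmodType R) (v : V) (v0 : v != 0) : pline (line_of v0) v.
Proof. by exists 1 => //; rewrite scale1r. Qed.

End Lines.

Section Coordinates.
Variables (R : realType) (S : smoothSurface R) (c : chart R S).
Hypothesis cc : compatible c.

(** The chart c need not belong to the atlas, so that w is not among the
    coordinates that v consists of. *)
Definition coord (p : S) (v : tangent p) (w : plane R) : Prop :=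
  forall i, v i = 'd (transition c (chart_at i)) (c p) w.

Lemma coord_velocity p (e : R -> S) t w : e t = p ->
  {for t, continuous e} -> cdom c p -> is_derive t (1 : R) (c \o e) w ->
  exists2 v : tangent p, has_velocity e t v & coord v w.
Proof.
move=> etp; subst p => ce ct de.
by have [v [h1 h2]] := velocity_of_chart cc ce ct de; exists v.
Qed.

Lemma velocity_coord p (e : R -> S) t (v : tangent p) : cdom c p ->
  has_velocity e t v -> exists2 w, is_derive t (1 : R) (c \o e) w & coord v w.
Proof.
move=> cp ev; have [w dw _] := chart_of_velocity cc ev cp.
exists w; first exact: dw.
have [etp ce dv] := ev; subst p => i.
apply: (is_derive_unique (dv i)).
case: i => i it; exact: (path_chain_chart ce cp (cc cp it).1 dw).
Qed.

Lemma coord_inj p (v v' : tangent p) w : coord v w -> coord v' w -> v = v'.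
Proof.
move=> h1 h2; apply: val_inj; apply/funext => i.
exact: (etrans (h1 i) (esym (h2 i))).
Qed.

Lemma coord_scale p (v : tangent p) w a : coord v w -> coord (a *: v) (a *: w).
Proof.
move=> h i; rewrite tangent_scaleE linearZ.
exact: (congr1 (fun z => a *: z) (h i)).
Qed.

Lemma coord_neq0_tangent p (v : tangent p) w : cdom c p -> coord v w -> w != 0 -> v != 0.
Proof.
move=> cp vw; apply: contra_neq => v0.
have [i ip] := atlas_cover p.
apply: (transition_to_atlas_inj cc cp ip).
by have := vw (exist _ i ip) => <-; rewrite v0.
Qed.

Lemma coord_neq0_plane p (v : tangent p) w : coord v w -> v != 0 -> w != 0.
Proof.
move=> vw; apply: contra_neq => w0; have [i ip] := atlas_cover p.
apply: (tangent_coord0 (i := exist _ i ip)).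
have := vw (exist _ i ip); rewrite w0 linear0; exact.
Qed.

Lemma coord_exists p w : cdom c p -> exists v : tangent p, coord v w.
Proof.
move=> cp; pose l (s : R) := c p + s *: w.
have dl : is_derive (0 : R) (1 : R) l w := is_derive_line _ _.
have cl : {for 0, continuous l} := @continuous_line _ _ _ _.
have l0 : l 0 = c p by rewrite /l scale0r addr0.
pose e := cinv c \o l.
have e0 : e 0 = p by rewrite /e /= l0 cmapK.
have ce : {for 0, continuous e}.
  apply: continuous_comp; first exact: cl.
  by rewrite l0; exact: cinv_continuous.
have de : is_derive (0 : R) (1 : R) (c \o e) w.
  apply: (is_derive_near _ dl).
  have H : \forall x \near l 0, (c @` cdom c) x by rewrite l0; exact: cimg_near.
  have H' : \forall s \near (0 : R), (c @` cdom c) (l s) := cl _ H.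
  by apply: filterS H' => s /chart_image_inv[_ h] /=.
by have [v _ vw] := coord_velocity e0 ce cp de; exists v.
Qed.

End Coordinates.

Section InducedMap.
Variables (R : realType) (S : smoothSurface R) (c : chart R S).
Hypothesis cc : compatible c.

Lemma tangent_line_parallel p (e : R -> S) s0 (lam : R -> R) (u : R -> plane R)
    (w' : plane R) (A : set S) (L : projective (tangent p)) :
  cdom c p -> tangent_line A (PTPoint L) ->
  {for s0, continuous e} -> e s0 = p ->
  (\forall s \near s0, s != s0 -> [/\ A (e s), lam s != 0 &
      c (e s) - c p = lam s *: u s]) ->
  u @ s0^' --> w' -> w' != 0 ->
  exists v a, [/\ coord c v w', pline L (a *: v) & a *: v != 0].
Proof.
move=> cp [g [t [v2 [gE AE vv v20 Lv]]]] ce es0 H uw' w'0.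
have [w2 dw2 vw2] := velocity_coord cc cp vv.
have [gt _ _] := vv.
have w20 := coord_neq0_plane vw2 v20.
have cw : cross w' w2 = 0.
  apply: (tangent_cone_limit (t := t) (e := e) (lam := lam) gE _ dw2 w20 ce _ _ uw').
  - by rewrite gt.
  - by rewrite gt.
  - by apply: filterS H => s h /h; rewrite AE gt.
have [a aE] := cross0_parallel cw w'0.
have [v vw] := coord_exists cc w' cp.
have E : v2 = a *: v by apply: (coord_inj vw2); rewrite aE; exact: coord_scale.
by exists v, a; rewrite -E.
Qed.

Lemma derive_quotient (V : normedModType R) (e : R -> V) t w :
  is_derive t (1 : R) e w -> (fun s => (s - t)^-1 *: (e s - e t)) @ t^' --> w.
Proof.
move=> /is_derive_pathP de; apply/cvgrPdist_le => d d0; rewrite near_withinE.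
apply: filterS (de d d0) => s h st.
have st0 : s - t != 0 by rewrite subr_eq0.
have -> : w - (s - t)^-1 *: (e s - e t) =
    - ((s - t)^-1 *: (e s - e t - (s - t) *: w)).
  by rewrite [X in _ = - X]scalerBr scalerA mulVf // scale1r opprB.
by rewrite normrN normrZ normfV ler_pdivrMl ?normr_gt0 // mulrC.
Qed.

Variable f : S -> S.

(** The image of a curve with velocity w1 at p has the secants of the curve
    itself, multiplied by nonzero scalars, so their direction is still w1. *)
Lemma dbar_radial p (lam : S -> R) : cdom c p -> f p = p ->
  {for p, continuous f} ->
  (\forall q \near p, q != p -> lam q != 0 /\ c (f q) - c p = lam q *: (c q - c p)) ->
  forall P : PTangent S, pt_base P = p -> dbar f P = P.
Proof.
move=> cp fp cf H [b L] /= bp; subst b.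
rewrite /dbar; case: xgetP => [[b M] _ [/= bE [A [tA tfA]]]|//].
rewrite fp in bE; subst b; congr PTPoint.
have [g1 [t1 [v1 [g1E AE vv1 v10 Lv1]]]] := tA.
have [w1 dw1 vw1] := velocity_coord cc cp vv1.
have [g1t cg1 _] := vv1; rewrite /= in g1t.
have Hg : \forall s \near t1, (g1 s != p) -> lam (g1 s) != 0 /\
    c (f (g1 s)) - c p = lam (g1 s) *: (c (g1 s) - c p).
  have H' : \forall q \near g1 t1, q != p -> lam q != 0 /\
    c (f q) - c p = lam q *: (c q - c p) by rewrite g1t.
  exact: (cg1 _ H').
have w10 := coord_neq0_plane vw1 v10.
have nq : \forall s \near t1, s != t1 -> g1 s != p.
  apply: filterS (is_derive_punctured_neq dw1 w10) => s h /h.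
  by apply: contra_neq; rewrite /= g1t => ->.
have dq := derive_quotient dw1.
have [|||v [a [vw Mv av0]]] := @tangent_line_parallel p (f \o g1) t1
   (fun s => lam (g1 s) * (s - t1)) _ w1 (f @` A) M cp tfA _ _ _ dq w10.
- apply: continuous_comp; first exact: cg1.
  by rewrite g1t.
- by rewrite /= g1t.
- apply: filterS2 Hg nq => s h1 h2 st; have [l0 E] := h1 (h2 st).
  have st0 : s - t1 != 0 by rewrite subr_eq0.
  split; first by exists (g1 s) => //; rewrite AE; exists s.
    by rewrite mulf_neq0.
  rewrite /= E scalerA -mulrA mulfV // mulr1 /= g1t //.
- have vE : v = v1 := coord_inj vw vw1.
  rewrite vE in Mv av0; exact: esym (line_eq Lv1 v10 Mv av0).
Qed.

(** The image of a curve with velocity w in the chart has velocity D (c p) w.  The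
    last two hypotheses ensure that the set that defines dbar f is not empty, so
    that its value is not the default one. *)
Lemma dbar_derivative p (F : plane R -> plane R) D (w : plane R) v (L : projective (tangent p)) :
  cdom c p -> cdom c (f p) -> {for p, continuous f} ->
  (\forall q \near p, c (f q) = F (c q)) -> dirC1 F D (c p) -> D (c p) w != 0 ->
  coord c v w -> v != 0 -> pline L v -> (forall A, C1_curve A -> C1_curve (f @` A)) ->
  (exists2 A, C1_curve A & tangent_line A (PTPoint L)) ->
  exists (M : projective (tangent (f p))) v' a,
    [/\ dbar f (PTPoint L) = PTPoint M, coord c v' (D (c p) w),
        pline M (a *: v') & a *: v' != 0].
Proof.
move=> cp cfp cf fF FD Dw0 vw v0 Lv fC1 [A0 A0C tA0].
rewrite /dbar; case: xgetP => [[b M] _ [/= bE [A [tA tfA]]]|noQ]; last first.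
  exfalso.
  have [g gE gA] := fC1 A0 A0C.
  have [g1 [t1 [v1 [_ AE [/= g1t _ _] _ _]]]] := tA0.
  have : (f @` A0) (f p) by exists p => //; rewrite AE; exists t1.
  rewrite gA => -[t _ gt].
  have [_ _ _ /(_ t) [v2 v2v v20]] := gE.
  rewrite gt in v2 v2v v20.
  apply: (noQ (PTPoint (line_of v20))); split=> //; exists A0; split=> //.
  by exists g, t, v2; split=> //; exact: line_of_mem.
subst b.
have [g1 [t1 [v1 [g1E AE vv1 v10 Lv1]]]] := tA.
have [w1 dw1 vw1] := velocity_coord cc cp vv1.
have [g1t cg1 _] := vv1; rewrite /= in g1t Lv1.
have [a aE] := line_parallel Lv v0 Lv1.
have a0 : a != 0 by apply: contraNneq v10 => a0; rewrite aE a0 scale0r.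
have dF : is_derive t1 (1 : R) (F \o (c \o g1)) (D (c p) w1).
  by rewrite -g1t; apply: path_chain => //; rewrite /= g1t.
have fFg : \forall s \near t1, c (f (g1 s)) = F (c (g1 s)).
  have H' : \forall q \near g1 t1, c (f q) = F (c q) by rewrite g1t.
  exact: (cg1 _ H').
have dcf : is_derive t1 (1 : R) (c \o (f \o g1)) (D (c p) w1).
  by apply: (is_derive_near _ dF); apply: filterS fFg => s /= ->.
have w1E : w1 = a *: w.
  have [i ip] := atlas_cover p.
  have H1 := vw1 (exist _ i ip); have H2 := coord_scale a vw (exist _ i ip).
  rewrite -aE in H2.
  have H3 : 'd (transition c (atlas i)) (c p) (w1 - a *: w) = 0.
    rewrite linearB; apply/eqP; rewrite subr_eq0; apply/eqP.
    exact: (etrans (esym H1) H2).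
  by apply/eqP; rewrite -subr_eq0; apply/eqP; exact: (transition_to_atlas_inj cc cp ip H3).
have Dw1 : D (c p) w1 = a *: D (c p) w by rewrite w1E; have [_ -> _ _] := FD.
have Dw10 : D (c p) w1 != 0 by rewrite Dw1 scaler_eq0 negb_or a0.
have [|||v' [b [vw' Mv bv0]]] := @tangent_line_parallel (f p) (f \o g1) t1
   (fun s => s - t1) _ (D (c p) w1) (f @` A) M cfp tfA _ _ _ (derive_quotient dcf) Dw10.
- by apply: continuous_comp; rewrite ?g1t.
- by rewrite /= g1t.
- apply: near_everywhere => s st; have st0 : s - t1 != 0 by rewrite subr_eq0.
  split; [by exists (g1 s) => //; rewrite AE; exists s|by []|].
  by rewrite scalerA mulfV // scale1r /= g1t.
- exists M, (a^-1 *: v'), (b * a); split=> //.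
  + have := coord_scale a^-1 vw'.
    by rewrite Dw1 scalerA mulVf // scale1r.
  + by rewrite scalerA mulfK.
  + by rewrite scalerA mulfK.
Qed.

End InducedMap.

(** * Curves with a given tangent line *)
Section Trigo.
Variable R : realType.
Implicit Types t : R.

Lemma regular_of_derive2 (V : normedModType R) (e e1 e2 : R -> V) t :
  (forall s, is_derive s (1 : R) e (e1 s)) ->
  (forall s, is_derive s (1 : R) e1 (e2 s)) -> e1 t != 0 -> regular e t.
Proof.
move=> d1 d2 e0.
have e1E : derive1 e = e1.
  by apply/funext => s; rewrite derive1E (@derive_val _ _ _ _ _ _ _ (d1 s)).
have c1 s : {for s, continuous e1}.
  by apply: derivable_path_continuous; have := d2 s.
split.
  apply: near_everywhere => s; split; first by have := d1 s.
  by rewrite e1E.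
rewrite e1E; have n0 : 0 < `|e1 t| by rewrite normr_gt0.
have /cvgrPdist_lt /(_ _ n0) H := c1 t.
apply: filterS H => s h; apply/eqP => s0; move: h.
by rewrite s0 subr0 ltxx.
Qed.

Definition turn t : R := pi *+ 2 * t.

Lemma sin_turn1 t : sin (turn (t + 1)) = sin (turn t).
Proof. by rewrite /turn mulrDr mulr1 sinD2pi. Qed.

Lemma cos_turn1 t : cos (turn (t + 1)) = cos (turn t).
Proof. by rewrite /turn mulrDr mulr1 cosD2pi. Qed.

Lemma is_derive_sin_turn t : is_derive t (1 : R) (fun s => sin (turn s)) (pi *+ 2 * cos (turn t)).
Proof.
rewrite /turn; apply: is_derive_eq; rewrite /GRing.scale /=; ring.
Qed.

Lemma is_derive_cos_turn t : is_derive t (1 : R) (fun s => cos (turn s)) (- (pi *+ 2 * sin (turn t))).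
Proof.
rewrite /turn; apply: is_derive_eq; rewrite /GRing.scale /=; ring.
Qed.

(** Reduce t to its fractional part r and use 1 - cos(2 pi r) = 2 sin(pi r)^2,
    where sin(pi r) > 0 for 0 < r < 1. *)
Lemma cos_turn_eq1 t : cos (turn t) = 1 -> exists n : int, t = n%:~R.
Proof.
move=> ct; exists (Num.floor t).
pose f (s : R) := cos (turn s).
have fp s : f (s + 1) = f s by exact: cos_turn1.
have := periodic_int fp t (- Num.floor t); rewrite {2}/f ct mulrNz.
have /andP[f1 f2] := floor_itv t; move: f1 f2; rewrite intrD.
set u := (Num.floor t)%:~R => f1 f2.
rewrite /f => cu.
have pi0 := pi_gt0 R.
have [->//|tu] := eqVneq t u.
have tu0 : 0 < t - u by rewrite lt_neqAle subr_ge0 f1 andbT eq_sym subr_eq0.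
have : sin (pi * (t - u)) != 0.
  by rewrite gt_eqF // sin_gt0_pi // mulr_gt0 //= gtr_pMr //; lra.
move: cu; rewrite (_ : turn (t - u) = (pi * (t - u)) *+ 2); last by rewrite /turn; ring.
rewrite cos_mulr2n => c1 /eqP []; apply/eqP.
have := cos2Dsin2 (pi * (t - u)) => c2.
rewrite -sqrf_eq0; apply/eqP; move: c1 c2; rewrite mulr2n; lra.
Qed.

Lemma turn_inj s t : sin (turn s) = sin (turn t) -> cos (turn s) = cos (turn t) ->
  exists n : int, s = t + n%:~R.
Proof.
move=> ss cs; have [|n nE] := @cos_turn_eq1 (s - t).
  have -> : turn (s - t) = turn s - turn t by rewrite /turn; ring.
  by rewrite cosB ss cs -!expr2 cos2Dsin2.
by exists n; rewrite -nE subrKC.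
Qed.

End Trigo.

Section Circle.
Variables (R : realType) (S : smoothSurface R) (c : chart R S).
Hypothesis cc : compatible c.

(** In the chart, take a circle through c p that is tangent to w; its radius is
    small enough for the circle to remain in the image of the chart. *)
Lemma circle_curve p (w : plane R) : cdom c p -> w != 0 ->
  exists (g : R -> S) (a : R), [/\ C1_embedding g, g 0 = p, a != 0 &
    is_derive (0 : R) (1 : R) (c \o g) (a *: w)].
Proof.
move=> cp w0; have nw : 0 < `|w| by rewrite normr_gt0.
have /near_normP[d d0 Hd] := cimg_near cp.
pose r := d / (4 * `|w|).
have r0 : 0 < r by rewrite divr_gt0 // mulr_gt0.
have rw : r * `|w| * 3 < d by rewrite /r invfM mulrA divfK ?gt_eqF //; lra.
pose k t : plane R := ((c p).1 + r * (w.1 * sin (turn t) - w.2 * (1 - cos (turn t))),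
                       (c p).2 + r * (w.2 * sin (turn t) + w.1 * (1 - cos (turn t)))).
pose q : R := pi *+ 2.
pose k1 t : plane R := (r * (w.1 * (q * cos (turn t)) - w.2 * (q * sin (turn t))),
                       r * (w.2 * (q * cos (turn t)) + w.1 * (q * sin (turn t)))).
pose k2 t : plane R := (r * (- w.1 * (q * (q * sin (turn t))) - w.2 * (q * (q * cos (turn t)))),
                       r * (- w.2 * (q * (q * sin (turn t))) + w.1 * (q * (q * cos (turn t))))).
have q0 : 0 < q by rewrite /q pmulrn_rgt0 // pi_gt0.
have ds := @is_derive_sin_turn R; have dc := @is_derive_cos_turn R.
have dk s : is_derive s (1 : R) k (k1 s).
  apply/is_derive_pair; split; apply: is_derive_eq.
  - by rewrite /GRing.scale /= -/q; ring.
  - by rewrite /GRing.scale /= -/q; ring.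
have dk1 s : is_derive s (1 : R) k1 (k2 s).
  apply/is_derive_pair; split; apply: is_derive_eq.
  - by rewrite /GRing.scale /= -/q; ring.
  - by rewrite /GRing.scale /= -/q; ring.
have w2 : 0 < w.1 ^+ 2 + w.2 ^+ 2.
  rewrite lt_neqAle addr_ge0 ?sqr_ge0 // andbT eq_sym paddr_eq0 ?sqr_ge0 //.
  rewrite !sqrf_eq0; apply: contra w0 => /andP[/eqP h1 /eqP h2].
  by rewrite (surjective_pairing w) h1 h2.
have k10 t : k1 t != 0.
  apply/eqP => /(congr1 (fun z => (z.1, z.2))) [] h1 h2.
  have e : (r * q) ^+ 2 * (w.1 ^+ 2 + w.2 ^+ 2) * (cos (turn t) ^+ 2 + sin (turn t) ^+ 2) = 0.
    rewrite [LHS](_ : _ = (r * (w.1 * (q * cos (turn t)) - w.2 * (q * sin (turn t)))) ^+ 2 +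
        (r * (w.2 * (q * cos (turn t)) + w.1 * (q * sin (turn t)))) ^+ 2); last by ring.
    by rewrite h1 h2 expr0n /= addr0.
  move/eqP: e; apply/negP; rewrite cos2Dsin2 mulr1 mulf_neq0 ?lt0r_neq0 //.
  by rewrite exprn_gt0 // mulr_gt0.
have kimg t : (c @` cdom c) (k t).
  apply: Hd; apply: normr_pair_lt => /=; rewrite addrC addKr normrM gtr0_norm //;
    apply: le_lt_trans rw; rewrite -mulrA ler_pM2l //.
  - rewrite (le_trans (ler_normB _ _)) // !normrM.
    have := sin_max (turn t); have := normr_fst_le w; have := normr_snd_le w.
    have : `|1 - cos (turn t)| <= 2.
      by rewrite ger0_norm ?subr_ge0 ?cos_le1 //; have := cos_geN1 (turn t); lra.
    move: (normr_ge0 w.1) (normr_ge0 w.2) (normr_ge0 (sin (turn t))) (normr_ge0 (1 - cos (turn t))).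
    by move: `|w.1| `|w.2| `|sin (turn t)| `|1 - cos (turn t)| `|w| nw => a b x y z; nra.
  - rewrite (le_trans (ler_normD _ _)) // !normrM.
    have := sin_max (turn t); have := normr_fst_le w; have := normr_snd_le w.
    have : `|1 - cos (turn t)| <= 2.
      by rewrite ger0_norm ?subr_ge0 ?cos_le1 //; have := cos_geN1 (turn t); lra.
    move: (normr_ge0 w.1) (normr_ge0 w.2) (normr_ge0 (sin (turn t))) (normr_ge0 (1 - cos (turn t))).
    by move: `|w.1| `|w.2| `|sin (turn t)| `|1 - cos (turn t)| `|w| nw => a b x y z; nra.
have kr t : regular k t := regular_of_derive2 dk dk1 (k10 t).
pose g := cinv c \o k.
have cg t : cdom c (g t) /\ c (g t) = k t := chart_image_inv (kimg t).
have k0 : k 0 = c p.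
  by rewrite /k /turn mulr0 sin0 cos0 subrr !mulr0 subr0 addr0 mulr0 !addr0 -surjective_pairing.
have cgk : c \o g = k by apply/funext => t; exact: (cg t).2.
have gcont t : {for t, continuous g}.
  apply: continuous_comp; first exact: nbhs_singleton (regular_continuous (kr t)).
  by have [q' cq' <-] := kimg t; exact: cinv_continuous.
exists g, (r * q); split.
- apply: surface_regular_embedding.
  + by move=> t; rewrite /g /= /k sin_turn1 cos_turn1.
  + apply: int_periodic_inj => s t gst.
    have : k s = k t by rewrite -(cg s).2 -(cg t).2 gst.
    move=> /(congr1 (fun z => (z.1, z.2))) [] /addrI/(mulfI (lt0r_neq0 r0)) h1.
    move=> /addrI/(mulfI (lt0r_neq0 r0)) h2.
    have h11 := congr1 ( *%R w.1) h1; have h12 := congr1 ( *%R w.1) h2.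
    have h21 := congr1 ( *%R w.2) h1; have h22 := congr1 ( *%R w.2) h2.
    by apply: turn_inj; apply: (mulfI (lt0r_neq0 w2)); lra.
  + move=> t; apply: (surface_regular_chart cc); last by rewrite cgk.
      exact: near_everywhere.
    exact: (cg t).1.
- by rewrite /g /= k0 cmapK.
- by rewrite mulf_neq0 // lt0r_neq0.
- rewrite cgk; have := dk 0; congr is_derive.
  rewrite /k1 /turn mulr0 sin0 cos0 !mulr1 !mulr0 subr0 addr0.
  by rewrite [RHS]surjective_pairing /= /GRing.scale /=; congr (_, _); ring.
Qed.

Lemma tangent_line_exists p (v : tangent p) (w : plane R) (L : projective (tangent p)) :
  cdom c p -> coord c v w -> v != 0 -> pline L v ->
  exists2 A, C1_curve A & tangent_line A (PTPoint L).
Proof.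
move=> cp vw v0 Lv; have w0 := coord_neq0_plane vw v0.
have [g [a [gE g0 a0 dg]]] := circle_curve cp w0.
exists (range g); first by exists g.
have cg : {for 0, continuous g} := nbhs_singleton (embedding_surface_regular gE 0).1.
have [v' gv' cv'] := coord_velocity cc g0 cg cp dg.
have E : v' = a *: v := coord_inj cv' (coord_scale a vw).
exists g, 0, v'; split=> //.
  by rewrite E scaler_eq0 negb_or a0.
by rewrite E; exact: line_scale.
Qed.

End Circle.

(** * A homeomorphism of the line that is cubic at the integers *)
Section InverseContinuous.

(** If V is an open neighbourhood of G y, then F maps the compact set K minus V to
    a closed set that does not contain y. *)
Lemma inverse_continuous (T U : topologicalType) (F : T -> U) (G : U -> T) y K :
  hausdorff_space U -> cancel F G -> cancel G F -> continuous F -> compact K ->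
  nbhs y (F @` K) -> {for y, continuous G}.
Proof.
move=> hU FG GF cF cK yK V /= GyV.
pose K' := K `&` ~` V^°.
have cK' : compact K'.
  by apply: compact_closedI => //; apply: open_closedC; exact: open_interior.
have clK : closed (F @` K').
  apply: compact_closed => //; apply: continuous_compact => //.
  exact: continuous_subspaceT.
have yK' : (~` (F @` K')) y.
  by move=> [x [_ nV] Fxy]; apply: nV; rewrite -(FG x) Fxy; exact: GyV.
have H : \forall z \near y, (~` (F @` K')) z.
  by apply: open_nbhs_nbhs; split=> //; exact: closed_openC.
apply: filterS2 yK H => z [x Kx <-] /= nz; rewrite FG.
apply: interior_subset; apply: contrapT => nV; apply: nz.
by exists x.
Qed.

Variable R : realType.

Lemma inverse_supported (F G : plane R -> plane R) : cancel F G -> cancel G F ->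
  continuous F -> (forall x, 1 <= `|x| -> F x = x) -> supported F G.
Proof.
move=> FG GF cF F1; split=> // y.
apply: (inverse_continuous _ FG GF cF (@compact_square R (`|y| + 1))).
  exact: norm_hausdorff.
apply: filterS (near_norm_lt y ltr01) => z zy.
exists (G z); last exact: GF.
have zM : `|z| <= `|y| + 1.
  by rewrite -[z](subrKC y) (le_trans (ler_normD _ _)) // lerD2l ltW.
rewrite /= leNgt; apply/negP => GzM.
have : 1 <= `|G z| by apply: le_trans (ltW GzM); rewrite lerDr.
by move=> /F1; rewrite GF => zG; move: GzM; rewrite -zG ltNge zM.
Qed.

End InverseContinuous.

Section Sigma.
Variable R : realType.
Implicit Types t s : R.

Local Notation q := (pi *+ 2 : R).

Lemma q_gt0 : 0 < q. Proof. by rewrite pmulrn_rgt0 // pi_gt0. Qed.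

(** Its derivative 1 - cos(2 pi t) is nonnegative and vanishes to second order at
    the integers, and nowhere else. *)
Definition sigma t : R := t - q^-1 * sin (turn t).
Definition dsigma t : R := 1 - cos (turn t).

Lemma sigmaE t : sigma t = t - q^-1 * sin (turn t). Proof. by []. Qed.
Lemma dsigmaE t : dsigma t = 1 - cos (turn t). Proof. by []. Qed.

Lemma is_derive_sigma t : is_derive t (1 : R) sigma (dsigma t).
Proof.
have ds := is_derive_sin_turn t.
rewrite /sigma; apply: is_derive_eq; rewrite /dsigma /GRing.scale /=.
by rewrite mulrA mulVf ?mul1r // gt_eqF // q_gt0.
Qed.

Lemma is_derive_dsigma t : is_derive t (1 : R) dsigma (q * sin (turn t)).
Proof.
have ds := is_derive_cos_turn t.
by rewrite /dsigma; apply: is_derive_eq; ring.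
Qed.

Lemma dsigma_ge0 t : 0 <= dsigma t.
Proof. by rewrite subr_ge0 cos_le1. Qed.

Lemma dsigma_neq0 t : (forall n : int, t != n%:~R) -> dsigma t != 0.
Proof.
move=> tn; rewrite subr_eq0 eq_sym; apply/eqP => /cos_turn_eq1[n tE].
by move: (tn n); rewrite tE eqxx.
Qed.

Lemma dsigma_continuous : continuous dsigma.
Proof. by move=> t; apply: derivable_path_continuous; have := is_derive_dsigma t. Qed.

Lemma sigma_continuous : continuous sigma.
Proof. by move=> t; apply: derivable_path_continuous; have := is_derive_sigma t. Qed.

Lemma sigma1 t : sigma (t + 1) = sigma t + 1.
Proof. by rewrite /sigma sin_turn1; ring. Qed.

Lemma sigma0 : sigma 0 = 0.
Proof. by rewrite /sigma /turn mulr0 sin0 mulr0 subr0. Qed.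

Lemma sigma_regular t : (forall n : int, t != n%:~R) -> regular sigma t.
Proof.
move=> tn; exact: (regular_of_derive2 is_derive_sigma is_derive_dsigma (dsigma_neq0 tn)).
Qed.

Lemma near_nonint t : t != 0 -> `|t| < 1 -> forall n : int, t != n%:~R.
Proof.
move=> t0 t1 n; apply/eqP => tn; move: t1; rewrite tn -intr_norm => n1.
have : `|n| < 1 by move: n1; rewrite (_ : 1 = 1%:~R :> R) // ltr_int.
by move: t0 => /[swap]; move: tn; case: n {n1} => [[|n]|n] //= ->; rewrite mulr0z eqxx.
Qed.

Lemma sin_lt t : 0 < t -> sin t < t.
Proof.
move=> t0; have [t1|t1] := ltP 1 t; first exact: le_lt_trans (sin_le1 _) t1.
have [|u] := @MVT R (fun s => s - sin s) (fun s => 1 - cos s) 0 t t0.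
  apply: continuous_subspaceT => x; apply: derivable_path_continuous.
  by apply: derivableB.
rewrite in_itv /= => /andP[u0 ut]; rewrite sin0 !subr0 => E.
rewrite -subr_gt0 E mulr_gt0 // subr_gt0 lt_neqAle cos_le1 andbT.
apply/eqP => cu1; have : sin u = 0 by apply: cos1sin0; rewrite cu1 normr1.
have u2 : u < pi by apply: lt_le_trans ut _; apply: le_trans t1 _; have := pi_ge2 R; lra.
by move=> su; have := @sin_gt0_pi R u; rewrite su ltxx u0 u2 => /(_ isT).
Qed.

(** The increment of sin(2 pi t) is 2 sin(b - a) cos(b + a) where b - a is pi times
    the increment of t, and |sin u| < u for u > 0. *)
Lemma sigma_incr s t : s < t -> sigma s < sigma t.
Proof.
move=> st; rewrite /sigma -subr_gt0.
pose a := turn s / 2; pose b := turn t / 2.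
have ba : 0 < b - a by rewrite /a /b -mulrBl divr_gt0 // /turn -mulrBr mulr_gt0 ?q_gt0 // subr_gt0.
have E : sin (turn t) - sin (turn s) = 2 * (sin (b - a) * cos (b + a)).
  have -> : turn t = (b + a) + (b - a) by rewrite /a /b; field.
  have -> : turn s = (b + a) - (b - a) by rewrite /a /b; field.
  by rewrite (sinD (b + a)) (sinB (b + a)); ring.
have F : sin (turn t) - sin (turn s) < q * (t - s).
  apply: (@le_lt_trans _ _ (2 * `|sin (b - a)|)).
    rewrite E ler_pM2l // (le_trans (ler_norm _)) // normrM.
    by rewrite ler_piMr // cos_max.
  have -> : q * (t - s) = 2 * (b - a) by rewrite /a /b /turn; field.
  rewrite ltr_pM2l // ltr_norml sin_lt // andbT.
  have [p1|p1] := ltP (b - a) 2.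
    have s0 : 0 < sin (b - a) by apply: sin_gt0_pi; rewrite ba; apply: lt_le_trans p1 (pi_ge2 R).
    by apply: lt_trans s0; rewrite oppr_lt0.
  by apply: lt_le_trans (sin_geN1 _); lra.
have -> : t - q^-1 * sin (turn t) - (s - q^-1 * sin (turn s)) =
  (t - s) - q^-1 * (sin (turn t) - sin (turn s)) by ring.
by rewrite subr_gt0 ltr_pdivrMl ?q_gt0.
Qed.

End Sigma.

Lemma inj_surj_inverse (T U : Type) (F : T -> U) : injective F ->
  (forall y, exists x, F x = y) -> exists G, cancel F G /\ cancel G F.
Proof.
move=> Fi /choice[G FG]; exists G; split=> // x.
by apply: Fi; rewrite FG.
Qed.

Section SigmaInverse.
Variable R : realType.
Implicit Types t s : R.

Local Notation q := (pi *+ 2 : R).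
Local Notation sigma := (@sigma R).
Local Notation dsigma := (@dsigma R).

Lemma sigma_inj : injective sigma.
Proof.
move=> s t st; apply/eqP; rewrite eq_le !leNgt; apply/andP; split; apply/negP => /sigma_incr.
  by rewrite st ltxx.
by rewrite st ltxx.
Qed.

Lemma sigma_ivt a b y : a <= b -> sigma a <= y -> y <= sigma b ->
  exists2 x, a <= x <= b & sigma x = y.
Proof.
move=> ab ay yb; have [||x] := @IVT R sigma a b y ab.
- by apply: continuous_subspaceT; exact: sigma_continuous.
- by rewrite ge_min le_max ay yb orbT.
by rewrite in_itv /=; exists x.
Qed.

Lemma sigma_surj y : exists x, sigma x = y.
Proof.
have q1 : `|q^-1 * sin (turn (y - 1))| <= 1 /\ `|q^-1 * sin (turn (y + 1))| <= 1.
  have H z : `|q^-1 * sin z| <= 1.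
    rewrite normrM gtr0_norm ?invr_gt0 ?q_gt0 // ler_pdivrMl ?q_gt0 // mulr1.
    by apply: (le_trans (sin_max _)); have := pi_ge2 R; rewrite mulr2n; lra.
  by split; exact: H.
move: q1; rewrite !ler_norml => -[/andP[h1 h2] /andP[h3 h4]].
have [|||x _ xE] := @sigma_ivt (y - 1) (y + 1) y; [lra| | |by exists x];
  by rewrite sigmaE; lra.
Qed.

Lemma sigma_inverse : exists l : R -> R, [/\ cancel sigma l, cancel l sigma,
  continuous l, forall t, l (t + 1) = l t + 1 & l 0 = 0].
Proof.
have [l [sl ls]] := inj_surj_inverse sigma_inj sigma_surj.
exists l; split=> //.
- move=> y; apply: (inverse_continuous _ sl ls (@sigma_continuous R) (@segment_compact R (l y - 1) (l y + 1))).
    exact: norm_hausdorff.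
  have h1 : sigma (l y + 1) = y + 1 by rewrite sigma1 ls.
  have h2 : sigma (l y - 1) = y - 1.
    by apply: (addIr 1); rewrite -sigma1 !subrK ls.
  apply: filterS (near_norm_lt y ltr01) => z; rewrite ltr_norml => /andP[z1 z2].
  have [|||x xE xz] := @sigma_ivt (l y - 1) (l y + 1) z; rewrite ?h1 ?h2; try lra.
  by exists x => //=; rewrite in_itv.
- by move=> t; apply: sigma_inj; rewrite sigma1 !ls.
- by apply: sigma_inj; rewrite ls sigma0.
Qed.

Lemma sigma_dir_diffeo t : dsigma t != 0 -> dir_diffeo sigma (fun s v => v *: dsigma s) t.
Proof.
move=> t0; split.
- by apply: is_derive_dirC1; [exact: is_derive_sigma|exact: dsigma_continuous].
- by move=> z; exists (z / dsigma t); rewrite /GRing.scale /= divfK.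
- have n0 : 0 < dsigma t by rewrite lt_neqAle eq_sym t0 dsigma_ge0.
  exists (dsigma t / 2); first by rewrite divr_gt0.
  have n2 : 0 < dsigma t / 2 by rewrite divr_gt0.
  have /cvgrPdist_lt /(_ _ n2) H := @dsigma_continuous R t.
  apply: filterS H => s h v w.
  rewrite -scalerBl normrZ mulrC ler_wpM2l // [leRHS]ger0_norm ?dsigma_ge0 //.
  by move: h; rewrite ltr_norml => /andP[]; lra.
Qed.

Lemma sigma_inverse_regular l t : cancel l sigma -> cancel sigma l -> continuous l ->
  (forall n : int, t != n%:~R) ->
  regular l t /\ \forall s \near t, derive1 l s * dsigma (l s) = 1.
Proof.
move=> ls sl cl tn.
have lt0 : dsigma (l t) != 0.
  apply: dsigma_neq0 => n; apply/eqP => ltn; move: (tn n); rewrite -(ls t) ltn.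
  have H : forall u, sigma (u + 1) - (u + 1) = sigma u - u by move=> u; rewrite sigma1; ring.
  have := periodic_int (g := fun u => sigma u - u) H 0 n.
  by rewrite sigma0 subr0 add0r => /eqP; rewrite subr_eq0 => /eqP ->; rewrite eqxx.
have H : \forall s \near t, dir_diffeo sigma (fun s v => v *: dsigma s) (l s).
  have n0 : 0 < `|dsigma (l t)| by rewrite normr_gt0.
  have c : {for t, continuous (dsigma \o l)}.
    by apply: continuous_comp; [exact: cl|exact: dsigma_continuous].
  have /cvgrPdist_lt /(_ _ n0) h := c.
  apply: filterS h => s hs; apply: sigma_dir_diffeo; apply/eqP => s0.
  by move: hs; rewrite /= s0 subr0 ltxx.
have slE : sigma \o l = idfun by apply/funext => s /=; rewrite ls.
have rid s : regular (@idfun R) s.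
  have -> : @idfun R = fun u => u + 0 by apply/funext => u; rewrite addr0.
  exact: regular_shift.
have [|r1 r2] := @regular_inverse R R R sigma _ l t H (near_everywhere _ cl).
  by rewrite slE.
split=> //; apply: filterS r2 => s; rewrite slE => e.
rewrite -[LHS]/(derive1 l s *: dsigma (l s)) e.
by rewrite derive1_id.
Qed.

(** This follows from 1 - cos(2 pi t) = 2 sin(pi t)^2 and the derivative of
    sin(pi t) at 0. *)
Lemma cvg_dsigma : (fun t => dsigma t / t ^+ 2) @ (0 : R)^' --> q ^+ 2 / 2.
Proof.
have d : is_derive (0 : R) (1 : R) (fun s => sin (pi * s)) (pi * cos (pi * 0)).
  by apply: is_derive_eq; rewrite /GRing.scale /=; ring.
have := derive_quotient d; rewrite mulr0 cos0 sin0 mulr1 => H.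
have H2 : (fun s => 2 * (((s - 0)^-1 *: (sin (pi * s) - 0)) * ((s - 0)^-1 *: (sin (pi * s) - 0)))) @ (0 : R)^' --> 2 * (pi * pi).
  by apply: cvgM; [exact: cvg_cst|exact: cvgM].
rewrite (_ : q ^+ 2 / 2 = 2 * (pi * pi)); last by rewrite mulr2n; field.
apply: cvg_trans H2; apply: near_eq_cvg; rewrite near_withinE.
apply: filterS (near_norm_lt (0 : R) ltr01) => t _ t0.
rewrite /GRing.scale /= !subr0 dsigmaE.
have -> : turn t = (pi * t) *+ 2 by rewrite /turn; ring.
rewrite cos_mulr2n.
have := cos2Dsin2 (pi * t) => /(congr1 (fun z => z - sin (pi * t) ^+ 2)).
by rewrite addrK => ->; field.
Qed.

(** The mean value theorem, applied to sigma t - (q^2 / 6) t^3, reduces this limit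
    to that of the derivative. *)
Lemma cvg_sigma : (fun t => sigma t / t ^+ 3) @ (0 : R)^' --> q ^+ 2 / 6.
Proof.
apply/cvgrPdist_le => e e0; rewrite near_withinE.
have /cvgrPdist_le /(_ e e0) := cvg_dsigma; rewrite near_withinE => H.
have /near_normP[d d0 Hd] : \forall t \near (0 : R), t != 0 ->
  `|q ^+ 2 / 2 - dsigma t / t ^+ 2| <= e by exact: H.
apply: filterS (near_norm_lt (0 : R) d0) => t td t0.
pose k := q ^+ 2 / 6.
have [||u [ut u0]] := @mvt_ball R (fun s => sigma s - k * s ^+ 3)
   (fun s => dsigma s - k * (3 * s ^+ 2)) 0 t t0.
- move=> x _ _; have ds := is_derive_sigma x.
  by apply: is_derive_eq; rewrite /GRing.scale /=; ring.
- apply: derivable_path_continuous; have ds := is_derive_sigma 0.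
  by apply: derivableB => //; apply: derivableM => //; exact: exprn_derivable.
rewrite sigma0 expr0n /= mulr0 subrr !subr0 => E.
have := Hd u (le_lt_trans ut td) u0.
have u2 : 0 < u ^+ 2 by rewrite exprn_even_gt0.
have t3 : 0 < `|t ^+ 3| by rewrite normr_gt0 expf_neq0.
move=> h.
have h' : `|dsigma u - k * (3 * u ^+ 2)| <= e * u ^+ 2.
  have -> : dsigma u - k * (3 * u ^+ 2) = - ((q ^+ 2 / 2 - dsigma u / u ^+ 2) * u ^+ 2).
    by rewrite /k; field.
  by rewrite normrN normrM [X in _ * X](ger0_norm (ltW u2)) ler_pM2r.
have -> : q ^+ 2 / 6 - sigma t / t ^+ 3 = - ((sigma t - k * t ^+ 3) / t ^+ 3).
  by rewrite /k; field.
rewrite normrN normrM normfV ler_pdivrMr // E normrM.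
have -> : `|t ^+ 3| = `|t| ^+ 2 * `|t| by rewrite normrX exprSr.
rewrite [e * _]mulrA ler_wpM2r // (le_trans h') // ler_wpM2l ?(ltW e0) //.
rewrite -(real_normK (num_real u)) ler_sqr ?nnegrE //.
by move: ut; rewrite !subr0.
Qed.

(** Factor M^3 - x^3; the second factor is at least M^2 as x >= 0. *)
Lemma cvg_cube (T : Type) (Fi : set_system T) {FF : Filter Fi} (f : T -> R) (M : R) :
  (forall x, 0 <= f x) -> 0 < M -> (fun x => f x ^+ 3) @ Fi --> M ^+ 3 ->
  f @ Fi --> M.
Proof.
move=> f0 M0 /cvgrPdist_le H; apply/cvgrPdist_le => e e0.
have eM : 0 < e * M ^+ 2 by rewrite mulr_gt0 // exprn_gt0.
have M2 : 0 < M ^+ 2 by rewrite exprn_gt0.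
apply: filterS (H _ eM) => x h.
rewrite -(ler_pM2r M2); apply: le_trans h.
have -> : M ^+ 3 - f x ^+ 3 = (M - f x) * (M ^+ 2 + M * f x + f x ^+ 2) by ring.
rewrite normrM ler_wpM2l // ger0_norm.
  by rewrite -addrA lerDl addr_ge0 ?sqr_ge0 // mulr_ge0 // ltW.
by rewrite !addr_ge0 ?sqr_ge0 // mulr_ge0 // ltW.
Qed.

Lemma cube_root_exists (a : R) : 0 < a -> exists2 M : R, 0 < M & M ^+ 3 = a.
Proof.
move=> a0; exists (a `^ (3^-1)); first exact: powR_gt0.
by rewrite -powR_mulrn ?powR_ge0 // -powRrM mulVf // powRr1 // ltW.
Qed.

End SigmaInverse.

(** * The radial map *)
Section Profile.
Variable R : realType.
Implicit Types s t u : R.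

Definition pos u : R := Num.max u 0.

Lemma pos_ge0 u : 0 <= pos u. Proof. by rewrite /pos le_max lexx orbT. Qed.
Lemma pos_id u : 0 <= u -> pos u = u. Proof. by move=> h; apply/max_idPl. Qed.
Lemma pos_0 u : u <= 0 -> pos u = 0. Proof. by move=> h; apply/max_idPr. Qed.

Lemma pos_lip s t : `|pos s - pos t| <= `|s - t|.
Proof.
have [s0|s0] := leP 0 s; have [t0|t0] := leP 0 t.
- by rewrite !pos_id.
- rewrite (pos_id s0) (pos_0 (ltW t0)) subr0 !ger0_norm //; lra.
- rewrite (pos_0 (ltW s0)) (pos_id t0) sub0r normrN ger0_norm // ler0_norm; lra.
- by rewrite !pos_0 ?(ltW s0) ?(ltW t0) // subrr normr0.
Qed.

Lemma pos_continuous : continuous pos.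
Proof.
move=> t; apply/cvgrPdist_le => e e0; apply: filterS (near_norm_lt t e0) => s /ltW h.
by apply: le_trans (pos_lip _ _) _; rewrite distrC.
Qed.

Lemma is_derive_pos2 t : is_derive t (1 : R) (fun u => pos u ^+ 2) (2 * pos t).
Proof.
apply/is_derive_pathP => d d0; apply: filterS (near_norm_lt t d0) => s /ltW h.
apply: (@le_trans _ _ (`|s - t| * `|s - t|)); last by rewrite ler_wpM2r.
rewrite -normrM ger0_norm; last by rewrite -expr2 sqr_ge0.
rewrite /GRing.scale /=.
have h2 : 0 <= (s - t) * (s - t) by rewrite -expr2 sqr_ge0.
have hs : 0 <= s * s by rewrite -expr2 sqr_ge0.
have ht : 0 <= t * t by rewrite -expr2 sqr_ge0.
rewrite !expr2 ler_norml; have [s0|s0] := leP 0 s; have [t0|t0] := leP 0 t.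
- by rewrite !pos_id //; apply/andP; split; lra.
- rewrite (pos_id s0) (pos_0 (ltW t0)); have := mulr_ge0_le0 s0 (ltW t0).
  by move=> st; apply/andP; split; lra.
- rewrite (pos_0 (ltW s0)) (pos_id t0); have := mulr_le0_ge0 (ltW s0) t0.
  by move=> st; apply/andP; split; lra.
- by rewrite !pos_0 ?(ltW s0) ?(ltW t0) //; apply/andP; split; lra.
Qed.

Lemma dirC1_pos2 t : dirC1 (fun u => pos u ^+ 2) (fun u v => v * (2 * pos u)) t.
Proof.
apply: is_derive_dirC1; first exact: is_derive_pos2.
by apply: cvgM; [exact: cvg_cst|exact: pos_continuous].
Qed.

(** A C^1 function that is s (2 - s) up to s = 1 and 1 from there on.  Being linear
    and increasing at 0 is what makes the radial map cubic at the origin. *)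
Definition phi s : R := 1 - pos (1 - s) ^+ 2.
Definition dphi s : R := 2 * pos (1 - s).

Lemma dirC1_phi t : dirC1 phi (fun s v => v * dphi s) t.
Proof.
have H1 : dirC1 (fun s : R => -1 * s + 1) (fun s v => (-1 * v + s * 0) + 0) t.
  apply: dirC1_add; last exact: dirC1_cst.
  by apply: dirC1_mul; [exact: dirC1_cst|exact: dirC1_id].
have H2 := dirC1_comp H1 (dirC1_pos2 _).
have H3 : dirC1 (fun x : R => -1 * x + 1) (fun x v => (-1 * v + x * 0) + 0) ((fun u => pos u ^+ 2) (-1 * t + 1)).
  apply: dirC1_add; last exact: dirC1_cst.
  by apply: dirC1_mul; [exact: dirC1_cst|exact: dirC1_id].
apply: dirC1_eq (dirC1_comp H2 H3).
  by apply/funext => s /=; rewrite /phi (_ : -1 * s + 1 = 1 - s); ring.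
move=> s v /=; rewrite /dphi (_ : -1 * s + 1 = 1 - s); ring.
Qed.

Lemma phi_le1 s : s <= 1 -> phi s = s * (2 - s).
Proof. by move=> s1; rewrite /phi pos_id ?subr_ge0 //; ring. Qed.

Lemma dphi_le1 s : s <= 1 -> dphi s = 2 * (1 - s).
Proof. by move=> s1; rewrite /dphi pos_id ?subr_ge0. Qed.

Lemma phi_ge1 s : 1 <= s -> phi s = 1.
Proof. by move=> s1; rewrite /phi pos_0 ?subr_le0 // expr0n subr0. Qed.

Lemma dphi_ge0 s : 0 <= dphi s.
Proof. by rewrite mulr_ge0 // pos_ge0. Qed.

Lemma phi0 : phi 0 = 0.
Proof. by rewrite phi_le1 // mul0r. Qed.

Lemma phi_gt0 s : 0 < s -> 0 < phi s.
Proof.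
move=> s0; have [s1|s1] := leP s 1; last by rewrite phi_ge1 // ltW.
by rewrite phi_le1 // mulr_gt0 //; lra.
Qed.

Lemma phi_le s t : 0 <= s -> s <= t -> phi s <= phi t.
Proof.
move=> s0 st; have [s1|s1] := leP 1 s; first by rewrite !phi_ge1 // (le_trans s1).
have [t1|t1] := leP 1 t; first 
  by rewrite (phi_ge1 t1) (phi_le1 (ltW s1)); have := sqr_ge0 (1 - s); rewrite expr2; lra.
rewrite (phi_le1 (ltW s1)) (phi_le1 (ltW t1)).
have h1 : 0 <= t - s by lra.
have h2 : 0 <= 2 - s - t by lra.
have := mulr_ge0 h1 h2; lra.
Qed.

Lemma phi_continuous : continuous phi.
Proof. by move=> s; exact: dirC1_continuous (dirC1_phi s). Qed.

End Profile.

Section RadialMap.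
Variable R : realType.
Implicit Types x v w z : plane R.

Definition dot x v : R := x.1 * v.1 + x.2 * v.2.
Definition nsq x : R := dot x x.
(** The Euclidean norm is used in order to have a smooth function of x.  It
    dominates the sup norm, so the map is the identity outside of the unit
    square. *)
Definition radial x : plane R := phi (nsq x) *: x.
Definition dradial x v : plane R :=
  phi (nsq x) *: v + (dphi (nsq x) * (2 * dot x v)) *: x.

Lemma dotC x v : dot x v = dot v x. Proof. by rewrite /dot; ring. Qed.
Lemma dotZl a x v : dot (a *: x) v = a * dot x v.
Proof. by rewrite /dot /= /GRing.scale /=; ring. Qed.
Lemma dotZr a x v : dot x (a *: v) = a * dot x v.
Proof. by rewrite dotC dotZl dotC. Qed.
Lemma dotDr x v w : dot x (v + w) = dot x v + dot x w.
Proof. by rewrite /dot /=; ring. Qed.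
Lemma nsqZ a x : nsq (a *: x) = a ^+ 2 * nsq x.
Proof. by rewrite /nsq dotZl dotZr mulrA -expr2. Qed.

Lemma nsq_ge0 x : 0 <= nsq x.
Proof. by rewrite /nsq /dot -!expr2 addr_ge0 ?sqr_ge0. Qed.

Lemma nsq_gt0 x : x != 0 -> 0 < nsq x.
Proof.
rewrite lt_neqAle nsq_ge0 andbT; apply: contra_neq => /esym.
rewrite /nsq /dot -!expr2 => /eqP; rewrite paddr_eq0 ?sqr_ge0 // !sqrf_eq0.
by move=> /andP[/eqP h1 /eqP h2]; rewrite (surjective_pairing x) h1 h2.
Qed.

Lemma nsq_ge x : `|x| ^+ 2 <= nsq x.
Proof.
rewrite /nsq /dot -!expr2 prod_normE.
have [h|h] := leP `|x.1| `|x.2|; rewrite -normrX ger0_norm ?sqr_ge0 //.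
  by rewrite lerDr sqr_ge0.
by rewrite lerDl sqr_ge0.
Qed.

Lemma dot_le x v : `|dot x v| <= 2 * `|x| * `|v|.
Proof.
rewrite /dot (le_trans (ler_normD _ _)) // !normrM -mulrA mulr_natl mulr2n.
by apply: lerD; apply: ler_pM => //; rewrite ?normr_fst_le ?normr_snd_le.
Qed.

Lemma dirC1_nsq p : dirC1 nsq (fun x v => 2 * dot x v) p.
Proof.
have H1 := dirC1_fst (U := R) (V := R) p; have H2 := dirC1_snd (U := R) (V := R) p.
apply: dirC1_eq (dirC1_add (dirC1_mul H1 H1) (dirC1_mul H2 H2)) => //.
by move=> x v; rewrite /dot; ring.
Qed.

Lemma nsq_continuous : continuous nsq.
Proof. by move=> x; exact: dirC1_continuous (dirC1_nsq x). Qed.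

Lemma dirC1_radial p : dirC1 radial dradial p.
Proof.
have H := dirC1_comp (dirC1_nsq p) (dirC1_phi _).
have H1 := dirC1_fst (U := R) (V := R) p; have H2 := dirC1_snd (U := R) (V := R) p.
apply: dirC1_eq (dirC1_pair (dirC1_mul H H1) (dirC1_mul H H2)).
  by apply/funext => -[x y].
move=> x v; rewrite /dradial [RHS]surjective_pairing /= /GRing.scale /=.
by congr (_, _); ring.
Qed.

Lemma radial_continuous : continuous radial.
Proof. by move=> x; exact: dirC1_continuous (dirC1_radial x). Qed.

Lemma dradialB x v w : dradial x v - dradial x w = dradial x (v - w).
Proof.
rewrite /dradial [LHS]surjective_pairing [RHS]surjective_pairing /= /GRing.scale /=.
by rewrite /dot /=; congr (_, _); ring.
Qed.

(** Pair the differential with v: the radial term contributes dphi times a square,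
    so the pairing is at least phi (nsq x) * nsq v. *)
Lemma dradial_lower x v : phi (nsq x) / 2 * `|v| <= `|dradial x v|.
Proof.
have [->|v0] := eqVneq v 0; first by rewrite normr0 mulr0.
have nv : 0 < `|v| by rewrite normr_gt0.
have h1 : phi (nsq x) * nsq v <= dot v (dradial x v).
  rewrite /dradial dotDr !dotZr -/(nsq v) lerDl dotC -mulrA mulr_ge0 ?dphi_ge0 //.
  by rewrite -mulrA mulr_ge0 // -expr2 sqr_ge0.
have h2 := le_trans (ler_norm _) (dot_le v (dradial x v)).
have h3 := nsq_ge v.
have p0 : 0 <= phi (nsq x).
  by rewrite -(phi0 R); apply: phi_le => //; exact: nsq_ge0.
have h4 : phi (nsq x) * `|v| ^+ 2 <= phi (nsq x) * nsq v by rewrite ler_wpM2l.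
rewrite -(ler_pM2r nv) -(ler_pM2l (ltr0n R 2)).
have := le_trans h4 (le_trans h1 h2); rewrite expr2; lra.
Qed.

(** The differential is a multiple of the identity plus a matrix of rank one, and
    this is the corresponding formula for its inverse. *)
Definition dradial_inverse x z : plane R :=
  (phi (nsq x))^-1 *: (z - ((dphi (nsq x) * 2 * dot x z) /
     (phi (nsq x) + dphi (nsq x) * 2 * nsq x)) *: x).

Lemma dradialK x z : x != 0 -> dradial x (dradial_inverse x z) = z.
Proof.
rewrite /dradial_inverse => x0; have n0 := nsq_gt0 x0; have p0 := phi_gt0 n0; have d0 := dphi_ge0 (nsq x).
rewrite /dradial; move: (phi (nsq x)) (dphi (nsq x)) p0 d0 n0 => p d p0 d0 n0.
have E : p + d * 2 * nsq x != 0 by rewrite gt_eqF // ltr_wpDr // !mulr_ge0 // ltW.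
rewrite [LHS]surjective_pairing [RHS]surjective_pairing.
have p0' : p != 0 by rewrite gt_eqF.
move: E; rewrite /= /nsq /dot /= /GRing.scale /= /GRing.scale /= => E.
by congr (_, _); field; rewrite E p0'.
Qed.

Lemma radial_dir_diffeo p : p != 0 -> dir_diffeo radial dradial p.
Proof.
move=> p0; split; first exact: dirC1_radial.
  by move=> z; eexists; exact: dradialK.
have c0 : 0 < phi (nsq p) := phi_gt0 (nsq_gt0 p0).
have c2 : 0 < phi (nsq p) / 2 by rewrite divr_gt0.
exists (phi (nsq p) / 4); first by rewrite divr_gt0.
have c : {for p, continuous (phi (R := R) \o nsq)}.
  by apply: continuous_comp; [exact: nsq_continuous|exact: phi_continuous].
have /cvgrPdist_lt /(_ _ c2) H := c.
apply: filterS H => x /=; rewrite ltr_norml => /andP[h1 h2] v w.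
rewrite dradialB; apply: le_trans (dradial_lower _ _).
by rewrite ler_wpM2r //; lra.
Qed.

Lemma radial0 : radial 0 = 0. Proof. by rewrite /radial scaler0. Qed.

Lemma radial_out x : 1 <= `|x| -> radial x = x.
Proof.
move=> x1; rewrite /radial phi_ge1 ?scale1r //; apply: le_trans (nsq_ge x).
by rewrite exprn_ege1.
Qed.

Lemma radial_neq0 x : x != 0 -> radial x != 0.
Proof. by move=> x0; rewrite scaler_eq0 negb_or x0 andbT gt_eqF // phi_gt0 // nsq_gt0. Qed.

(** The square of the norm of the image is phi(s)^2 s with s = nsq x, and this is a
    strictly increasing function of s; so x and y have the same norm, and are
    multiplied by the same scalar. *)
Lemma radial_inj : injective radial.
Proof.
move=> x y E.
have [x0|x0] := eqVneq x 0; have [y0|y0] := eqVneq y 0.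
- by rewrite x0 y0.
- by have := radial_neq0 y0; rewrite -E x0 radial0 eqxx.
- by have := radial_neq0 x0; rewrite E y0 radial0 eqxx.
have H (s t : R) : 0 < s -> s < t -> phi s ^+ 2 * s < phi t ^+ 2 * t.
  move=> s0 st; have ps := phi_gt0 s0; have h := phi_le (ltW s0) (ltW st).
  apply: (@lt_le_trans _ _ (phi s ^+ 2 * t)).
    by rewrite ltr_pM2l // exprn_gt0.
  rewrite ler_wpM2r ?(ltW (lt_trans s0 st)) // ler_sqr ?nnegrE ?(ltW ps) //.
  exact: le_trans (ltW ps) h.
have := congr1 nsq E; rewrite !nsqZ => En.
have nxy : nsq x = nsq y.
  case: (ltgtP (nsq x) (nsq y)) => // h.
    by have := H _ _ (nsq_gt0 x0) h; rewrite En ltxx.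
  by have := H _ _ (nsq_gt0 y0) h; rewrite En ltxx.
move: E; rewrite /radial nxy => /scalerI; apply.
by rewrite gt_eqF // phi_gt0 // nsq_gt0.
Qed.

(** The intermediate value theorem on the ray through y. *)
Lemma radial_surj y : exists x, radial x = y.
Proof.
have [->|y0] := eqVneq y 0; first by exists 0; exact: radial0.
have n0 := nsq_gt0 y0.
pose h (a : R) := a * phi (a ^+ 2 * nsq y).
pose b := 1 + (nsq y)^-1.
have b1 : 1 <= b by rewrite /b lerDl invr_ge0 ltW.
have hc : continuous h.
  move=> a; apply: cvgM; first exact: cvg_id.
  apply: (continuous_comp (f := fun a : R => a ^+ 2 * nsq y)); last exact: phi_continuous.
  by apply: cvgM; [exact: exprn_continuous|exact: cvg_cst].
have hb : h b = b.
  rewrite /h phi_ge1 ?mulr1 // -ler_pdivrMr // div1r.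
  apply: (@le_trans _ _ b); first by rewrite /b lerDr.
  by rewrite expr2 ler_peMr // (le_trans _ b1).
have [||a] := @IVT R h 0 b 1 (le_trans ler01 b1).
- exact: continuous_subspaceT.
- by rewrite /h mul0r -/(h b) hb ge_min le_max ler01 b1 orbT.
move=> _ ha; exists (a *: y); rewrite /radial nsqZ scalerA mulrC.
by rewrite -/(h a) ha scale1r.
Qed.

Lemma radial_inverse : exists G, supported radial G.
Proof.
have [G [FG GF]] := inj_surj_inverse radial_inj radial_surj.
by exists G; apply: inverse_supported => //; [exact: radial_continuous|exact: radial_out].
Qed.

Lemma radial_inverse_zero (G : plane R -> plane R) : supported radial G -> G 0 = 0.
Proof. by move=> [FG _ _ _ _]; rewrite -(radial0) FG radial0. Qed.

Lemma radial_inverse_neq0 (G : plane R -> plane R) y : supported radial G ->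
  y != 0 -> G y != 0.
Proof.
by move=> [_ GF _ _ _]; apply: contra_neq => y0; rewrite -(GF y) y0 radial0.
Qed.

Lemma radial_preserving x : x != 0 -> regular_preserving radial x.
Proof.
move=> x0 e t et re; have ce := nbhs_singleton (regular_continuous re).
have H : \forall s \near t, e s != 0.
  have n0 : 0 < `|e t| by rewrite normr_gt0 et.
  have /cvgrPdist_lt /(_ _ n0) h := ce.
  apply: filterS h => s hs; apply/eqP => s0; move: hs.
  by rewrite s0 subr0 ltxx.
apply: (regular_comp (D := dradial) _ re).1; apply: filterS H => s es.
by split; [exact: dirC1_radial|move=> v; exact: dir_diffeo_inj (radial_dir_diffeo es)].
Qed.

Lemma radial_inverse_path G (e : R -> plane R) t : supported radial G ->
  e t != 0 -> regular e t -> regular (G \o e) t /\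
  \forall s \near t, dradial (G (e s)) (derive1 (G \o e) s) = derive1 e s.
Proof.
move=> [FG GF cF cG F1] et re.
have ce := regular_continuous re.
have cGe : \forall s \near t, {for s, continuous (G \o e)}.
  by apply: filterS ce => s h; apply: continuous_comp h _; exact: cG.
have H : \forall s \near t, dir_diffeo radial dradial ((G \o e) s).
  have n0 : 0 < `|e t| by rewrite normr_gt0.
  have /cvgrPdist_lt /(_ _ n0) h := nbhs_singleton ce.
  apply: filterS h => s hs; apply: radial_dir_diffeo; apply/eqP => s0.
  by move: hs; rewrite -(GF (e s)) [G (e s)]s0 radial0 subr0 ltxx.
have E : radial \o (G \o e) = e by apply/funext => s /=; rewrite GF.
have [|r1 r2] := regular_inverse H cGe; first by rewrite E.
split; first exact: r1.
by apply: filterS r2 => s h; exact: (etrans h (congr1 (fun k => derive1 k s) E)).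
Qed.

End RadialMap.

(** * Regular parametrizations at the centre of the radial map *)
Section Desingularization.
Variable R : realType.

Local Notation q := (pi *+ 2 : R).
Local Notation sigma := (@sigma R).
Local Notation dsigma := (@dsigma R).

Lemma regular_near_regular (V : normedModType R) (e : R -> V) t :
  regular e t -> \forall s \near t, regular e s.
Proof.
move=> [/near_join h1 /near_join h2].
by apply: filterS2 h1 h2 => s; split.
Qed.

Lemma regular_is_derive (V : normedModType R) (e : R -> V) t :
  regular e t -> is_derive t (1 : R) e (derive1 e t).
Proof. by move=> [/nbhs_singleton [dd _] _]; rewrite derive1E; exact: derivableP. Qed.

Lemma regular_derive1_continuous (V : normedModType R) (e : R -> V) t :
  regular e t -> {for t, continuous (derive1 e)}.
Proof. by move=> [/nbhs_singleton [_ cd] _]. Qed.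

Lemma cvg_punctured (T : topologicalType) (f : R -> T) t :
  {for t, continuous f} -> f @ t^' --> f t.
Proof. by move=> cf; apply: cvg_trans cf; apply: cvg_app; exact: nbhs_dnbhs. Qed.

Lemma cvg_punctured_injective (k : R -> R) t : {for t, continuous k} ->
  (forall s, s != t -> k s != k t) -> k @ t^' --> (k t)^'.
Proof.
move=> ck ki P H.
change (\forall s \near t, s != t -> P (k s)).
have H' : \forall s \near t, k s != k t -> P (k s) := ck _ H.
by apply: filterS H' => s h /ki /h.
Qed.

Lemma cvg_dot (T : Type) (Fi : set_system T) {FF : Filter Fi}
    (f g : T -> plane R) (a b : plane R) :
  f @ Fi --> a -> g @ Fi --> b -> (fun t => dot (f t) (g t)) @ Fi --> dot a b.
Proof.
move=> fa gb.
have f1 : (fun t => (f t).1) @ Fi --> a.1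
    by apply: (cvg_comp _ fst fa); exact: cvg_fst.
have f2 : (fun t => (f t).2) @ Fi --> a.2 by apply: (cvg_comp _ snd fa); exact: cvg_snd.
have g1 : (fun t => (g t).1) @ Fi --> b.1 by apply: (cvg_comp _ fst gb); exact: cvg_fst.
have g2 : (fun t => (g t).2) @ Fi --> b.2 by apply: (cvg_comp _ snd gb); exact: cvg_snd.
by apply: cvgD; apply: cvgM.
Qed.

Section Path.
Variable e : R -> plane R.
Hypothesis e0 : e 0 = 0.
Hypothesis re : regular e 0.
Local Notation v := (derive1 e 0).

Let v0 : v != 0. Proof. exact: nbhs_singleton re.2. Qed.

Lemma cvg_path_quotient : (fun t => t^-1 *: e t) @ (0 : R)^' --> v.
Proof.
have := derive_quotient (regular_is_derive re).
by under eq_fun do rewrite subr0 e0 subr0.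
Qed.

Lemma cvg_path_velocity : derive1 e @ (0 : R)^' --> v.
Proof. exact: cvg_punctured (regular_derive1_continuous re). Qed.

Lemma cvg_path_nsq : (fun t => nsq (e t)) @ (0 : R)^' --> (0 : R).
Proof.
have ce : {for 0, continuous e} := nbhs_singleton (regular_continuous re).
have := cvg_punctured ce; rewrite e0 => h.
have E : dot (0 : plane R) 0 = 0 by rewrite /dot !mul0r addr0.
by have H := cvg_dot h h; rewrite E in H; exact: H.
Qed.

(** The numerator and the denominator are both of order t^2.  After division by
    t^2, the limit is taken term by term, e t / t and e' t both tending to v:
    the numerator tends to 2 |v|^2 v + 4 |v|^2 v. *)
Lemma cvg_dradial_path :
  (fun t => (dsigma t)^-1 *: dradial (e t) (derive1 e t)) @ (0 : R)^' -->
    (12 / q ^+ 2 * nsq v) *: v.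
Proof.
have q0 := q_gt0 R.
have -> : (12 / q ^+ 2 * nsq v) *: v =
    (q ^+ 2 / 2)^-1 *: ((nsq v * (2 - 0)) *: v + (4 * (1 - 0) * nsq v) *: v).
  rewrite -scalerDl scalerA; congr (_ *: _).
  by move: (pi *+ 2) q0 => Q Q0; field; rewrite gt_eqF.
have H : (fun t => (dsigma t / t ^+ 2)^-1 *:
   ((nsq (t^-1 *: e t) * (2 - nsq (e t))) *: derive1 e t +
    (4 * (1 - nsq (e t)) * dot (t^-1 *: e t) (derive1 e t)) *: (t^-1 *: e t)))
   @ (0 : R)^' -->
   (q ^+ 2 / 2)^-1 *: ((nsq v * (2 - 0)) *: v + (4 * (1 - 0) * nsq v) *: v).
  have cN : (fun t => nsq (t^-1 *: e t)) @ (0 : R)^' --> nsq v.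
    exact: cvg_dot cvg_path_quotient cvg_path_quotient.
  have cD : (fun t => dot (t^-1 *: e t) (derive1 e t)) @ (0 : R)^' --> nsq v.
    exact: cvg_dot cvg_path_quotient cvg_path_velocity.
  apply: cvgZ.
    by apply: cvgV; [rewrite gt_eqF // divr_gt0 // exprn_gt0|exact: cvg_dsigma].
  apply: cvgD; apply: cvgZ.
  - apply: cvgM => //; apply: cvgB; [exact: cvg_cst|exact: cvg_path_nsq].
  - exact: cvg_path_velocity.
  - apply: cvgM => //; apply: cvgM; first exact: cvg_cst.
    by apply: cvgB; [exact: cvg_cst|exact: cvg_path_nsq].
  - exact: cvg_path_quotient.
apply: cvg_trans H; apply: near_eq_cvg.
have /cvgrPdist_lt /(_ 1 ltr01) := cvg_path_nsq; rewrite !near_withinE.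
apply: filterS => t h t0; have {h} := h t0; rewrite sub0r normrN ger0_norm ?nsq_ge0 // => h.
rewrite /dradial (phi_le1 (ltW h)) (dphi_le1 (ltW h)).
have E : nsq (e t) = t ^+ 2 * nsq (t^-1 *: e t).
  by rewrite nsqZ mulrA -exprMn mulfV // expr1n mul1r.
have Ed : dot (e t) (derive1 e t) = t * dot (t^-1 *: e t) (derive1 e t).
  by rewrite dotZl mulrA mulfV // mul1r.
have Ee : e t = t *: (t^-1 *: e t) by rewrite scalerA mulfV // scale1r.
rewrite invf_div -[t ^+ 2 / _]mulrC -(scalerA (dsigma t)^-1 (t ^+ 2)); congr (_ *: _).
have gen (N n d : R) (a y z : plane R) : N = t ^+ 2 * n -> z = t *: y ->
    t ^+ 2 *: ((n * (2 - N)) *: a + (4 * (1 - N) * d) *: y) =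
    (N * (2 - N)) *: a + (2 * (1 - N) * (2 * (t * d))) *: z.
  move=> NE ->; rewrite scalerDr !scalerA.
  by congr (_ *: _ + _ *: _); [rewrite {2}NE; ring|ring].
by rewrite Ed; exact: gen.
Qed.

End Path.

(** With l the inverse of sigma, the velocity of radial \o e \o l at s is the
    quotient of [cvg_dradial_path] at t = l s, which has a nonzero limit. *)
Lemma radial_desingularizes l : cancel sigma l -> cancel l sigma -> continuous l ->
  (forall t, l (t + 1) = l t + 1) -> l 0 = 0 -> desingularizes l (@radial R).
Proof.
move=> sl ls cl l1 l0; split; [exact: l1|exact: l0|by exists sigma|exact: cl|].
split=> [t tn|e e0 re]; first exact: (sigma_inverse_regular ls sl cl tn).1.
have cl' : l @ (0 : R)^' --> (0 : R)^'.
  rewrite -[X in _ --> X^'](l0); apply: cvg_punctured_injective; first exact: cl.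
  by move=> s; apply: contra_neq => /(can_inj ls).
have cphi := cvg_comp _ _ cl' (cvg_dradial_path e0 re).
have q0 := q_gt0 R.
have v0 : derive1 e 0 != 0 := nbhs_singleton re.2.
apply: (regular_punctured _ _ cphi).
- apply: continuous_comp; last exact: radial_continuous.
  apply: continuous_comp; first exact: cl.
  by rewrite l0; exact: nbhs_singleton (regular_continuous re).
- have H1 : \forall s \near l 0, regular e s by rewrite l0; exact: regular_near_regular.
  have H2 : \forall s \near l 0, s != 0 -> e s != 0.
    rewrite l0; have := is_derive_punctured_neq (regular_is_derive re) v0.
    by rewrite e0.
  have H1' : \forall s \near (0 : R), regular e (l s) := cl 0 _ H1.
  have H2' : \forall s \near (0 : R), l s != 0 -> e (l s) != 0 := cl 0 _ H2.
  apply: filterS3 H1' H2' (near_norm_lt (0 : R) ltr01) => s h1 h2; rewrite subr0 => s1 s0.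
  have ns := near_nonint s0 s1.
  have [rl /nbhs_singleton dl] := sigma_inverse_regular ls sl cl ns.
  have ls0 : l s != 0 by rewrite -l0 (inj_eq (can_inj ls)).
  have [rel /nbhs_singleton del] := regular_reparam h1 rl.
  split; first exact: (radial_preserving (h2 ls0) (erefl _) rel).
  have H : \forall u \near s, dirC1 (@radial R) (@dradial R) ((e \o l) u) /\
      forall v, dradial ((e \o l) u) v = 0 -> v = 0.
    have n0 : 0 < `|e (l s)| by rewrite normr_gt0 h2.
    have /cvgrPdist_lt /(_ _ n0) := nbhs_singleton (regular_continuous rel).
    apply: filterS => u hu; split; first exact: dirC1_radial.
    have eu : (e \o l) u != 0.
      by apply/eqP => u0; move: hu; rewrite u0 subr0 ltxx.
    by move=> v; exact: dir_diffeo_inj (radial_dir_diffeo eu).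
  have [_ /nbhs_singleton ->] := regular_comp H rel.
  rewrite del /=; have [_ DZ _ _] := dirC1_radial (e (l s)); rewrite DZ.
  have ds0 : dsigma (l s) != 0.
    by apply/eqP => d0; move/eqP: dl; rewrite d0 mulr0 eq_sym oner_eq0.
  by congr (_ *: _); apply: (mulIf ds0); rewrite dl mulVf.
- rewrite scaler_eq0 negb_or v0 andbT gt_eqF // mulr_gt0 ?nsq_gt0 //.
  by rewrite divr_gt0 // exprn_gt0.
Qed.

End Desingularization.

Section InverseDesingularization.
Variable R : realType.

Local Notation q := (pi *+ 2 : R).
Local Notation sigma := (@sigma R).
Local Notation dsigma := (@dsigma R).

Section Path.
Variable G : plane R -> plane R.
Hypothesis AG : supported (@radial R) G.
Variable e : R -> plane R.
Hypothesis e0 : e 0 = 0.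
Hypothesis re : regular e 0.
Local Notation v := (derive1 e 0).
Local Notation E := (fun s => G (e (sigma s))).
Local Notation L := (q ^+ 2 / 6 : R).

Let v0 : v != 0. Proof. exact: nbhs_singleton re.2. Qed.
Let N0 : 0 < nsq v. Proof. exact: nsq_gt0. Qed.

Lemma cvg_sigma_punctured : sigma @ (0 : R)^' --> (0 : R)^'.
Proof.
have := @cvg_punctured_injective R sigma 0 (@sigma_continuous R 0).
rewrite sigma0; apply => s s0; apply: contra_neq s0.
by rewrite -{1}(sigma0 R) => /sigma_inj.
Qed.

Lemma cvg_inverse_nsq : (fun s => nsq (E s)) @ (0 : R)^' --> (0 : R).
Proof.
have cE : {for 0, continuous E}.
  apply: (continuous_comp (f := e \o sigma)).
    apply: continuous_comp; first exact: sigma_continuous.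
    by rewrite sigma0; exact: nbhs_singleton (regular_continuous re).
  by have [_ _ _ cG _] := AG; exact: cG.
have h := cvg_punctured cE; rewrite /= sigma0 e0 (radial_inverse_zero AG) in h.
have EE : dot (0 : plane R) 0 = 0 by rewrite /dot !mul0r addr0.
by have H := cvg_dot h h; rewrite EE in H; exact: H.
Qed.

(** Multiplying and dividing by sigma s separates the two known limits. *)
Lemma cvg_path_cube : (fun s => (sigma s / s ^+ 3) *: ((sigma s)^-1 *: e (sigma s)))
  @ (0 : R)^' --> L *: v.
Proof.
apply: cvgZ; first exact: cvg_sigma.
exact: (cvg_comp _ _ cvg_sigma_punctured (cvg_path_quotient e0 re)).
Qed.

Lemma cvg_path_speed : (fun s => (dsigma s / s ^+ 2) *: derive1 e (sigma s))
  @ (0 : R)^' --> (q ^+ 2 / 2) *: v.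
Proof.
apply: cvgZ; first exact: cvg_dsigma.
exact: (cvg_comp _ _ cvg_sigma_punctured (cvg_path_velocity re)).
Qed.

Lemma inverse_path_near : \forall s \near (0 : R), s != 0 ->
  [/\ sigma s != 0, e (sigma s) != 0, E s != 0 & nsq (E s) < 1].
Proof.
have /cvgrPdist_lt /(_ 1 ltr01) := cvg_inverse_nsq; rewrite near_withinE => H1.
have H2 : \forall s \near sigma 0, s != 0 -> e s != 0.
  rewrite sigma0; have := is_derive_punctured_neq (regular_is_derive re) v0.
  by rewrite e0.
have H2' : \forall s \near (0 : R), sigma s != 0 -> e (sigma s) != 0 :=
  @sigma_continuous R 0 _ H2.
apply: filterS2 H1 H2' => s h1 h2 s0.
have ss0 : sigma s != 0.
  by apply: contra_neq s0; rewrite -{1}(sigma0 R) => /sigma_inj.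
split=> //; first exact: h2.
  have [_ GF _ _ _] := AG; apply: contraNneq (h2 ss0) => Es.
  by rewrite -(GF (e (sigma s))) Es radial0.
by have := h1 s0; rewrite sub0r normrN ger0_norm ?nsq_ge0.
Qed.

(** The number S = nsq (E s) satisfies S^3 (2 - S)^2 = nsq (e (sigma s)), and the
    right-hand side is equivalent to L^2 |v|^2 s^6; so the cube of S / s^2
    tends to L^2 |v|^2 / 4. *)
Lemma cvg_inverse_ratio (M : R) : 0 < M -> M ^+ 3 = L ^+ 2 * nsq v / 4 ->
  (fun s => nsq (E s) / s ^+ 2) @ (0 : R)^' --> M.
Proof.
move=> M0 M3; apply: cvg_cube => //.
  by move=> s; rewrite divr_ge0 ?nsq_ge0 ?sqr_ge0.
rewrite M3.
have H : (fun s => nsq ((sigma s / s ^+ 3) *: ((sigma s)^-1 *: e (sigma s))) /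
   (2 - nsq (E s)) ^+ 2) @ (0 : R)^' --> nsq (L *: v) / (2 - 0) ^+ 2.
  apply: cvgM; first exact: (cvg_dot cvg_path_cube cvg_path_cube).
  have c2 : (fun s => 2 - nsq (E s)) @ (0 : R)^' --> (2 - 0 : R).
    by apply: cvgB; [exact: cvg_cst|exact: cvg_inverse_nsq].
  apply: cvgV; first by rewrite subr0 expf_neq0.
  by under eq_fun do rewrite expr2; rewrite expr2; exact: cvgM.
rewrite (_ : L ^+ 2 * nsq v / 4 = nsq (L *: v) / (2 - 0) ^+ 2); last first.
  by rewrite nsqZ subr0; congr (_ / _); ring.
apply: cvg_trans H; apply: near_eq_cvg; rewrite near_withinE.
apply: filterS inverse_path_near => s h s0; have {h} [ss0 es0 Es0 E1] := h s0.
have [_ GF _ _ _] := AG.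
have -> : (sigma s / s ^+ 3) *: ((sigma s)^-1 *: e (sigma s)) = (s ^+ 3)^-1 *: e (sigma s).
  by rewrite scalerA mulrAC mulfV // mul1r.
rewrite -{1}(GF (e (sigma s))) /radial !nsqZ (phi_le1 (ltW E1)).
move: (nsq (E s)) E1 => S E1; have S2 : 2 - S != 0 by rewrite gt_eqF //; lra.
by field; rewrite s0 S2.
Qed.

(** E s is e (sigma s), which is equivalent to L s^3 v, divided by S (2 - S), which
    is equivalent to 2 M s^2. *)
Lemma cvg_inverse_position (M : R) : 0 < M -> M ^+ 3 = L ^+ 2 * nsq v / 4 ->
  (fun s => s^-1 *: E s) @ (0 : R)^' --> (L / (2 * M)) *: v.
Proof.
move=> M0 M3; rewrite (_ : (L / (2 * M)) *: v = (M * (2 - 0))^-1 *: (L *: v)); last first.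
  by rewrite scalerA subr0; congr (_ *: _); rewrite [M * 2]mulrC; exact: mulrC.
have H : (fun s => (nsq (E s) / s ^+ 2 * (2 - nsq (E s)))^-1 *:
   ((sigma s / s ^+ 3) *: ((sigma s)^-1 *: e (sigma s)))) @ (0 : R)^'
   --> (M * (2 - 0))^-1 *: (L *: v).
  apply: cvgZ; last exact: cvg_path_cube.
  apply: cvgV; first by rewrite subr0 mulf_neq0 // gt_eqF.
  apply: cvgM; first exact: cvg_inverse_ratio.
  by apply: cvgB; [exact: cvg_cst|exact: cvg_inverse_nsq].
apply: cvg_trans H; apply: near_eq_cvg; rewrite near_withinE.
apply: filterS inverse_path_near => s h s0; have {h} [ss0 es0 Es0 E1] := h s0.
have [_ GF _ _ _] := AG.
have -> : (sigma s / s ^+ 3) *: ((sigma s)^-1 *: e (sigma s)) = (s ^+ 3)^-1 *: e (sigma s).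
  by rewrite scalerA mulrAC mulfV // mul1r.
rewrite -{3}(GF (e (sigma s))) /radial (phi_le1 (ltW E1)) !scalerA; congr (_ *: _).
have S0 : nsq (E s) != 0 by rewrite gt_eqF // nsq_gt0.
move: (nsq (E s)) E1 S0 => S E1 S0; have S2 : 2 - S != 0 by rewrite gt_eqF //; lra.
by field; rewrite s0 S2 S0.
Qed.

(** The velocity of E at s is the inverse of the differential applied to a vector
    equivalent to (q^2 / 2) s^2 v.  That inverse divides by a quantity of order
    s^2, and its rank one correction is homogeneous of degree 0 in E s; so the
    limit is obtained from those of E s / s and of S / s^2. *)
Lemma cvg_inverse_velocity (M : R) : 0 < M -> M ^+ 3 = L ^+ 2 * nsq v / 4 ->
  (fun s => dradial_inverse (E s) (dsigma s *: derive1 e (sigma s))) @ (0 : R)^' -->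
  (q ^+ 2 / (12 * M)) *: v.
Proof.
move=> M0 M3.
have q0 := q_gt0 R; have L0 : 0 < L by rewrite divr_gt0 // exprn_gt0.
pose m s := nsq (E s) / s ^+ 2.
pose S s := nsq (E s).
pose y s := s^-1 *: E s.
pose z s := (dsigma s / s ^+ 2) *: derive1 e (sigma s).
have cm : m @ (0 : R)^' --> M by exact: cvg_inverse_ratio.
have cS : S @ (0 : R)^' --> (0 : R) by exact: cvg_inverse_nsq.
have cy : y @ (0 : R)^' --> (L / (2 * M)) *: v by exact: cvg_inverse_position.
have cz : z @ (0 : R)^' --> (q ^+ 2 / 2) *: v by exact: cvg_path_speed.
set mu := (L / (2 * M)) *: v in cy; set zeta := (q ^+ 2 / 2) *: v in cz.
have H : (fun s => (m s * (2 - S s))^-1 *: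
   (z s - (4 * (1 - S s) * dot (y s) (z s) / (m s * (6 - 5 * S s))) *: y s)) @ (0 : R)^' -->
   (M * (2 - 0))^-1 *: (zeta - (4 * (1 - 0) * dot mu zeta / (M * (6 - 5 * 0))) *: mu).
  have c2 : (fun s => 2 - S s) @ (0 : R)^' --> (2 - 0 : R).
    by apply: cvgB => //; exact: cvg_cst.
  have c1 : (fun s => 1 - S s) @ (0 : R)^' --> (1 - 0 : R).
    by apply: cvgB => //; exact: cvg_cst.
  have c6 : (fun s => 6 - 5 * S s) @ (0 : R)^' --> (6 - 5 * 0 : R).
    by apply: cvgB; [exact: cvg_cst|apply: cvgM => //; exact: cvg_cst].
  apply: cvgZ.
    by apply: cvgV; [rewrite subr0 mulf_neq0 // gt_eqF|exact: cvgM].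
  apply: cvgB => //; apply: cvgZ => //; apply: cvgM.
    by apply: cvgM; [apply: cvgM => //; exact: cvg_cst|exact: cvg_dot].
  apply: cvgV; first by rewrite mulr0 subr0 mulf_neq0 // gt_eqF.
  exact: cvgM.
have -> : (q ^+ 2 / (12 * M)) *: v =
   (M * (2 - 0))^-1 *: (zeta - (4 * (1 - 0) * dot mu zeta / (M * (6 - 5 * 0))) *: mu).
  rewrite /mu /zeta !dotZl dotZr -/(nsq v) !scalerA -scalerBl scalerA; congr (_ *: _).
  have -> : nsq v = M ^+ 3 * 4 / L ^+ 2.
    by rewrite M3 divfK // mulrAC mulfV ?mul1r // expf_neq0 // gt_eqF.
  by move: (pi *+ 2) q0 => Q Q0; field; rewrite !gt_eqF.
apply: cvg_trans H; apply: near_eq_cvg; rewrite near_withinE.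
apply: filterS inverse_path_near => s h s0; have {h} [ss0 es0 Es0 E1] := h s0.
rewrite /dradial_inverse (phi_le1 (ltW E1)) (dphi_le1 (ltW E1)) /m /S /y /z.
have S0 : nsq (E s) != 0 by rewrite gt_eqF // nsq_gt0.
have S2 : 2 - nsq (E s) != 0 by rewrite gt_eqF //; lra.
have S6 : 6 - 5 * nsq (E s) != 0 by rewrite gt_eqF //; lra.
rewrite !dotZl !dotZr.
move: (nsq (E s)) (dot (E s) _) S0 S2 S6 => T d T0 T2 T6.
rewrite !scalerBr !scalerA; congr (_ *: _ - _ *: _); field; rewrite ?s0 ?T0 ?T2 ?T6 //.
rewrite (_ : T * (2 - T) + 2 * (1 - T) * 2 * T = T * (6 - 5 * T)); last by ring.
by rewrite mulf_neq0.
Qed.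

End Path.

Lemma radial_inverse_desingularizes G : supported (@radial R) G -> desingularizes sigma G.
Proof.
move=> AG; have [l [sl ls cl l1 l0]] := sigma_inverse R.
split.
- exact: sigma1.
- exact: sigma0.
- by exists l.
- exact: sigma_continuous.
split=> [t tn|e e0 re]; first exact: sigma_regular.
have v0 : derive1 e 0 != 0 := nbhs_singleton re.2.
have q0 := q_gt0 R.
have [M M0 M3] : exists2 M : R, 0 < M & M ^+ 3 = (q ^+ 2 / 6) ^+ 2 * nsq (derive1 e 0) / 4.
  apply: cube_root_exists; rewrite divr_gt0 // mulr_gt0 ?nsq_gt0 // exprn_gt0 //.
  by rewrite divr_gt0 // exprn_gt0.
apply: (regular_punctured _ _ (cvg_inverse_velocity AG e0 re M0 M3)).
- apply: continuous_comp; last by have [_ _ _ cG _] := AG; exact: cG.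
  apply: continuous_comp; first exact: sigma_continuous.
  by rewrite sigma0; exact: nbhs_singleton (regular_continuous re).
- have H1 : \forall s \near sigma 0, regular e s.
    by rewrite sigma0; exact: regular_near_regular.
  have H1' : \forall s \near (0 : R), regular e (sigma s) := @sigma_continuous R 0 _ H1.
  apply: filterS3 H1' (inverse_path_near AG e0 re) (near_norm_lt (0 : R) ltr01) => s h1 h2.
  rewrite subr0 => s1 s0; have [ss0 es0 Es0 E1] := h2 s0.
  have ns := near_nonint s0 s1.
  have [rel /nbhs_singleton del] := regular_reparam h1 (sigma_regular ns).
  have [r1 /nbhs_singleton r2] := radial_inverse_path AG (es0 : (e \o sigma) s != 0) rel.
  split; first exact: r1.
  have ds : derive1 sigma s = dsigma s.
    by rewrite derive1E (@derive_val _ _ _ _ _ _ _ (is_derive_sigma s)).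
  apply/eqP; rewrite -subr_eq0; apply/eqP.
  apply: (dir_diffeo_inj (radial_dir_diffeo Es0)).
  by rewrite -dradialB r2 del ds dradialK // subrr.
- rewrite scaler_eq0 negb_or v0 andbT gt_eqF // divr_gt0 ?exprn_gt0 //.
  by rewrite mulr_gt0.
Qed.

End InverseDesingularization.

(** * A homogeneous function that is not linear *)
Section Homogeneous.
Variable R : realType.
Implicit Types x v w : plane R.

(** Its restriction to each line through 0 is linear and it is smooth elsewhere,
    so it is directionally C^1; but it vanishes on both axes and not on the
    diagonal. *)
Definition hom x : R := x.1 * x.2 ^+ 2 / nsq x.

(** The partial derivatives of [hom]. *)
Definition hom1 x : R := x.2 ^+ 2 * (x.2 ^+ 2 - x.1 ^+ 2) / nsq x ^+ 2.
Definition hom2 x : R := 2 * x.1 ^+ 3 * x.2 / nsq x ^+ 2.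

Definition dhom x v : R := if x == 0 then hom v else hom1 x * v.1 + hom2 x * v.2.

Lemma nsqE x : nsq x = x.1 ^+ 2 + x.2 ^+ 2.
Proof. by rewrite /nsq /dot -!expr2. Qed.

Lemma hom0 : hom 0 = 0.
Proof. by rewrite /hom /= !mul0r. Qed.

Lemma homZ a x : hom (a *: x) = a * hom x.
Proof.
have [->|a0] := eqVneq a 0; first by rewrite scale0r hom0 mul0r.
have [->|x0] := eqVneq x 0; first by rewrite scaler0 hom0 mulr0.
rewrite /hom nsqZ /= /GRing.scale /=; have n0 := nsq_gt0 x0.
by move: (nsq x) n0 => n n0; field; rewrite a0 gt_eqF.
Qed.

Lemma hom_euler v : v != 0 -> hom1 v * v.1 + hom2 v * v.2 = hom v.
Proof.
move=> v0; have n0 : nsq v != 0 by rewrite gt_eqF // nsq_gt0.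
move: n0; rewrite /hom1 /hom2 /hom nsqE => n0.
by field.
Qed.

Lemma hom1Z a x : a != 0 -> hom1 (a *: x) = hom1 x.
Proof.
move=> a0; have [->|x0] := eqVneq x 0; first by rewrite scaler0.
rewrite /hom1 nsqZ /= /GRing.scale /=; have n0 := nsq_gt0 x0.
by move: (nsq x) n0 => n n0; field; rewrite a0 gt_eqF.
Qed.

Lemma hom2Z a x : a != 0 -> hom2 (a *: x) = hom2 x.
Proof.
move=> a0; have [->|x0] := eqVneq x 0; first by rewrite scaler0.
rewrite /hom2 nsqZ /= /GRing.scale /=; have n0 := nsq_gt0 x0.
by move: (nsq x) n0 => n n0; field; rewrite a0 gt_eqF.
Qed.

Lemma hom1_le x : `|hom1 x| <= 1.
Proof.
have [->|x0] := eqVneq x 0; first by rewrite /hom1 /= expr0n /= !mul0r normr0.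
have n0 := nsq_gt0 x0; have n2 : 0 < nsq x ^+ 2 by rewrite exprn_gt0.
rewrite /hom1 normrM normfV (gtr0_norm n2) ler_pdivrMr // mul1r nsqE.
have h1 : 0 <= x.1 ^+ 2 by exact: sqr_ge0.
have h2 : 0 <= x.2 ^+ 2 by exact: sqr_ge0.
move: (x.1 ^+ 2) (x.2 ^+ 2) h1 h2 => a b a0 b0.
have ab := mulr_ge0 a0 b0; have aa := mulr_ge0 a0 a0; have bb := mulr_ge0 b0 b0.
by rewrite ler_norml expr2; apply/andP; split; lra.
Qed.

Lemma hom2_le x : `|hom2 x| <= 2.
Proof.
have [->|x0] := eqVneq x 0; first by rewrite /hom2 /= mulr0 mul0r normr0.
have n0 := nsq_gt0 x0; have n2 : 0 < nsq x ^+ 2 by rewrite exprn_gt0.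
rewrite /hom2 normrM normfV (gtr0_norm n2) ler_pdivrMr // nsqE.
have h := sqr_ge0 (x.1 - x.2); have h' := sqr_ge0 (x.1 + x.2).
have a2 := sqr_ge0 x.1; have b2 := sqr_ge0 x.2.
have k1 := mulr_ge0 a2 h; have k2 := mulr_ge0 a2 h'.
have k3 := mulr_ge0 a2 a2; have k4 := mulr_ge0 b2 b2; have k5 := mulr_ge0 a2 b2.
by rewrite ler_norml; apply/andP; split; lra.
Qed.

(** The difference is X - X' times a quotient whose numerator is at most its
    denominator in absolute value; this last inequality is a combination of
    squares, which are listed for [lra]. *)
Lemma hom_lip1 (X X' Y : R) : `|hom (X, Y) - hom (X', Y)| <= `|X - X'|.
Proof.
have [->|Y0] := eqVneq Y 0.
  by rewrite /hom /= expr0n /= !mulr0 !mul0r subrr normr0.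
have Y2 : 0 < Y ^+ 2 by rewrite exprn_even_gt0.
have A0 : 0 < X ^+ 2 + Y ^+ 2 by rewrite ltr_wpDl // sqr_ge0.
have B0 : 0 < X' ^+ 2 + Y ^+ 2 by rewrite ltr_wpDl // sqr_ge0.
rewrite /hom !nsqE /=.
have -> : X * Y ^+ 2 / (X ^+ 2 + Y ^+ 2) - X' * Y ^+ 2 / (X' ^+ 2 + Y ^+ 2) =
  (X - X') * (Y ^+ 2 * (Y ^+ 2 - X * X') / ((X ^+ 2 + Y ^+ 2) * (X' ^+ 2 + Y ^+ 2))).
  by field; rewrite !gt_eqF.
rewrite normrM ler_piMr // normrM normfV [X in _ / X]gtr0_norm ?mulr_gt0 //.
rewrite ler_pdivrMr ?mulr_gt0 // mul1r.
have a2 := sqr_ge0 X; have b2 := sqr_ge0 X'.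
have h := sqr_ge0 (X - X'); have h' := sqr_ge0 (X + X').
have k1 := mulr_ge0 (ltW Y2) h; have k2 := mulr_ge0 (ltW Y2) h'.
have k3 := mulr_ge0 a2 b2; have k4 := mulr_ge0 (ltW Y2) a2; have k5 := mulr_ge0 (ltW Y2) b2.
have k6 := mulr_ge0 (ltW Y2) (ltW Y2).
by rewrite ler_norml; apply/andP; split; lra.
Qed.

Lemma hom_lip2 (X Y Y' : R) : `|hom (X, Y) - hom (X, Y')| <= `|Y - Y'|.
Proof.
have [->|X0] := eqVneq X 0.
  by rewrite /hom /= !mul0r subrr normr0.
have X2 : 0 < X ^+ 2 by rewrite exprn_even_gt0.
have A0 : 0 < X ^+ 2 + Y ^+ 2 by rewrite ltr_pwDl // sqr_ge0.
have B0 : 0 < X ^+ 2 + Y' ^+ 2 by rewrite ltr_pwDl // sqr_ge0.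
rewrite /hom !nsqE /=.
have -> : X * Y ^+ 2 / (X ^+ 2 + Y ^+ 2) - X * Y' ^+ 2 / (X ^+ 2 + Y' ^+ 2) =
  (Y - Y') * (X ^+ 3 * (Y + Y') / ((X ^+ 2 + Y ^+ 2) * (X ^+ 2 + Y' ^+ 2))).
  by field; rewrite !gt_eqF.
rewrite normrM ler_piMr // normrM normfV [X in _ / X]gtr0_norm ?mulr_gt0 //.
rewrite ler_pdivrMr ?mulr_gt0 // mul1r.
have a2 := sqr_ge0 Y; have b2 := sqr_ge0 Y'.
have k1 := mulr_ge0 (ltW X2) (sqr_ge0 (X - Y)); have k2 := mulr_ge0 (ltW X2) (sqr_ge0 (X + Y)).
have k1' := mulr_ge0 (ltW X2) (sqr_ge0 (X - Y')); have k2' := mulr_ge0 (ltW X2) (sqr_ge0 (X + Y')).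
have k3 := mulr_ge0 a2 b2; have k4 := mulr_ge0 (ltW X2) a2; have k5 := mulr_ge0 (ltW X2) b2.
have k6 := mulr_ge0 (ltW X2) (ltW X2).
by rewrite ler_norml; apply/andP; split; lra.
Qed.

Lemma hom_lip x v : `|hom x - hom v| <= 2 * `|x - v|.
Proof.
have h1 := hom_lip1 x.1 v.1 x.2; have h2 := hom_lip2 v.1 x.2 v.2.
have n1 := normr_fst_le (x - v); have n2 := normr_snd_le (x - v).
rewrite -!surjective_pairing in h1 h2.
have := ler_normD (hom x - hom (v.1, x.2)) (hom (v.1, x.2) - hom v).
rewrite addrA subrK => h3; move: n1 n2 => /= n1 n2; lra.
Qed.

Lemma dhom_lip x v w : `|dhom x v - dhom x w| <= 4 * `|v - w|.
Proof.
rewrite /dhom; case: eqP => _.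
  by apply: (le_trans (hom_lip v w)); rewrite ler_wpM2r // ler_nat.
have -> : hom1 x * v.1 + hom2 x * v.2 - (hom1 x * w.1 + hom2 x * w.2) =
  hom1 x * (v - w).1 + hom2 x * (v - w).2 by rewrite /=; ring.
have n1 := normr_fst_le (v - w); have n2 := normr_snd_le (v - w).
have h1 := hom1_le x; have h2 := hom2_le x.
apply: (le_trans (ler_normD _ _)); rewrite (normrM (hom1 x)) (normrM (hom2 x)).
have k1 : `|hom1 x| * `|(v - w).1| <= 1 * `|v - w| by apply: ler_pM.
have k2 : `|hom2 x| * `|(v - w).2| <= 2 * `|v - w| by apply: ler_pM.
apply: (le_trans (lerD k1 k2)); rewrite -mulrDl ler_wpM2r //; lra.
Qed.

Lemma dhomZ x a v : dhom x (a *: v) = a * dhom x v.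
Proof.
rewrite /dhom; case: eqP => _; first exact: homZ.
by rewrite /= /GRing.scale /=; ring.
Qed.

Lemma dhom0 v : dhom 0 v = hom v. Proof. by rewrite /dhom eqxx. Qed.

Lemma dhom_euler v : dhom v v = hom v.
Proof. by rewrite /dhom; case: eqVneq => // v0; rewrite hom_euler. Qed.

Lemma dhom_scale a x v : a != 0 -> dhom (a *: x) v = dhom x v.
Proof.
move=> a0; rewrite /dhom scaler_eq0 (negbTE a0) /=.
by case: eqP => // _; rewrite hom1Z // hom2Z.
Qed.

Lemma dirC1_inv (u : R) : u != 0 -> dirC1 (fun s : R => s^-1) (fun s a : R => a * (- s ^- 2)) u.
Proof.
move=> u0; apply: is_derive_dirC1.
  have d0 : derivable (@id R) u 1 by exact: derivable_id.
  split; first exact: (@derivableV _ _ (@id R) u 1 u0 d0).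
  by rewrite (@deriveV _ _ (@id R) u 1 u0 d0) derive_id /GRing.scale /= mulr1.
apply: cvgN; apply: cvgV; first by rewrite expf_neq0.
exact: exprn_continuous.
Qed.

Lemma dirC1_hom_neq0 p : p != 0 ->
  dirC1 hom (fun x v => hom1 x * v.1 + hom2 x * v.2) p.
Proof.
move=> p0; have n0 : nsq p != 0 by rewrite gt_eqF // nsq_gt0.
have h1 := dirC1_fst (U := R) (V := R) p; have h2 := dirC1_snd (U := R) (V := R) p.
have hi := dirC1_comp (dirC1_nsq p) (dirC1_inv n0).
have H := dirC1_mul (dirC1_mul h1 (dirC1_mul h2 h2)) hi.
apply: dirC1_near H.
  by apply: near_everywhere => x; rewrite /hom /= expr2.
have np : 0 < `|p| by rewrite normr_gt0.
apply: filterS (near_norm_lt p np) => x xp v.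
have x0 : x != 0 by apply: contraTneq xp => ->; rewrite sub0r normrN ltxx.
have nx : nsq x != 0 by rewrite gt_eqF // nsq_gt0.
move: nx; rewrite /hom1 /hom2 /= nsqE /dot /= => nx.
by field.
Qed.

Lemma dhom_continuous v : v != 0 -> {for v, continuous (fun u => dhom u v)}.
Proof.
move=> v0; have np : 0 < `|v| by rewrite normr_gt0.
have n0 : nsq v != 0 by rewrite gt_eqF // nsq_gt0.
have H : {for v, continuous (fun u => hom1 u * v.1 + hom2 u * v.2)}.
  have h1 := dirC1_fst (U := R) (V := R) v; have h2 := dirC1_snd (U := R) (V := R) v.
  have hi := dirC1_comp (dirC1_nsq v) (dirC1_inv n0).
  have d1 := dirC1_mul (dirC1_mul h2 h2) (dirC1_add (dirC1_mul h2 h2)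
     (dirC1_mul (dirC1_cst (-1 : R) v) (dirC1_mul h1 h1))).
  have d2 := dirC1_mul (dirC1_mul (dirC1_cst (2 : R) v) (dirC1_mul h1 (dirC1_mul h1 h1))) h2.
  have hii := dirC1_mul hi hi.
  have := dirC1_continuous (dirC1_add (dirC1_mul (dirC1_mul d1 hii) (dirC1_cst v.1 v))
     (dirC1_mul (dirC1_mul d2 hii) (dirC1_cst v.2 v))).
  apply: continuous_near; apply: near_everywhere => x /=.
  by rewrite /hom1 /hom2 expr2 invfM; ring.
apply: continuous_near H; apply: filterS (near_norm_lt v np) => x xp.
have x0 : x != 0 by apply: contraTneq xp => ->; rewrite sub0r normrN ltxx.
by rewrite /dhom (negbTE x0).
Qed.

(** At 0, if x / a is close to v then dhom x v = dhom (x / a) v is close to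
    dhom v v, because the partial derivatives are homogeneous of degree 0 and
    continuous at v; and dhom v v = hom v by the identity of Euler. *)
Lemma dirC1_hom p : dirC1 hom dhom p.
Proof.
have [->|p0] := eqVneq p 0; last first.
  apply: dirC1_near (dirC1_hom_neq0 p0); first exact: near_everywhere.
  have np : 0 < `|p| by rewrite normr_gt0.
  apply: filterS (near_norm_lt p np) => x xp v.
  have x0 : x != 0 by apply: contraTneq xp => ->; rewrite sub0r normrN ltxx.
  by rewrite /dhom (negbTE x0).
split.
- move=> e e0; apply: near_everywhere => x.
  by rewrite dhom0 hom0 !subr0 subrr normr0 mulr_ge0 // ltW.
- by move=> a v; rewrite dhomZ.
- by exists 4 => //; apply: near_everywhere => x v w; exact: dhom_lip.
- move=> v e e0; have [->|v0] := eqVneq v 0.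
    exists 1 => // x a _ _; have H y : dhom y 0 = 0.
      by rewrite -[X in dhom _ X](scale0r (0 : plane R)) dhomZ mul0r.
    by rewrite !H subrr normr0 ltW.
  have /cvgrPdist_le /(_ e e0) /near_normP[d d0 Hd] := dhom_continuous v0.
  exists (d / 2); first by rewrite divr_gt0.
  move=> x a _; rewrite subr0 => h; have [a0|a0] := eqVneq a 0.
    move: h; rewrite a0 normr0 mulr0 scale0r subr0 normr_le0 => /eqP ->.
    by rewrite subrr normr0 ltW.
  rewrite dhom0 -dhom_euler distrC -(dhom_scale x v (invr_neq0 a0)).
  apply: Hd; have -> : a^-1 *: x - v = a^-1 *: (x - a *: v).
    by rewrite [RHS]scalerBr scalerA mulVf // scale1r.
  rewrite normrZ normfV ltr_pdivrMl ?normr_gt0 // (le_lt_trans h) // mulrC ltr_pM2l ?normr_gt0 //.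
  lra.
Qed.

End Homogeneous.

(** * An oscillating function with simple zeros *)
Section Oscillating.
Variable R : realType.
Implicit Types s t : R.

(** With the convention 0^-1 = 0, both formulas also hold at s = 0, where they give
    the value and the derivative 0. *)
Definition osc s : R := s ^+ 3 * sin s^-1.
Definition dosc s : R := 3 * s ^+ 2 * sin s^-1 - s * cos s^-1.

Lemma osc_le s : `|osc s| <= `|s| ^+ 3.
Proof. by rewrite /osc (normrM (s ^+ 3)) normrX ler_piMr ?exprn_ge0 // sin_max. Qed.

Lemma dosc_le s : `|dosc s| <= 3 * `|s| ^+ 2 + `|s|.
Proof.
rewrite /dosc (le_trans (ler_normB _ _)) //.
rewrite (normrM (3 * s ^+ 2)) (normrM 3) (normrM s (cos _)) normrX lerD //.
  by rewrite gtr0_norm // ler_piMr ?sin_max // mulr_ge0 // exprn_ge0.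
by rewrite ler_piMr // cos_max.
Qed.

Lemma is_derive_osc s : is_derive s (1 : R) osc (dosc s).
Proof.
have [->|s0] := eqVneq s 0.
  apply/is_derive_pathP => d d0.
  have d1 : 0 < Num.min 1 d by rewrite lt_min ltr01 d0.
  apply: filterS (near_norm_lt (0 : R) d1) => t; rewrite subr0 lt_min => /andP[t1 td].
  have -> : osc 0 = 0 by rewrite /osc expr0n /= mul0r.
  have -> : dosc 0 = 0 by rewrite /dosc expr0n /= mulr0 !mul0r subr0.
  rewrite scaler0 !subr0 (le_trans (osc_le t)) // exprSr ler_wpM2r //.
  by rewrite expr2 (le_trans _ (ltW td)) // ler_piMr // ltW.
have di : derivable (@id R) s 1 by exact: derivable_id.
have d1 : is_derive s (1 : R) (fun u : R => u^-1) (- s ^- 2).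
  split; first exact: (@derivableV _ _ (@id R) s 1 s0 di).
  by rewrite (@deriveV _ _ (@id R) s 1 s0 di) derive_id /GRing.scale /= mulr1.
have d2 : is_derive s (1 : R) (fun u : R => sin u^-1) (- s ^- 2 * cos s^-1).
  have := is_derive1_comp (is_derive_sin s^-1) d1.
  by rewrite mulrC.
rewrite /osc; apply: is_derive_eq.
rewrite /dosc /GRing.scale /=.
move: (sin _) (cos _) => a b; field.
by rewrite s0.
Qed.

Lemma dosc_continuous : continuous dosc.
Proof.
move=> s; have [->|s0] := eqVneq s 0.
  apply/cvgrPdist_le => d d0.
  have d1 : 0 < Num.min 1 (d / 4) by rewrite lt_min ltr01 divr_gt0.
  apply: filterS (near_norm_lt (0 : R) d1) => t; rewrite subr0 lt_min => /andP[t1 td].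
  have -> : dosc 0 = 0 by rewrite /dosc expr0n /= mulr0 !mul0r subr0.
  rewrite sub0r normrN (le_trans (dosc_le t)) //.
  have : `|t| ^+ 2 <= `|t| by rewrite expr2 ler_piMr // ltW.
  lra.
have ci : {for s, continuous (fun u : R => u^-1)}.
  exact: cvgV.
apply: cvgB; apply: cvgM.
- by apply: cvgM; [exact: cvg_cst|exact: exprn_continuous].
- by apply: (continuous_comp ci); exact: continuous_sin.
- exact: cvg_id.
- by apply: (continuous_comp ci); exact: continuous_cos.
Qed.

Definition bump s : R := pos (1 - s ^+ 2) ^+ 2.
Definition dbump s : R := - (4 * s * pos (1 - s ^+ 2)).

Lemma is_derive_bump s : is_derive s (1 : R) bump (dbump s).
Proof.
have d1 : is_derive s (1 : R) (fun u : R => 1 - u ^+ 2) (- (2 * s)).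
  by apply: is_derive_eq; rewrite /GRing.scale /=; ring.
have := @is_derive1_comp R (fun u => pos u ^+ 2) (fun u => 1 - u ^+ 2) s _ _ (is_derive_pos2 _) d1.
by rewrite (_ : 2 * pos (1 - s ^+ 2) * - (2 * s) = dbump s) // /dbump; ring.
Qed.

Lemma dbump_continuous : continuous dbump.
Proof.
move=> s; apply: cvgN; apply: cvgM.
  by apply: cvgM; [exact: cvg_cst|exact: cvg_id].
apply: (continuous_comp (f := fun u : R => 1 - u ^+ 2)); last exact: pos_continuous.
by apply: cvgB; [exact: cvg_cst|exact: exprn_continuous].
Qed.

Definition gosc s : R := bump s * osc s.
Definition dgosc s : R := dbump s * osc s + bump s * dosc s.

Lemma is_derive_gosc s : is_derive s (1 : R) gosc (dgosc s).
Proof.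
have d1 := is_derive_bump s; have d2 := is_derive_osc s.
rewrite /gosc; apply: is_derive_eq; rewrite /dgosc /GRing.scale /=; ring.
Qed.

Lemma gosc_continuous : continuous gosc.
Proof. by move=> s; apply: derivable_path_continuous; have := is_derive_gosc s. Qed.

Lemma dgosc_continuous : continuous dgosc.
Proof.
move=> s; apply: cvgD; apply: cvgM.
- exact: dbump_continuous.
- by apply: derivable_path_continuous; have := is_derive_osc s.
- by apply: derivable_path_continuous; have := is_derive_bump s.
- exact: dosc_continuous.
Qed.

Lemma pos_out s : 1 <= `|s| -> pos (1 - s ^+ 2) = 0.
Proof.
by move=> s1; apply: pos_0; rewrite subr_le0 -(real_normK (num_real s)) exprn_ege1.
Qed.

Lemma gosc_out s : 1 <= `|s| -> gosc s = 0.
Proof. by move=> s1; rewrite /gosc /bump pos_out // expr0n mul0r. Qed.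

Lemma dgosc_le s : `|dgosc s| <= 8.
Proof.
have [s1|s1] := leP 1 `|s|.
  by rewrite /dgosc /dbump /bump pos_out // expr0n /= mulr0 oppr0 !mul0r addr0 normr0.
have s2 : `|s| ^+ 2 <= 1 by rewrite exprn_ile1 // ltW.
have s3 : `|s| ^+ 3 <= 1 by rewrite exprn_ile1 // ltW.
have p0 := pos_ge0 (1 - s ^+ 2).
have p1 : pos (1 - s ^+ 2) <= 1 by rewrite /pos ge_max ler01 andbT lerBlDr lerDl sqr_ge0.
rewrite /dgosc (le_trans (ler_normD _ _)) // (normrM (dbump s)) (normrM (bump s)).
have h1 : `|dbump s| * `|osc s| <= 4 * 1.
  apply: ler_pM => //; last exact: le_trans (osc_le s) s3.
  rewrite normrN !normrM (ger0_norm p0) [`|4|]ger0_norm // -mulrA ler_piMr //.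
  by apply: mulr_ile1 => //; exact: ltW.
have h2 : `|bump s| * `|dosc s| <= 1 * 4.
  apply: ler_pM => //.
    by rewrite /bump normrX ger0_norm // exprn_ile1.
  by apply: le_trans (dosc_le s) _; lra.
apply: (le_trans (lerD h1 h2)); lra.
Qed.

Lemma gosc_lip s t : `|gosc s - gosc t| <= 8 * `|s - t|.
Proof.
have [->|st] := eqVneq s t; first by rewrite !subrr normr0 mulr0.
have [||u _ ->] := @mvt_ball R gosc dgosc t s st.
- by move=> x _ _; exact: is_derive_gosc.
- exact: gosc_continuous.
by rewrite normrM ler_wpM2r // dgosc_le.
Qed.

Lemma sin_natpi (n : nat) : sin (n%:R * pi) = 0 :> R.
Proof.
elim: n => [|n IH]; first by rewrite mul0r sin0.
by rewrite -natr1 mulrDl mul1r sinDpi IH oppr0.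
Qed.

Definition zero_osc (n : nat) : R := (n.+1%:R * pi)^-1.

Lemma zero_osc_gt0 n : 0 < zero_osc n.
Proof. by rewrite invr_gt0 mulr_gt0 ?pi_gt0. Qed.

Lemma zero_osc_lt1 n : zero_osc n < 1.
Proof.
rewrite invf_lt1 ?mulr_gt0 ?pi_gt0 //; have p2 := pi_ge2 R.
apply: (@lt_le_trans _ _ pi); first lra.
by rewrite ler_peMl ?pi_ge0 // ler1n.
Qed.

Lemma zero_osc_inj : injective zero_osc.
Proof.
move=> m n /invr_inj /mulIf; rewrite gt_eqF ?pi_gt0 // => /(_ isT) /eqP.
by rewrite eqr_nat => /eqP [].
Qed.

Lemma gosc_zero n : gosc (zero_osc n) = 0.
Proof. by rewrite /gosc /osc invrK sin_natpi !mulr0. Qed.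

Lemma dgosc_zero n : dgosc (zero_osc n) != 0.
Proof.
rewrite /dgosc /osc /dosc invrK sin_natpi !mulr0 add0r sub0r.
rewrite mulf_neq0 //.
  rewrite /bump expf_neq0 // pos_id; last first.
    by rewrite subr_ge0 exprn_ile1 // ltW ?zero_osc_gt0 ?zero_osc_lt1.
  rewrite gt_eqF // subr_gt0 exprn_ilt1 // ?zero_osc_lt1 //.
  by rewrite ltW // zero_osc_gt0.
have z0 : zero_osc n != 0 by rewrite gt_eqF // zero_osc_gt0.
rewrite oppr_eq0 mulf_neq0 //.
have := sin0cos1 (sin_natpi n.+1) => /eqP c; apply/eqP => c0.
by move: c; rewrite c0 normr0 eq_sym oner_eq0.
Qed.

End Oscillating.

(** * The shear *)
Section Shear.
Variable R : realType.
Implicit Types x v w : plane R.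

(** The derivative of [gosc] is at most 8 and [dhom] has Lipschitz constant 4: the
    factor 1/64 makes the perturbation of the identity a contraction of ratio
    1/2, both for the map and for its directional derivatives. *)
Definition shear_shift x : R := 64^-1 * hom (gosc x.1, gosc x.2).
Definition dshear_shift x v : R :=
  64^-1 * dhom (gosc x.1, gosc x.2) (v.1 * dgosc x.1, v.2 * dgosc x.2).

Definition shear x : plane R := (x.1 + shear_shift x, x.2).
Definition dshear x v : plane R := (v.1 + dshear_shift x v, v.2).

Lemma shear_shift_lip x v : `|shear_shift x - shear_shift v| <= 2^-1 * `|x - v|.
Proof.
rewrite /shear_shift -mulrBr normrM gtr0_norm ?invr_gt0 //.
have h := hom_lip (gosc x.1, gosc x.2) (gosc v.1, gosc v.2).
have g1 : `|(gosc x.1, gosc x.2) - (gosc v.1, gosc v.2)| <= 8 * `|x - v|.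
  apply: normr_pair_le => /=; apply: (le_trans (gosc_lip _ _)).
    by rewrite ler_pM2l // (normr_fst_le (x - v)).
  by rewrite ler_pM2l // (normr_snd_le (x - v)).
rewrite ler_pdivrMl //; apply: (le_trans h).
apply: (@le_trans _ _ (2 * (8 * `|x - v|))); first by rewrite ler_pM2l.
have := normr_ge0 (x - v); lra.
Qed.

Lemma dshear_shift_lip x v w : `|dshear_shift x v - dshear_shift x w| <= 2^-1 * `|v - w|.
Proof.
rewrite /dshear_shift -mulrBr normrM gtr0_norm ?invr_gt0 //.
have h := dhom_lip (gosc x.1, gosc x.2) (v.1 * dgosc x.1, v.2 * dgosc x.2)
  (w.1 * dgosc x.1, w.2 * dgosc x.2).
have g1 : `|(v.1 * dgosc x.1, v.2 * dgosc x.2) - (w.1 * dgosc x.1, w.2 * dgosc x.2)|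
    <= 8 * `|v - w|.
  apply: normr_pair_le => /=; rewrite -mulrBl normrM mulrC; apply: ler_pM => //.
  - exact: dgosc_le.
  - exact: (normr_fst_le (v - w)).
  - exact: dgosc_le.
  - exact: (normr_snd_le (v - w)).
rewrite ler_pdivrMl //; apply: (le_trans h).
apply: (@le_trans _ _ (4 * (8 * `|v - w|))); first by rewrite ler_pM2l.
have := normr_ge0 (v - w); lra.
Qed.

Lemma dirC1_gosc s : dirC1 (@gosc R) (fun s a => a * dgosc s) s.
Proof.
by apply: is_derive_dirC1; [exact: is_derive_gosc|exact: dgosc_continuous].
Qed.

Lemma dirC1_shear p : dirC1 shear dshear p.
Proof.
have h1 := dirC1_fst (U := R) (V := R) p; have h2 := dirC1_snd (U := R) (V := R) p.
have k1 := dirC1_comp h1 (dirC1_gosc _); have k2 := dirC1_comp h2 (dirC1_gosc _).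
have H := dirC1_comp (dirC1_pair k1 k2) (dirC1_hom _).
have H' := dirC1_mul (dirC1_cst (64^-1 : R) p) H.
apply: dirC1_eq (dirC1_pair (dirC1_add h1 H') h2).
  by apply/funext => x.
by move=> x v; rewrite /dshear /dshear_shift /= mulr0 addr0.
Qed.

Lemma perturbed_id_surj (k : R -> R) : (forall s t, `|k s - k t| <= 2^-1 * `|s - t|) ->
  forall y, exists s, s + k s = y.
Proof.
move=> kl y; pose M := 2 * (`|y| + `|k 0|) + 1.
have M0 : 0 < M by rewrite /M ltr_wpDl // mulr_ge0 // addr_ge0.
have kc : continuous k.
  move=> t; apply/cvgrPdist_le => d d0; apply: filterS (near_norm_lt t d0) => s /ltW sd.
  apply: (le_trans (kl _ _)); rewrite distrC; have := normr_ge0 (s - t); lra.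
have NM : - M <= M by lra.
have [||s _ sy] := @IVT R (fun s => s + k s) (- M) M y NM.
- by apply: continuous_subspaceT => s; apply: cvgD; [exact: cvg_id|exact: kc].
- have := kl M 0; have := kl (- M) 0; rewrite !subr0 normrN (gtr0_norm M0) !ler_norml.
  move=> /andP[a1 a2] /andP[b1 b2].
  have := ler_norm y; have := ler_norm (- y); have := ler_norm (k 0); have := ler_norm (- k 0).
  rewrite !normrN => c1 c2 c3 c4; rewrite ge_min le_max; move: NM M0; rewrite /M => NM M0.
  by apply/andP; split; apply/orP; [left|right]; rewrite /M in a1 a2 b1 b2 *; lra.
by exists s.
Qed.

(** A perturbation of the identity in the first coordinate by a contraction is
    onto and bounded below. *)
Lemma shear_dir_diffeo p : dir_diffeo shear dshear p.
Proof.
split; first exact: dirC1_shear.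
  move=> z; have [|s sE] := @perturbed_id_surj (fun s => dshear_shift p (s, z.2)) _ z.1.
    move=> s t; apply: (le_trans (dshear_shift_lip p (s, z.2) (t, z.2))).
    by rewrite ler_pM2l ?invr_gt0 //; apply: normr_pair_le => //=; rewrite subrr normr0.
  by exists (s, z.2); rewrite /dshear /= sE -surjective_pairing.
exists 2^-1; first by rewrite invr_gt0.
apply: near_everywhere => x v w.
have h := dshear_shift_lip x v w.
have d1 := normr_fst_le (dshear x v - dshear x w).
have d2 := normr_snd_le (dshear x v - dshear x w).
rewrite /= in d1 d2.
suff : `|v - w| <= `|dshear x v - dshear x w| + 2^-1 * `|v - w| by lra.
apply: normr_pair_le => /=; last first.
  by apply: (le_trans d2); rewrite lerDl mulr_ge0 // invr_ge0.
have -> : v.1 - w.1 = (v.1 + dshear_shift x v - (w.1 + dshear_shift x w)) - (dshear_shift x v - dshear_shift x w).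
  by ring.
by apply: (le_trans (ler_normB _ _)); apply: lerD.
Qed.

Lemma shear_inj : injective shear.
Proof.
move=> x y E; have E1 : x.1 + shear_shift x = y.1 + shear_shift y by have := congr1 fst E.
have E2 : x.2 = y.2 by have := congr1 snd E.
have h := shear_shift_lip x y.
have n : `|x - y| <= `|x.1 - y.1| by apply: normr_pair_le => //=; rewrite E2 subrr normr0.
have : `|x.1 - y.1| <= 2^-1 * `|x - y|.
  by rewrite (_ : x.1 - y.1 = - (shear_shift x - shear_shift y)) ?normrN //; lra.
move=> h2; have n0 : `|x.1 - y.1| <= 0 by have := normr_ge0 (x.1 - y.1); lra.
move: n0; rewrite normr_le0 subr_eq0 => /eqP E3.
by rewrite (surjective_pairing x) (surjective_pairing y) E2 E3.
Qed.

Lemma shear_surj y : exists x, shear x = y.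
Proof.
have [|s sE] := @perturbed_id_surj (fun s => shear_shift (s, y.2)) _ y.1.
  move=> s t; apply: (le_trans (shear_shift_lip (s, y.2) (t, y.2))).
  by rewrite ler_pM2l ?invr_gt0 //; apply: normr_pair_le => //=; rewrite subrr normr0.
by exists (s, y.2); rewrite /shear /= sE -surjective_pairing.
Qed.

Lemma shear_out x : 1 <= `|x| -> shear x = x.
Proof.
rewrite prod_normE le_max => x1; rewrite [RHS]surjective_pairing /shear /shear_shift.
suff -> : hom (gosc x.1, gosc x.2) = 0 by rewrite mulr0 addr0.
by case/orP: x1 => /gosc_out ->; rewrite /hom /= ?expr0n /= ?mulr0 !mul0r.
Qed.

Lemma shear_inverse : exists G, supported shear G.
Proof.
have [G [FG GF]] := inj_surj_inverse shear_inj shear_surj.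
exists G; apply: inverse_supported => //; last exact: shear_out.
by move=> x; exact: dirC1_continuous (dirC1_shear x).
Qed.

(** At (z, z) with g z = 0, the first component of the directional derivative in
    the direction v is v.1 + g' z * hom v / 64.  If it were linear in v, then
    [hom] would be additive on (1, 0) + (0, 1). *)
Lemma shear_not_differentiable n (F : plane R -> plane R) :
  (\forall y \near (zero_osc R n, zero_osc R n), F y = shear y) ->
  ~ differentiable F (zero_osc R n, zero_osc R n).
Proof.
set x := zero_osc R n; set p := (x, x) => FE dF.
have DE v : 'd F p v = dshear p v.
  pose l (s : R) := p + s *: v.
  have dl : is_derive (0 : R) (1 : R) l v := is_derive_line _ _.
  have l0 : l 0 = p by rewrite /l scale0r addr0.
  have d1 : is_derive (0 : R) (1 : R) (F \o l) ('d F (l 0) v).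
    by apply: differentiable_path_chain dl; rewrite l0.
  have d2 : is_derive (0 : R) (1 : R) (shear \o l) (dshear (l 0) v).
    by apply: path_chain dl; exact: dirC1_shear.
  rewrite l0 in d1 d2; apply: (is_derive_unique d1); apply: (is_derive_near _ d2).
  have H : \forall y \near l 0, F y = shear y by rewrite l0.
  have H' : \forall s \near (0 : R), F (l s) = shear (l s) := @continuous_line _ _ _ _ _ H.
  by apply: filterS H' => s /= ->.
have A : dshear p ((1, 0) + (0, 1)) = dshear p (1, 0) + dshear p (0, 1).
  by rewrite -(DE ((1, 0) + (0, 1))) -(DE (1, 0)) -(DE (0, 1)) linearD.
have := congr1 fst A; rewrite /dshear /dshear_shift /= /x gosc_zero !dhom0.
rewrite /hom /= !mul0r !add0r !addr0 !mul1r expr0n /= !mulr0 !mul0r !mulr0 !addr0.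
have g0 := dgosc_zero R n; move/eqP; rewrite -subr_eq0 addrC addKr; apply/negP.
rewrite mulf_neq0 // mulf_neq0 //.
  by rewrite mulf_neq0 // expf_neq0.
by rewrite invr_eq0 gt_eqF // nsq_gt0 //; apply/eqP => -[] /eqP; rewrite (negbTE g0).
Qed.

Lemma dir_diffeo_preserving (F : plane R -> plane R) D x :
  (forall p, dir_diffeo F D p) -> regular_preserving F x.
Proof.
move=> FD e t _ re; apply: (regular_comp (D := D) _ re).1.
apply: near_everywhere => s; have [h _ _] := FD (e s).
by split=> // v; exact: dir_diffeo_inj.
Qed.

Lemma dir_diffeo_inverse_preserving (F G : plane R -> plane R) D x :
  (forall p, dir_diffeo F D p) -> supported F G -> regular_preserving G x.
Proof.
move=> FD [FG GF cF cG F1] e t _ re.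
have E : F \o (G \o e) = e by apply/funext => s /=; rewrite GF.
have cGe : \forall s \near t, {for s, continuous (G \o e)}.
  by apply: filterS (regular_continuous re) => s h; apply: continuous_comp h _; exact: cG.
have FDe : \forall s \near t, dir_diffeo F D ((G \o e) s).
  by apply: near_everywhere => s; exact: FD.
have [|r1 r2] := regular_inverse FDe cGe; first by rewrite E.
exact: r1.
Qed.

Lemma preserving_desingularizes (F : plane R -> plane R) :
  (forall x, regular_preserving F x) -> desingularizes (@idfun R) F.
Proof.
move=> HF; split; [by []|by []|by exists idfun|by move=> x; exact: cvg_id|].
split=> [t _|e e0 re]; last exact: (HF (e 0)) re.
have -> : @idfun R = fun u => u + 0 by apply/funext => u; rewrite addr0.
exact: regular_shift.
Qed.

End Shear.

(** * An open set of directions *)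
Section TangentBundleTopology.
Variables (R : realType) (S : smoothSurface R).

(** The differential is continuous in the point for a fixed vector, and Lipschitz
    in the vector uniformly in the point. *)
Lemma C1_at_jointly (g : plane R -> plane R) (x : plane R * plane R) : C1_at g x.1 ->
  {for x, continuous (fun y : plane R * plane R => 'd g (y.1) (y.2) : plane R)}.
Proof.
case: x => a w /= g1; have [_ _ [M M0 HM] _] := C1_at_dirC1 g1.
have ca : {for a, continuous (fun y => 'd g y w : plane R)}.
  apply: continuous_near (g1.2 w); apply: filterS g1.1 => y dgy.
  exact: deriveE w dgy.
apply/cvgrPdist_le => e e0.
have e2 : 0 < e / 2 by rewrite divr_gt0.
have eM : 0 < e / 2 / M by rewrite divr_gt0.
have /cvgrPdist_le /(_ _ e2) H := ca.
have c1 : {for (a, w), continuous (@fst (plane R) (plane R))} by exact: cvg_fst.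
have H1 : \forall y \near (a, w), `|('d g a w : plane R) - 'd g (y.1) w| <= e / 2 := c1 _ H.
have H2 : \forall y \near (a, w), forall u v : plane R,
  `|('d g (y.1) u : plane R) - 'd g (y.1) v| <= M * `|u - v| := c1 _ HM.
have gen (p q r : plane R) (m : R) : `|p - q| <= e / 2 -> `|q - r| <= e / 2 -> `|p - r| <= e.
  by move=> h1 h2; rewrite -(subrKA q) (le_trans (ler_normD _ _)) // (splitr e) lerD.
apply: filterS3 H1 H2 (near_norm_lt (a, w) eM) => y h1 h2 h3.
apply: (gen _ _ _ 0 h1); apply: (le_trans (h2 _ _)).
rewrite -ler_pdivlMl // mulrC distrC; apply: le_trans (ltW h3).
exact: (normr_snd_le (y - (a, w))).
Qed.

(** A neighbourhood of the direction (1, 1) that is small enough to exclude the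
    images of this direction under the differentials of the radial map; see
    [dradial_leaves_cone]. *)
Definition cone (w : plane R) : Prop := `|w.1| < 2 * `|w.2|.

Lemma cone_scale a w : cone (a *: w) -> cone w.
Proof.
rewrite /cone /= /GRing.scale /= !normrM => h.
have a0 : 0 < `|a|.
  rewrite normr_gt0; apply: contraTneq h => ->.
  by rewrite normr0 !mul0r mulr0 ltxx.
by rewrite -(ltr_pM2l a0) mulrCA.
Qed.

Lemma scale_cone a w : a != 0 -> cone w -> cone (a *: w).
Proof.
move=> a0 h; apply: (@cone_scale a^-1).
by rewrite scalerA mulVf // scale1r.
Qed.

Lemma cone_open w : cone w -> \forall u \near w, cone u.
Proof.
rewrite /cone => h; have d0 : 0 < (2 * `|w.2| - `|w.1|) / 4 by lra.
apply: filterS (near_norm_lt w d0) => u uw.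
have h1 := le_lt_trans (normr_fst_le (u - w)) uw.
have h2 := le_lt_trans (normr_snd_le (u - w)) uw.
have k1 : `|u.1| <= `|w.1| + `|(u - w).1|.
  by rewrite -[u.1](subrKC w.1) ler_normD.
have k2 : `|w.2| <= `|u.2| + `|(u - w).2|.
  by have := ler_normB u.2 (u - w).2; rewrite /= subKr.
lra.
Qed.

Definition cone_set (i : atlas_index S) : set (PTangent S) := [set Q |
  exists (hi : cdom (atlas i) (pt_base Q)) (v : tangent (pt_base Q)),
    pline (pt_line Q) v /\ cone (v (exist _ i hi))].

(** In another chart the condition bears on the differential of the change of
    charts, and this is jointly continuous in the point and the vector. *)
Lemma cone_set_open i0 : pt_open (cone_set i0).
Proof.
move=> i [p L] x [hi0 [v [Lv Cv]]] [hi [v1 [Lv1 v10 ->]]] /=.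
rewrite /= in hi0 v Lv Cv hi v1 Lv1 v10 *.
have [a aE] := line_parallel Lv1 v10 Lv.
have Cv1 : cone (v1 (exist _ i0 hi0)).
  by apply: (@cone_scale a); rewrite -tangent_scaleE -aE.
have tau (q : S) (u : tangent q) (h : cdom (atlas i) q) (h0 : cdom (atlas i0) q) :
    u (exist _ i0 h0) = 'd (transition (atlas i) (atlas i0)) (atlas i q) (u (exist _ i h)).
  by have /asboolP H := tcoordP u; exact: H.
have C1t : C1_at (transition (atlas i) (atlas i0)) (atlas i p).
  exact: (atlas_compatible hi hi0).1.
have cj := @C1_at_jointly (transition (atlas i) (atlas i0))
  (atlas i p, v1 (exist _ i hi)) C1t.
have Cx : cone ('d (transition (atlas i) (atlas i0)) (atlas i p) (v1 (exist _ i hi))).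
  by rewrite -(tau _ _ hi hi0).
have H1 : \forall y \near (atlas i p, v1 (exist _ i hi)),
   cone ('d (transition (atlas i) (atlas i0)) (y.1) (y.2)) := cj _ (cone_open Cx).
have ci : {for atlas i p, continuous (cinv (atlas i))} := cinv_continuous hi.
have d0 : \forall q \near cinv (atlas i) (atlas i p), cdom (atlas i0) q.
  by rewrite cmapK //; exact: cdom_near.
have d1 : \forall y \near atlas i p, cdom (atlas i0) (cinv (atlas i) y) := ci _ d0.
have c1 : {for (atlas i p, v1 (exist _ i hi)), continuous (@fst (plane R) (plane R))}.
  exact: cvg_fst.
have H2 : \forall y \near (atlas i p, v1 (exist _ i hi)),
  cdom (atlas i0) (cinv (atlas i) y.1) := c1 _ d1.
apply: filterS2 H1 H2 => y Cy dy [q M] [hq [u [Mu u0 yE]]]; rewrite /= in hq u Mu u0 yE.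
rewrite yE /= cmapK // in dy; rewrite yE /= in Cy.
by exists dy, u; split=> //=; rewrite (tau _ _ hq dy).
Qed.

End TangentBundleTopology.

(** * Local models of a map *)
Section LocalModel.
Variables (R : realType) (S : smoothSurface R) (i0 : atlas_index S).
Variables (a : plane R) (r : R).
Hypothesis r0 : 0 < r.
Local Notation c0 := (atlas i0).
Local Notation N := (rescale a r0 c0).

Lemma rescale_atlas_compatible : compatible N.
Proof. exact: rescale_compatible (@atlas_compatible _ S i0). Qed.

Lemma coord_rescale p (v : tangent p) w (hi : cdom c0 p) :
  coord N v w -> v (exist _ i0 hi) = r *: w.
Proof.
move=> vw; rewrite vw /=.
have [C1 _] := rescale_atlas_compatible (hi : cdom N p) hi.
pose l (s : R) := N p + s *: w.
have l0 : l 0 = N p by rewrite /l scale0r addr0.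
have dl : is_derive (0 : R) (1 : R) l w := is_derive_line _ _.
have cl : {for 0, continuous l} := @continuous_line _ _ _ _.
have d1 : is_derive (0 : R) (1 : R) (transition N c0 \o l) ('d (transition N c0) (N p) w).
  have H := C1_at_dirC1 C1; rewrite -l0 in H *.
  exact: path_chain H dl.
have daff : dirC1 (aff a r) (fun _ v => 0 + (r *: v)) (l 0).
  apply: dirC1_add; first exact: dirC1_cst.
  by apply: (@dirC1_linear _ _ _ ( *:%R r) r) => // u; rewrite normrZ gtr0_norm.
have d2 := path_chain daff dl; rewrite add0r in d2.
apply: (is_derive_unique d1); apply: (is_derive_near _ d2).
have H : \forall x \near l 0, (N @` cdom N) x.
  by rewrite l0; exact: (cimg_near (hi : cdom N p)).
have H' : \forall s \near (0 : R), (N @` cdom N) (l s) := cl _ H.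
apply: filterS H' => s [q cq qE]; rewrite /= -qE transitionE // /= affinvK //.
Qed.

Variable f : S -> S.
Variable F : plane R -> plane R.

Definition local_model (p : S) : Prop :=
  \forall q \near p, [/\ cdom N q, cdom N (f q) & N (f q) = F (N q)].

Lemma not_differentiable_model p : local_model p ->
  (forall Phi : plane R -> plane R, (\forall y \near N p, Phi y = F y) ->
     ~ differentiable Phi (N p)) ->
  ~ differentiable_at f p.
Proof.
move=> fF nF [_ df]; have [cp cfp _] := nbhs_singleton fF.
have d := df i0 i0 cp cfp.
have E : aff a r (N p) = c0 p by rewrite /= affinvK.
rewrite -E in d.
have [d1 _] := @derive_comp_aff R a r _ _ 0 d.
have [d2 _] := @derive_affinv_comp R a r _ _ 0 d1.
apply: (nF _ _ d2).
have cN := cinv_continuous (cp : cdom N p).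
have H : \forall q \near cinv N (N p), [/\ cdom N q, cdom N (f q) & N (f q) = F (N q)].
  by rewrite cmapK.
have H' : \forall y \near N p, [/\ cdom N (cinv N y), cdom N (f (cinv N y)) &
    N (f (cinv N y)) = F (N (cinv N y))] := cN _ H.
apply: filterS2 H' (cimg_near (cp : cdom N p)) => y [_ _ h] cy.
have [_ yE] := chart_image_inv cy; rewrite yE in h.
by rewrite -h.
Qed.

End LocalModel.

Section RadialProperties.
Variable R : realType.

Lemma dradial0 v : dradial (0 : plane R) v = 0.
Proof. by rewrite /dradial scaler0 addr0 /nsq /dot !mul0r addr0 phi0 scale0r. Qed.

(** The differential of [radial] at 0 is 0.  If its inverse had a differential at
    0, then the chain rule would give 0 as the differential of the identity. *)
Lemma radial_inverse_not_differentiable (G : plane R -> plane R) :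
  supported (@radial R) G ->
  forall Phi : plane R -> plane R, (\forall y \near (0 : plane R), Phi y = G y) ->
    ~ differentiable Phi (0 : plane R).
Proof.
move=> AG Phi PG dP; pose l (s : R) : plane R := 0 + s *: (1, 0).
have dl : is_derive (0 : R) (1 : R) l (1, 0) := is_derive_line _ _.
have l0 : l 0 = 0 by rewrite /l scale0r addr0.
have d1 : is_derive (0 : R) (1 : R) (Phi \o l) ('d Phi (l 0) (1, 0)).
  by apply: differentiable_path_chain dl; rewrite l0.
have d2 := path_chain (dirC1_radial _) d1.
have P0 : (Phi \o l) 0 = 0.
  by rewrite /= l0 (nbhs_singleton PG) (radial_inverse_zero AG).
rewrite P0 dradial0 in d2.
have [_ GF _ _ _] := AG.
have H : \forall y \near l 0, Phi y = G y by rewrite l0.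
have H' : \forall s \near (0 : R), Phi (l s) = G (l s) := @continuous_line _ _ _ _ _ H.
have d3 : is_derive (0 : R) (1 : R) (@radial R \o (Phi \o l)) (1, 0).
  by apply: (is_derive_near _ dl); apply: filterS H' => s /= ->; rewrite GF.
have [/eqP] := is_derive_unique d2 d3; by rewrite eq_sym oner_eq0.
Qed.

(** The image of (1, 1) is s^2 (6 - 5 s^2, 2 - s^2), which is close to the direction
    (3, 1). *)
Lemma dradial_leaves_cone s : s != 0 -> `|s| < 2^-1 ->
  dradial ((s, 0) : plane R) (1, 1) != 0 /\ ~ cone (dradial ((s, 0) : plane R) (1, 1)).
Proof.
move=> s0 s1; have s2 : s ^+ 2 <= 4^-1.
  rewrite -(real_normK (num_real s)).
  by have := normr_ge0 s; rewrite expr2 => n0; nra.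
have sp : 0 < s ^+ 2 by rewrite exprn_even_gt0.
have nE : nsq ((s, 0) : plane R) = s ^+ 2 by rewrite /nsq /dot /= mulr0 addr0 expr2.
have n1 : s ^+ 2 <= 1 by lra.
have dE : dradial ((s, 0) : plane R) (1, 1) = (s ^+ 2 * (6 - 5 * s ^+ 2), s ^+ 2 * (2 - s ^+ 2)).
  rewrite /dradial nE (phi_le1 n1) (dphi_le1 n1) [LHS]surjective_pairing.
  by rewrite /dot /= /GRing.scale /=; congr (_, _); ring.
rewrite dE; have k2 : 0 < s ^+ 2 * (2 - s ^+ 2) by rewrite mulr_gt0 //; lra.
have k1 : 0 < s ^+ 2 * (6 - 5 * s ^+ 2) by rewrite mulr_gt0 //; lra.
split; first by apply/eqP => -[_ /eqP]; rewrite gt_eqF.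
rewrite /cone /= (gtr0_norm k1) (gtr0_norm k2) => /lt_geF /negbT /negP; apply.
by rewrite mulrCA ler_pM2l //; lra.
Qed.

End RadialProperties.

Section RadialModel.
Variables (R : realType) (S : smoothSurface R) (i0 : atlas_index S).
Variables (a : plane R) (r : R).
Hypothesis r0 : 0 < r.
Local Notation c0 := (atlas i0).
Local Notation N := (rescale a r0 c0).
Variable f : S -> S.
Hypothesis cf : continuous f.

Lemma radial_model_pushforward p : local_model i0 a r0 f (@radial R) p -> N p = 0 ->
  exists D : tangent p -> tangent (f p), is_pushforward f p D /\ forall v, D v = 0.
Proof.
move=> fp Np; have [cp _ _] := nbhs_singleton fp.
have NC : compatible N := @rescale_atlas_compatible _ _ _ _ _ r0.
exists (fun _ => 0); split=> // v e _ ev.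
have [e0E ce de] := ev.
have cfe : {for 0, continuous (f \o e)} := continuous_comp ce (@cf _).
have [w dw vw] := velocity_coord NC cp ev.
have me : \forall s \near (0 : R),
    [/\ cdom N (e s), cdom N (f (e s)) & N (f (e s)) = radial (N (e s))].
  have H : \forall x \near e 0, [/\ cdom N x, cdom N (f x) & N (f x) = radial (N x)].
    by rewrite e0E.
  exact: (ce _ H).
have dF : is_derive (0 : R) (1 : R) (@radial R \o (N \o e)) (dradial (N (e 0)) w).
  by apply: path_chain dw; exact: dirC1_radial.
rewrite e0E Np dradial0 in dF.
have dNf : is_derive (0 : R) (1 : R) (N \o (f \o e)) 0.
  by apply: (is_derive_near _ dF); apply: filterS me => s [_ _ /= ->].
have cfe0 : cdom N ((f \o e) 0) by have [] := nbhs_singleton me.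
have fe0 : (f \o e) 0 = f p by rewrite /= e0E.
split=> // i; rewrite tangent0E.
have ifp : cdom (chart_at i) ((f \o e) 0) by rewrite fe0; exact: svalP i.
have := path_chain_chart cfe cfe0 (NC (sval i) _ cfe0 ifp).1 dNf.
by rewrite linear0.
Qed.

(** Take the directions (1, 1) at the points with coordinates (s, 0): they tend to
    the direction (1, 1) at p, which is fixed and belongs to the open set
    [cone_set], while their images do not. *)
Lemma radial_model_dbar_discontinuous p : big_chart N ->
  (forall z, cdom N z -> `|N z| < 1 -> local_model i0 a r0 f (@radial R) z) ->
  (forall A, C1_curve A -> C1_curve (f @` A)) ->
  cdom N p -> N p = 0 -> (forall P : PTangent S, pt_base P = p -> dbar f P = P) ->
  ~ continuous (dbar f).
Proof.
move=> bN fz fC cp Np dbarp cont.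
have w0 : (1, 1) != 0 :> plane R by apply/eqP => -[/eqP]; rewrite oner_eq0.
have [v0 v0w] := coord_exists bN.1 (1, 1) cp.
have v00 := coord_neq0_tangent bN.1 cp v0w w0.
pose P0 := PTPoint (line_of v00).
have C11 : cone (r *: (1, 1) : plane R).
  by apply: scale_cone; rewrite ?gt_eqF // /cone /= normr1 mulr1 ltrDl.
have O0 : cone_set i0 P0.
  exists cp, v0; split; first exact: line_of_mem.
  by rewrite (coord_rescale cp v0w).
have nO : nbhs (dbar f P0) (cone_set i0 : set (PTangent S)).
  apply: open_nbhs_nbhs; split; first exact: cone_set_open.
  by rewrite dbarp.
have := cont P0 _ nO; rewrite nbhsE => -[U [oU U0] Usub].
have P0x : pt_coord i0 P0 (c0 p, r *: (1, 1)).
  exists cp, v0; split=> //; first exact: line_of_mem.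
  by rewrite (coord_rescale cp v0w).
have near_x := oU i0 P0 _ U0 P0x.
pose y s : plane R * plane R := (aff a r (s, 0), r *: (1, 1)).
have cy : {for 0, continuous y}.
  have c1 : {for 0, continuous (fun s : R => ((s, 0) : plane R))}.
    exact: (cvg_pair cvg_id (cvg_cst _)).
  have c2 : {for 0, continuous (fun s : R => aff a r (s, 0))}.
    apply: (continuous_comp c1); exact: continuous_aff.
  exact: (cvg_pair c2 (cvg_cst _)).
have y0 : y 0 = (c0 p, r *: (1, 1)).
  by rewrite /y -[(0, 0)]/(0 : plane R) -Np /= affinvK.
have Uy : \forall s \near (0 : R), forall Q, pt_coord i0 Q (y s) -> U Q.
  have near_y : \forall z \near y 0, forall Q, pt_coord i0 Q z -> U Q by rewrite y0.
  exact: (cy _ near_y).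
have /near_normP[e e0 He] := Uy.
pose s := Num.min (e / 2) 4^-1.
have s0 : 0 < s by rewrite lt_min divr_gt0 //= invr_gt0.
have s4 : s <= 4^-1 by rewrite ge_min lexx orbT.
have se : s <= e / 2 by rewrite ge_min lexx.
have ns : `|s| = s by rewrite gtr0_norm.
have s1 : `|(s, 0) : plane R| < 1 by apply: normr_pair_lt => /=; rewrite ?normr0 ?ns //; lra.
have [|z cz zE] := bN.2 (s, 0); first by apply: lt_trans s1 _; rewrite ltrDl.
have [vz vzw] := coord_exists bN.1 (1, 1) cz.
have vz0 := coord_neq0_tangent bN.1 cz vzw w0.
pose Q := PTPoint (line_of vz0).
have UQ : U Q.
  apply: (He s); first by rewrite subr0 ns; lra.
  exists cz, vz; split=> //; first exact: line_of_mem.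
  by rewrite /y -zE /= affinvK // (coord_rescale cz vzw).
have [hi [v' [Lv' Cv']]] := Usub _ UQ.
have [D0 nD] := @dradial_leaves_cone R s (lt0r_neq0 s0) (ltac:(rewrite ns; lra)).
rewrite -zE in D0 nD.
have mz : local_model i0 a r0 f (@radial R) z by apply: fz cz _; rewrite zE.
have [_ cfz _] := nbhs_singleton mz.
have mz' : \forall x \near z, N (f x) = radial (N x).
  by apply: filterS mz => x [].
have [M [v2 [b [ME vD Mb b0]]]] := dbar_derivative bN.1 cz cfz (@cf z) mz'
  (dirC1_radial _) D0 vzw vz0 (line_of_mem vz0) fC
  (tangent_line_exists bN.1 cz vzw vz0 (line_of_mem vz0)).
move: hi v' Lv' Cv'; rewrite /Q ME /= => hi v' Lv' Cv'.
have [d dE] := line_parallel Mb b0 Lv'.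
apply: nD; apply: (@cone_scale _ (d * b * r)).
move: Cv'; rewrite dE scalerA tangent_scaleE (coord_rescale hi vD).
by rewrite scalerA.
Qed.

End RadialModel.

(** * The construction *)
Theorem proposition2 (R : realType) (S : smoothSurface R) :
  exists (f : S -> S) (p1 p2 : S) (q : nat -> S),
    [/\ Homeo1 f, ~ Diff1 f & injective q] /\
    [/\ [/\ f p1 = p1,
            forall P : PTangent S, pt_base P = p1 -> dbar f P = P
          & ~ differentiable_at f p1],
        exists D : tangent p2 -> tangent (f p2),
          is_pushforward f p2 D /\ forall v, D v = 0,
        ~ continuous (dbar f)
      & forall n, ~ differentiable_at f (q n)].
Proof.
have [p0 _] := surface_inhabited S.
have [i0 i0p0] := atlas_cover p0.
pose c0 := atlas i0.
have /near_normP[d d0 Hd] := cimg_near i0p0.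
(* The squares of radius 2 r around the centres at 0, 4 r and - 4 r lie within
   6 r < d of the base point. *)
pose r := d / 8; have r0 : 0 < r by rewrite divr_gt0.
pose ctr (k : R) : plane R := c0 p0 + (4 * r * k, 0).
pose N k := rescale (ctr k) r0 c0.
have NbC k : `|k| <= 1 -> big_chart (N k).
  move=> k1; split; first exact: rescale_atlas_compatible.
  move=> x x2.
  have [q cq qE] : (c0 @` cdom c0) (aff (ctr k) r x).
    apply: Hd; have -> : aff (ctr k) r x - c0 p0 = (4 * r * k, 0) + r *: x.
      by rewrite /aff /ctr addrAC [c0 p0 + _]addrC addrK.
    rewrite (le_lt_trans (ler_normD _ _)) // normrZ gtr0_norm //.
    have h1 : `|(4 * r * k, 0) : plane R| <= 4 * r.
      apply: normr_pair_le => /=; last by rewrite normr0 mulr_ge0 // ltW.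
      by rewrite normrM [`|4 * r|]gtr0_norm ?mulr_gt0 // ler_piMr // mulr_ge0 // ltW.
    have h2 : r * `|x| < r * 2 by rewrite ltr_pM2l.
    have dr : d = 8 * r by rewrite /r; field.
    rewrite dr; lra.
  by exists q => //=; rewrite qE affK.
have b0 := NbC 0; have b1 := NbC 1; have b2 := NbC (-1).
rewrite normr0 in b0; rewrite normr1 in b1; rewrite normrN1 in b2.
have {}b0 := b0 ler01; have {}b1 := b1 (lexx _); have {}b2 := b2 (lexx _).
(* Two centres are at least 4 apart in the rescaled coordinates, so the unit
   squares around them are disjoint. *)
have far k l q : 1 <= `|k - l| -> `|N k q| < 1 -> 1 <= `|N l q|.
  move=> kl kq; have E : N l q = N k q + (4 * (k - l), 0).
    rewrite /= /affinv /ctr [RHS]surjective_pairing [LHS]surjective_pairing /= /GRing.scale /=.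
    by congr (_, _); field; rewrite gt_eqF.
  have h4 : 4 <= `|(4 * (k - l), 0) : plane R|.
    apply: le_trans (normr_fst_le ((4 * (k - l), 0) : plane R)) => /=.
    by rewrite normrM [`|4|]gtr0_norm // ler_peMr.
  have := ler_normB (N l q) (N k q); rewrite {1}E [N k q + _]addrC addrK => h.
  have := le_trans h4 h; lra.
have [G AG] := radial_inverse R.
have GA := supported_sym AG.
have [G' SG] := shear_inverse R.
have [l [sl ls cl l1 l0]] := sigma_inverse R.
have desA := radial_desingularizes sl ls cl l1 l0.
have desG := radial_inverse_desingularizes AG.
have Gpres x : x != 0 -> regular_preserving G x.
  by move=> x0 e t et re; apply: (radial_inverse_path AG _ re).1; rewrite et.
have shp x : regular_preserving (@shear R) x.
  exact: dir_diffeo_preserving (@shear_dir_diffeo R).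
have shp' x : regular_preserving G' x.
  exact: dir_diffeo_inverse_preserving (@shear_dir_diffeo R) SG.
(* f0 is responsible for the zero pushforward and the discontinuity of dbar f, f1
   for the behaviour at p1 and f2 for that at the points q n. *)
pose f0 := transfer (N 0) (@radial R).
pose f1 := transfer (N 1) G.
pose f2 := transfer (N (-1)) (@shear R).
have H0 : Homeo1 f0.
  apply: (transfer_Homeo1 b0 AG _ Gpres desA desG).
  by move=> x x0; exact: radial_preserving.
have H1 : Homeo1 f1.
  apply: (transfer_Homeo1 b1 GA Gpres _ desG desA).
  by move=> x x0; exact: radial_preserving.
have H2 : Homeo1 f2.
  apply: (transfer_Homeo1 b2 SG _ _ (preserving_desingularizes shp) (preserving_desingularizes shp')).
    by move=> x _; exact: shp.
  by move=> x _; exact: shp'.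
pose f := f0 \o (f1 \o f2).
have Hf : Homeo1 f := Homeo1_comp H0 (Homeo1_comp H1 H2).
have [g [_ _ cf _ fC]] := Hf.
have model k F F' p : big_chart (N k) -> supported F F' ->
    (forall q, cdom c0 q -> `|N k q| < 1 -> f q = transfer (N k) F q) ->
    cdom c0 p -> `|N k p| < 1 -> local_model i0 (ctr k) r0 f F p.
  move=> bk FF' fk cp kp.
  have ck : {for p, continuous (fun q => `|N k q|)}.
    apply: (continuous_comp (f := N k)); last exact: norm_continuous.
    exact: cmap_continuous (cp : cdom (N k) p).
  have lt1 : \forall q \near p, `|N k q| < 1.
    have e0 : 0 < 1 - `|N k p| by rewrite subr_gt0.
    have /cvgrPdist_lt /(_ _ e0) := ck; apply: filterS => q; rewrite ltr_norml => /andP[h1 h2].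
    lra.
  apply: filterS2 lt1 (cdom_near (cp : cdom c0 p)) => q q1 cq.
  have [h1 h2] := transfer_dom bk FF' (cq : cdom (N k) q).
  by rewrite (fk q cq q1).
have f0E q : cdom c0 q -> `|N 0 q| < 1 -> f q = f0 q.
  move=> cq q1; rewrite /f /= [f2 q](transfer_id SG) //; last first.
    by apply: (far 0) => //; rewrite opprK add0r normr1.
  rewrite [f1 q](transfer_id GA) //.
  by apply: (far 0) => //; rewrite sub0r normrN normr1.
have inside k F F' q : big_chart (N k) -> supported F F' -> cdom c0 q -> `|N k q| < 1 ->
    cdom c0 (transfer (N k) F q) /\ `|N k (transfer (N k) F q)| < 1.
  move=> bk FF' cq q1; have [h1 h2] := transfer_dom bk FF' (cq : cdom (N k) q).
  by split=> //; rewrite h2; exact: supported_lt1 FF' q1.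
have f1E q : cdom c0 q -> `|N 1 q| < 1 -> f q = f1 q.
  move=> cq q1; rewrite /f /= [f2 q](transfer_id SG) //; last first.
    by apply: (far 1) => //; rewrite opprK gtr0_norm ?addr_gt0 // lerDl.
  have [h1 h2] := inside 1 G _ q b1 GA cq q1.
  by apply: (transfer_id AG) => //; apply: (far 1) => //; rewrite subr0 normr1.
have f2E q : cdom c0 q -> `|N (-1) q| < 1 -> f q = f2 q.
  move=> cq q1; rewrite /f /=.
  have [h1 h2] := inside (-1) _ _ q b2 SG cq q1.
  have E : f1 (f2 q) = f2 q.
    apply: (transfer_id GA) => //; apply: (far (-1)) => //.
    by rewrite -opprD normrN gtr0_norm ?addr_gt0 // lerDl.
  rewrite E; apply: (transfer_id AG) => //; apply: (far (-1)) => //.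
  by rewrite subr0 normrN1.
have point k x : big_chart (N k) -> `|x| < 2 -> exists2 p, cdom c0 p & N k p = x.
  by move=> bk x2; have [p cp pE] := bk.2 x x2; exists p.
have [p1 cp1 p1E] : exists2 p, cdom c0 p & N 1 p = 0.
  by apply: point b1 _; rewrite normr0.
have [p2 cp2 p2E] : exists2 p, cdom c0 p & N 0 p = 0.
  by apply: point b0 _; rewrite normr0.
have xn2 n : `|(zero_osc R n, zero_osc R n)| < 1.
  by apply: normr_pair_lt; rewrite /= gtr0_norm ?zero_osc_gt0 ?zero_osc_lt1.
have /choice[q qP] : forall n, exists p, cdom c0 p /\ N (-1) p = (zero_osc R n, zero_osc R n).
  move=> n; have [|p cp pE] := point (-1) (zero_osc R n, zero_osc R n) b2; last by exists p.
  by apply: lt_trans (xn2 n) _; rewrite ltrDl.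
have lt1 : `|(0 : plane R)| < 1 by rewrite normr0.
have m1 : local_model i0 (ctr 1) r0 f G p1.
  by apply: model GA f1E cp1 _; rewrite ?p1E.
have m2 : local_model i0 (ctr 0) r0 f (@radial R) p2.
  by apply: model AG f0E cp2 _; rewrite ?p2E.
have m3 n : local_model i0 (ctr (-1)) r0 f (@shear R) (q n).
  by apply: model SG f2E (qP n).1 _; rewrite ?(qP n).2.
have fix_of k p x : cdom c0 p -> cdom c0 x -> N k x = N k p -> x = p.
  move=> cp cx E; have := cmapK (cx : cdom (N k) x); rewrite E.
  by rewrite (cmapK (cp : cdom (N k) p)).
have fp1 : f p1 = p1.
  have [_ c1 E] := nbhs_singleton m1; apply: (fix_of 1) => //.
  by rewrite E p1E radial_inverse_zero.
have fp2 : f p2 = p2.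
  have [_ c1 E] := nbhs_singleton m2; apply: (fix_of 0) => //.
  by rewrite E p2E radial0.
have nd1 : ~ differentiable_at f p1.
  apply: (not_differentiable_model m1); rewrite p1E.
  exact: radial_inverse_not_differentiable AG.
have neq0 k p x : cdom c0 p -> cdom c0 x -> N k p = 0 -> x != p -> N k x != 0.
  move=> cp cx pE; apply: contra_neq => xE; apply: (fix_of k) => //.
  by rewrite xE pE.
have dbar1 (P : PTangent S) : pt_base P = p1 -> dbar f P = P.
  apply: (@dbar_radial R S (N 1) b1.1 f p1
    (fun x => (phi (nsq (G (N 1 x))))^-1) cp1 fp1 (cf p1)).
  apply: filterS m1 => x [cx _ xE] xp1.
  have Nx : N 1 x != 0 := neq0 1 p1 x cp1 cx p1E xp1.
  have ph : phi (nsq (G (N 1 x))) != 0.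
    by rewrite gt_eqF // phi_gt0 // nsq_gt0 // (radial_inverse_neq0 AG).
  split; first by rewrite invr_neq0.
  rewrite xE p1E !subr0; have [_ GF _ _ _] := AG.
  by rewrite -{3}(GF (N 1 x)) /radial scalerA mulVf // scale1r.
have dbar2 (P : PTangent S) : pt_base P = p2 -> dbar f P = P.
  apply: (@dbar_radial R S (N 0) b0.1 f p2
    (fun x => phi (nsq (N 0 x))) cp2 fp2 (cf p2)).
  apply: filterS m2 => x [cx _ xE] xp2.
  have Nx : N 0 x != 0 := neq0 0 p2 x cp2 cx p2E xp2.
  split; first by rewrite gt_eqF // phi_gt0 // nsq_gt0.
  by rewrite xE p2E !subr0.
exists f, p1, p2, q; split; split.
- exact: Hf.
- move=> [h [_ _ [_ fD] _]]; apply: nd1; split; first exact: cf.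
  by move=> i j ip jfp; have [H _] := fD i j; apply: H; exists p1.
- move=> m n mn; have E := (qP m).2; rewrite mn (qP n).2 in E.
  exact: (@zero_osc_inj R _ _ (esym (congr1 fst E))).
- by split.
- exact: (@radial_model_pushforward _ _ _ _ _ r0 f cf p2 m2 p2E).
- apply: (radial_model_dbar_discontinuous cf b0 _ _ cp2 p2E dbar2); last by move=> A /fC[].
  by move=> z cz z1; exact: (model 0 _ _ _ b0 AG f0E).
- move=> n; apply: (not_differentiable_model (m3 n)).
  by rewrite (qP n).2; exact: shear_not_differentiable.
Qed.
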